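(* Let $s>1$, let $S\subset\mathbb{C}$ be an open sector with vertex at $0$, and consider the Taylor map $\mathcal{T}_{(s)}:\mathcal{O}_{(s)}(S)\to\mathbb{C}_{(s)}[[z]]$. 1. If the opening of $S$ is less than or equal to $\min\{(s-1)\pi,2\pi\}$, then $\mathcal{T}_{(s)}$ is surjective but not injective. 2. If $s<3$ and the opening of $S$ is greater than $(s-1)\pi$, then $\mathcal{T}_{(s)}$ is not surjective but is injective.
   Context: An open sector is a set $S=\{z\in\mathbb{C}:0<|z|<r,\ \eta<\arg z<\theta\}$ with $r>0$ and $0<\theta-\eta\le2\pi$; its opening is $\theta-\eta$. For another sector $S'$ with data $r',\eta',\theta'$, write $S'\subset\!\subset S$ if $0<r'<r$ and $\eta<\eta'<\theta'<\theta$. $\mathcal{O}_{(s)}(S)$ is the set of holomorphic $f$ on $S$ such that for every $S'\subset\!\subset S$ there are $M,C>0$ with $|f^{(k)}(z)|\le MC^k\,k!^{\,s}$ for all $k\ge0$, $z\in S'$. $\mathbb{C}_{(s)}[[z]]$ is the set of formal series $\sum_{k\ge0}c_kz^k$ for which there are $M,C>0$ with $|c_k|\le MC^k\,k!^{\,s-1}$ for all $k\ge0$. The Taylor map is $\mathcal{T}_{(s)}(f)=\sum_{k\ge0}\frac{a_k}{k!}z^k$, where $a_k=\lim_{z\to0,\ z\in S'}f^{(k)}(z)$ for any $S'\subset\!\subset S$ (these limits exist and do not depend on $S'$). *)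

(* Defs.v *)
From Stdlib Require Import Reals Factorial.
From Coquelicot Require Import Coquelicot.
Open Scope R_scope.

Record sector : Type := Sector {
  radius : R;
  arg_inf : R;
  arg_sup : R;
  radius_pos : 0 < radius;
  arg_bounds : 0 < arg_sup - arg_inf <= 2 * PI
}.

Definition opening (S : sector) : R := arg_sup S - arg_inf S.

(* The witness [t] ranges over all determinations of [arg z]. *)
Definition in_sector (S : sector) (z : C) : Prop :=
  0 < Cmod z < radius S /\
  exists t : R, arg_inf S < t < arg_sup S /\
    z = (Cmod z * cos t, Cmod z * sin t).

Definition subsector (S' S : sector) : Prop :=
  radius S' < radius S /\ arg_inf S < arg_inf S' /\ arg_sup S' < arg_sup S.

(* Functions on a sector are represented by total functions [C -> C] whose
   values off the sector are irrelevant; sectors being open, this does not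
   affect derivatives at their points. *)
Definition holomorphic_on (S : sector) (f : C -> C) : Prop :=
  forall z : C, in_sector S z -> ex_derive (V := C_NormedModule) f z.

(* [C_derive] is meaningful only where the complex derivative exists, which for
   all iterates is the case on the domain of a holomorphic function. *)
Definition C_derive_n (f : C -> C) (k : nat) : C -> C := Nat.iter k C_derive f.

Definition gevrey_function (s : R) (S : sector) (f : C -> C) : Prop :=
  holomorphic_on S f /\
  forall S' : sector, subsector S' S ->
    exists M A : R, 0 < M /\ 0 < A /\
      forall (k : nat) (z : C), in_sector S' z ->
        Cmod (C_derive_n f k z) <= M * A ^ k * Rpower (INR (fact k)) s.

(* A formal power series is its sequence of coefficients. *)
Definition gevrey_series (s : R) (c : nat -> C) : Prop :=
  exists M A : R, 0 < M /\ 0 < A /\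
    forall k : nat, Cmod (c k) <= M * A ^ k * Rpower (INR (fact k)) (s - 1).

(* The common limit at 0 of the [k]-th derivative along all proper subsectors;
   it exists and is unique for every [f] satisfying [gevrey_function]. *)
Definition derivative_at_vertex (S : sector) (f : C -> C) (k : nat) : C :=
  iota (T := C_CompleteNormedModule) (fun a : C =>
    forall S' : sector, subsector S' S ->
      filterlim (C_derive_n f k)
        (within (in_sector S') (locally (T := C_UniformSpace) (RtoC 0)))
        (locally (T := C_UniformSpace) a)).

Definition taylor_map (S : sector) (f : C -> C) (k : nat) : C :=
  (derivative_at_vertex S f k / RtoC (INR (fact k)))%C.

Definition taylor_surjective (s : R) (S : sector) : Prop :=
  forall c : nat -> C, gevrey_series s c ->
    exists f : C -> C, gevrey_function s S f /\
      forall k : nat, taylor_map S f k = c k.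

(* Two functions are equal as elements of the source when they agree on [S]. *)
Definition taylor_injective (s : R) (S : sector) : Prop :=
  forall f g : C -> C, gevrey_function s S f -> gevrey_function s S g ->
    (forall k : nat, taylor_map S f k = taylor_map S g k) ->
    forall z : C, in_sector S z -> f z = g z.

(* Main.v *)
Require Import Defs.
From Stdlib Require Import ZArith Reals Factorial Lra Lia Psatz ClassicalEpsilon.
From Coquelicot Require Import Coquelicot.
Open Scope R_scope.

(** Write [a = s - 1]. A function of the class whose Taylor series vanishes is [O((A |z|)^n n!^a)] for every
    [n], hence [O(exp (- c |z|^(-1/a)))]; on a sector of opening greater than [a PI] the Phragmen-Lindelof
    principle and the identity theorem make it vanish.

    On such a sector, take coefficients [n!^a] on the multiples of a large [m] and [0] elsewhere. By injectivity
    on a slightly smaller sector, a function with this Taylor series is invariant under the rotation by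
    [2 PI / m]; its Fourier coefficients over arcs of opening [2 PI / m] are then independent of the radius up
    to the factor [r^k], which bounds the coefficients geometrically, a contradiction.

    On a sector of opening at most [a PI], a branch [W] of [z^(-1/a)] maps into the right half plane and
    [exp (- W)] is a nonzero function with vanishing Taylor series. A given series is summed, without Borel
    transform, by [sum_n c_n z^n E_(p n) (dl W z)] with [E_p x = 1 - e^(-x) sum_(j < p) x^j / j!], [p n] close
      to
    [a n] and [dl] small: [E_p x] is at most [|x|^p / p!], which makes the sum converge, and differs from [1] by
    an exponentially small term. Cauchy inequalities turn Gevrey asymptotics into bounds on derivatives. *)

(** * Complex derivatives *)

(** The Phragmen-Lindelof step uses finite rectangles only: a factor [exp (lambda w)] amplifies the
    value at a point against the right side of a rectangle, and letting [lambda] grow forces that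
    value to be [0]. Coefficients are hard to isolate in a sector, which contains no circle around
    the vertex; invariance lets an arc replace the circle, and the angle [2 PI / m] only has to be
    smaller than the excess of the opening over [a PI]. The factors [E_(p n)] come from a truncated
    Laplace integral: cutting the integral of [t^(a n - 1) e^(- t W)] at [dl] multiplies [z^n] by an
    incomplete gamma function of order [a n], which is elementary for the integer orders [p n].
    Hence [dl] is small like a radius inside the disc of convergence of the Borel transform, and
    [p n] close to [a n] balances [z^n] against [W^(p n)] and [n!^a] against [(p n)!]. Discs in a
    sector have radius proportional to [|z|], so the Cauchy inequalities lose [|z|^(-k) k!]; the
    factor [|z|^k] of the remainder after [k] terms pays for it. *)

Definition cderiv (f : C -> C) (z l : C) : Prop :=
  forall eps, 0 < eps -> exists del, 0 < del /\
    forall h : C, Cmod h < del ->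
      Cmod (f (z + h) - f z - l * h)%C <= eps * Cmod h.

Lemma cderiv_is_derive (f : C -> C) (z l : C) :
  is_derive (V := C_NormedModule) f z l <-> cderiv f z l.
Proof.
split.
- intros [_ H] eps He.
  specialize (H z (fun P HP => HP) (mkposreal eps He)).
  destruct H as [d Hd].
  exists d; split; [apply cond_pos|].
  intros h Hh.
  specialize (Hd (z + h)%C).
  assert (B : Cmod (z + h + - z)%C < d).
  { replace (z + h + - z)%C with h by ring; exact Hh. }
  specialize (Hd B).
  change (Cmod (f (z + h) + - f z + - ((z + h + - z) * l))%C
          <= eps * Cmod (z + h + - z)%C) in Hd.
  replace (f (z + h) - f z - l * h)%C
    with (f (z + h) + - f z + - ((z + h + - z) * l))%C by ring.
  replace (Cmod h) with (Cmod (z + h + - z)%C); [|f_equal; ring].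
  exact Hd.
- intros H.
  split; [apply is_linear_scal_l|].
  intros x Hx.
  apply (is_filter_lim_locally_unique (K := C_AbsRing) (V := AbsRing_NormedModule C_AbsRing)) in Hx.
  subst x.
  intros [eps He].
  destruct (H eps He) as [d [Hd H']].
  exists (mkposreal d Hd).
  intros y Hy; change C in y.
  specialize (H' (y - z)%C Hy).
  change (Cmod (f y + - f z + - ((y + - z) * l))%C <= eps * Cmod (y + - z)%C).
  replace (z + (y - z))%C with y in H' by ring.
  replace (f y + - f z + - ((y + - z) * l))%C with (f y - f z - l * (y - z))%C by ring.
  exact H'.
Qed.

Lemma cderiv_C_derive (f : C -> C) (z l : C) :
  cderiv f z l -> C_derive f z = l.
Proof.
intros H; apply is_C_derive_unique.
apply cderiv_is_derive in H; exact H.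
Qed.

Lemma ex_derive_cderiv (f : C -> C) (z : C) :
  ex_derive (V := C_NormedModule) f z <-> cderiv f z (C_derive f z).
Proof.
split.
- intros [l H].
  apply cderiv_is_derive in H.
  rewrite (cderiv_C_derive _ _ _ H); exact H.
- intros H; exists (C_derive f z); apply cderiv_is_derive, H.
Qed.

Lemma cderiv_ext_loc (f g : C -> C) (z l : C) (r : R) :
  0 < r -> (forall w, Cmod (w - z) < r -> f w = g w) ->
  cderiv f z l -> cderiv g z l.
Proof.
intros Hr E H eps He.
destruct (H eps He) as [d [Hd H']].
exists (Rmin d r); split; [now apply Rmin_pos|].
intros h Hh.
assert (Cmod h < d) by (eapply Rlt_le_trans; [exact Hh|apply Rmin_l]).
assert (Cmod h < r) by (eapply Rlt_le_trans; [exact Hh|apply Rmin_r]).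
rewrite <- (E (z + h)%C), <- (E z).
- now apply H'.
- replace (z - z)%C with (RtoC 0) by ring. rewrite Cmod_0; lra.
- replace (z + h - z)%C with h by ring; assumption.
Qed.

Lemma cderiv_const (c z : C) : cderiv (fun _ => c) z 0.
Proof.
intros eps He; exists 1; split; [lra|]; intros h _.
replace (c - c - 0 * h)%C with (RtoC 0) by ring.
rewrite Cmod_0. apply Rmult_le_pos; [lra|apply Cmod_ge_0].
Qed.

Lemma cderiv_id (z : C) : cderiv (fun w => w) z 1.
Proof.
intros eps He; exists 1; split; [lra|]; intros h _.
replace (z + h - z - 1 * h)%C with (RtoC 0) by ring.
rewrite Cmod_0. apply Rmult_le_pos; [lra|apply Cmod_ge_0].
Qed.

Lemma cderiv_plus (f g : C -> C) (z l m : C) :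
  cderiv f z l -> cderiv g z m -> cderiv (fun w => f w + g w)%C z (l + m)%C.
Proof.
intros Hf Hg; apply cderiv_is_derive.
apply cderiv_is_derive in Hf; apply cderiv_is_derive in Hg.
exact (is_derive_plus (V := C_NormedModule) f g z l m Hf Hg).
Qed.

Lemma cderiv_cont (f : C -> C) (z l : C) :
  cderiv f z l -> forall eps, 0 < eps -> exists del, 0 < del /\
    forall h : C, Cmod h < del -> Cmod (f (z + h) - f z)%C <= eps.
Proof.
intros H eps He.
destruct (H 1 Rlt_0_1) as [d [Hd H']].
assert (Hl := Cmod_ge_0 l).
assert (Hq : 0 < eps / (1 + Cmod l)) by (apply Rdiv_lt_0_compat; lra).
exists (Rmin d (eps / (1 + Cmod l))); split; [now apply Rmin_pos|].
intros h Hh.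
assert (H1 : Cmod h < d) by (eapply Rlt_le_trans; [exact Hh|apply Rmin_l]).
assert (H2 : Cmod h < eps / (1 + Cmod l)) by (eapply Rlt_le_trans; [exact Hh|apply Rmin_r]).
specialize (H' h H1).
replace (f (z + h) - f z)%C with ((f (z + h) - f z - l * h) + l * h)%C by ring.
eapply Rle_trans; [apply Cmod_triangle|].
rewrite Cmod_mult.
apply (Rmult_lt_compat_l (1 + Cmod l)) in H2; [|lra].
replace ((1 + Cmod l) * (eps / (1 + Cmod l))) with eps in H2 by (field; lra).
lra.
Qed.

(** As a codomain [C] carries two normed-module structures over itself, the product one and that of
    an absolute ring; the product and chain rules below are used in the second. *)
Lemma is_derive_self (f : C -> C) (z l : C) :
  is_derive (K := C_AbsRing) (V := AbsRing_NormedModule C_AbsRing) f z l <-> cderiv f z l.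
Proof.
rewrite <- cderiv_is_derive. split; intros [H1 H2]; (split; [apply is_linear_scal_l|exact H2]).
Qed.
Lemma cderiv_mult (f g : C -> C) (z l m : C) :
  cderiv f z l -> cderiv g z m ->
  cderiv (fun w => f w * g w)%C z (l * g z + f z * m)%C.
Proof.
intros Hf Hg; apply is_derive_self.
apply is_derive_self in Hf; apply is_derive_self in Hg.
exact (is_derive_mult (K := C_AbsRing) f g z l m Hf Hg Cmult_comm).
Qed.

Lemma cderiv_comp (f g : C -> C) (z l m : C) :
  cderiv f (g z) l -> cderiv g z m -> cderiv (fun w => f (g w)) z (l * m)%C.
Proof.
intros Hf Hg; apply is_derive_self.
apply is_derive_self in Hf; apply is_derive_self in Hg.
rewrite Cmult_comm.
exact (is_derive_comp (K := C_AbsRing) (V := AbsRing_NormedModule C_AbsRing) f g z l m Hf Hg).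
Qed.

Lemma cderiv_eq (f : C -> C) (z l m : C) : cderiv f z l -> l = m -> cderiv f z m.
Proof. now intros H <-. Qed.

Lemma cderiv_scal (f : C -> C) (c z l : C) :
  cderiv f z l -> cderiv (fun w => c * f w)%C z (c * l)%C.
Proof.
intros H; eapply cderiv_eq; [apply (cderiv_mult (fun _ => c) f z 0 l); [apply cderiv_const|exact H]|].
ring.
Qed.

Lemma cderiv_minus (f g : C -> C) (z l m : C) :
  cderiv f z l -> cderiv g z m -> cderiv (fun w => f w - g w)%C z (l - m)%C.
Proof.
intros Hf Hg.
apply (cderiv_ext_loc (fun w => f w + (-1) * g w)%C _ z _ 1 Rlt_0_1).
- intros w _; ring.
- eapply cderiv_eq; [apply cderiv_plus; [exact Hf|apply cderiv_scal, Hg]|ring].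
Qed.

Lemma cderiv_pow (n : nat) (z : C) :
  cderiv (fun w => w ^ n)%C z (INR n * z ^ (n - 1))%C.
Proof.
induction n as [|n IH].
- apply (cderiv_ext_loc (fun _ => RtoC 1) _ z _ 1 Rlt_0_1).
  + reflexivity.
  + eapply cderiv_eq; [apply cderiv_const|simpl; ring].
- eapply cderiv_eq; [apply (cderiv_mult (fun w => w) (fun w => w ^ n)%C z 1); [apply cderiv_id|exact IH]|].
  replace (S n - 1)%nat with n by lia.
  rewrite S_INR, RtoC_plus.
  destruct n as [|n]; [simpl; ring|].
  replace (S n - 1)%nat with n by lia.
  rewrite Cpow_S; ring.
Qed.

(** * Curves in the complex plane and the mean value inequality *)

Definition rderiv (F : R -> C) (t : R) (l : C) : Prop :=
  is_derive (fun x => Re (F x)) t (Re l) /\ is_derive (fun x => Im (F x)) t (Im l).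

Lemma Cmod_le_Rabs (z : C) : Cmod z <= Rabs (Re z) + Rabs (Im z).
Proof.
destruct z as [x y].
replace (x, y) with (RtoC x + RtoC y * Ci)%C by (unfold Cplus, Cmult, RtoC, Ci; simpl; f_equal; ring).
eapply Rle_trans; [apply Cmod_triangle|].
rewrite Cmod_mult, !Cmod_R, Cmod_Ci. simpl.
apply Req_le. f_equal; [f_equal; ring|]. rewrite Rmult_1_r. f_equal; ring.
Qed.

Lemma im_le_Cmod (z : C) : Rabs (Im z) <= Cmod z.
Proof.
replace (Rabs (Im z)) with (Rabs (Re (z * Ci)%C)).
- eapply Rle_trans; [apply re_le_Cmod|]. rewrite Cmod_mult, Cmod_Ci. lra.
- rewrite re_mult_Ci. apply Rabs_Ropp.
Qed.

Lemma is_derive_eps (f : R -> R) (x l : R) :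
  is_derive f x l <->
  (forall eps, 0 < eps -> exists del, 0 < del /\
    forall h, Rabs h < del -> Rabs (f (x + h) - f x - l * h) <= eps * Rabs h).
Proof.
split.
- intros H eps He. apply is_derive_Reals in H.
  destruct (H eps He) as [d Hd].
  exists d; split; [apply cond_pos|].
  intros h Hh. destruct (Req_dec h 0) as [->|Hn].
  + rewrite Rplus_0_r. replace (f x - f x - l * 0) with 0 by ring. rewrite Rabs_R0; lra.
  + specialize (Hd h Hn Hh).
    replace (f (x + h) - f x - l * h) with (((f (x + h) - f x) / h - l) * h) by (field; assumption).
    rewrite Rabs_mult. apply Rmult_le_compat_r; [apply Rabs_pos|lra].
- intros H. apply is_derive_Reals. intros eps He.
  destruct (H (eps / 2)) as [d [Hd H']]; [lra|].
  exists (mkposreal d Hd). intros h Hn Hh. simpl in Hh.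
  specialize (H' h Hh).
  replace ((f (x + h) - f x) / h - l) with ((f (x + h) - f x - l * h) / h) by (field; assumption).
  unfold Rdiv. rewrite Rabs_mult, Rabs_inv.
  assert (P : 0 < Rabs h) by now apply Rabs_pos_lt.
  apply (Rmult_lt_reg_r (Rabs h)); [exact P|].
  rewrite Rmult_assoc, Rinv_l, Rmult_1_r; nra.
Qed.

Lemma rderiv_eps (F : R -> C) (t : R) (l : C) :
  rderiv F t l <->
  (forall eps, 0 < eps -> exists del, 0 < del /\
    forall h : R, Rabs h < del -> Cmod (F (t + h)%R - F t - l * h)%C <= eps * Rabs h).
Proof.
split.
- intros [H1 H2] eps He.
  rewrite is_derive_eps in H1, H2.
  destruct (H1 (eps / 2)) as [d1 [P1 K1]]; [lra|].
  destruct (H2 (eps / 2)) as [d2 [P2 K2]]; [lra|].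
  exists (Rmin d1 d2); split; [now apply Rmin_pos|].
  intros h Hh.
  specialize (K1 h (Rlt_le_trans _ _ _ Hh (Rmin_l _ _))).
  specialize (K2 h (Rlt_le_trans _ _ _ Hh (Rmin_r _ _))).
  eapply Rle_trans; [apply Cmod_le_Rabs|].
  replace (Re (F (t + h)%R - F t - l * h)%C) with (Re (F (t + h)) - Re (F t) - Re l * h)
    by (simpl; unfold Re; ring).
  replace (Im (F (t + h)%R - F t - l * h)%C) with (Im (F (t + h)) - Im (F t) - Im l * h)
    by (simpl; unfold Im; ring).
  lra.
- intros H; split; apply is_derive_eps; intros eps He;
    destruct (H eps He) as [d [P K]]; exists d; (split; [exact P|]);
    intros h Hh; specialize (K h Hh).
  + replace (Re (F (t + h)) - Re (F t) - Re l * h) with (Re (F (t + h)%R - F t - l * h)%C)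
      by (simpl; unfold Re; ring).
    eapply Rle_trans; [apply re_le_Cmod|exact K].
  + replace (Im (F (t + h)) - Im (F t) - Im l * h) with (Im (F (t + h)%R - F t - l * h)%C)
      by (simpl; unfold Im; ring).
    eapply Rle_trans; [apply im_le_Cmod|exact K].
Qed.

Lemma rderiv_eq (F : R -> C) (t : R) (l m : C) : rderiv F t l -> l = m -> rderiv F t m.
Proof. now intros H <-. Qed.

Lemma cderiv_rderiv (f : C -> C) (u v : C) (t : R) (l : C) :
  cderiv f (u + v * t)%C l -> rderiv (fun x : R => f (u + v * x)%C) t (l * v)%C.
Proof.
intros H; apply rderiv_eps; intros eps He.
assert (Pv := Cmod_ge_0 v).
assert (Q : 0 < eps / (1 + Cmod v)) by (apply Rdiv_lt_0_compat; lra).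
destruct (H _ Q) as [d [Pd Hd]].
assert (Q2 : 0 < d / (1 + Cmod v)) by (apply Rdiv_lt_0_compat; lra).
exists (d / (1 + Cmod v)); split; [exact Q2|].
intros h Hh.
assert (Ph := Rabs_pos h).
apply (Rmult_lt_compat_l (1 + Cmod v)) in Hh; [|lra].
replace ((1 + Cmod v) * (d / (1 + Cmod v))) with d in Hh by (field; lra).
specialize (Hd (v * h)%C).
rewrite Cmod_mult, Cmod_R in Hd.
assert (Hv : Cmod v * Rabs h < d) by lra.
specialize (Hd Hv).
replace (u + v * (t + h)%R)%C with (u + v * t + v * h)%C by (rewrite RtoC_plus; ring).
replace (l * v * h)%C with (l * (v * h))%C by ring.
eapply Rle_trans; [exact Hd|].
apply Rle_trans with (eps / (1 + Cmod v) * ((1 + Cmod v) * Rabs h)).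
- apply Rmult_le_compat_l; lra.
- right; field; lra.
Qed.

Lemma rderiv_minus (F G : R -> C) (t : R) (l m : C) :
  rderiv F t l -> rderiv G t m -> rderiv (fun x => F x - G x)%C t (l - m)%C.
Proof.
intros [H1 H2] [K1 K2]; split.
- apply (is_derive_ext (fun x => minus (Re (F x)) (Re (G x)))); [reflexivity|].
  exact (is_derive_minus _ _ _ _ _ H1 K1).
- apply (is_derive_ext (fun x => minus (Im (F x)) (Im (G x)))); [reflexivity|].
  exact (is_derive_minus _ _ _ _ _ H2 K2).
Qed.

Lemma rderiv_line (u v : C) (t : R) : rderiv (fun x : R => u + v * x)%C t v.
Proof.
eapply rderiv_eq; [apply (cderiv_rderiv (fun w => w)); apply cderiv_id|ring].
Qed.

Lemma Cconj_mult_self (z : C) : Re (Cconj z * z)%C = Cmod z * Cmod z.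
Proof.
rewrite Cmult_comm, <- Cmod2_conj. simpl. ring.
Qed.

(* Project the increment [F b - F a] onto its own direction and apply the real mean value theorem. *)
Lemma mean_value_ineq (F F' : R -> C) (g g' : R -> R) (a b : R) :
  a <= b ->
  (forall t, a <= t <= b -> rderiv F t (F' t)) ->
  (forall t, a <= t <= b -> is_derive g t (g' t)) ->
  (forall t, a <= t <= b -> Cmod (F' t) <= g' t) ->
  Cmod (F b - F a)%C <= g b - g a.
Proof.
intros Hab HF Hg HB.
set (D := (F b - F a)%C).
assert (Gmono : 0 <= g b - g a).
{ destruct (MVT_gen g a b g') as [c [Hc E]].
  - intros x Hx; apply Hg. rewrite Rmin_left, Rmax_right in Hx; lra.
  - intros x Hx. rewrite Rmin_left, Rmax_right in Hx; try lra.
    apply continuity_pt_filterlim, (ex_derive_continuous g). exists (g' x); apply Hg; lra.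
  - rewrite Rmin_left, Rmax_right in Hc; try lra.
    rewrite E. apply Rmult_le_pos; [|lra].
    eapply Rle_trans; [apply Cmod_ge_0|apply HB, Hc]. }
destruct (Req_dec (Cmod D) 0) as [Z|Z]; [rewrite Z; exact Gmono|].
assert (PD : 0 < Cmod D) by (assert (T := Cmod_ge_0 D); lra).
set (phi := fun t => Re D * Re (F t) + Im D * Im (F t) - Cmod D * g t).
set (phi' := fun t => Re D * Re (F' t) + Im D * Im (F' t) - Cmod D * g' t).
assert (Hphi : forall t, a <= t <= b -> is_derive phi t (phi' t)).
{ intros t Ht. destruct (HF t Ht) as [H1 H2]. specialize (Hg t Ht).
  unfold phi, phi'.
  apply (is_derive_minus (V := R_NormedModule) (fun t => Re D * Re (F t) + Im D * Im (F t)) (fun t => Cmod D *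
    g t)).
  - apply (is_derive_plus (V := R_NormedModule) (fun t => Re D * Re (F t)) (fun t => Im D * Im (F t)));
      apply is_derive_scal; assumption.
  - apply is_derive_scal; assumption. }
destruct (MVT_gen phi a b phi') as [c [Hc E]].
- intros x Hx; apply Hphi. rewrite Rmin_left, Rmax_right in Hx; lra.
- intros x Hx. rewrite Rmin_left, Rmax_right in Hx; try lra.
  apply continuity_pt_filterlim, (ex_derive_continuous phi). exists (phi' x); apply Hphi; lra.
- rewrite Rmin_left, Rmax_right in Hc; try lra.
  assert (E1 : phi b - phi a = Cmod D * Cmod D - Cmod D * (g b - g a)).
  { rewrite <- Cconj_mult_self. unfold phi, D, Re, Im; simpl. ring. }
  assert (E2 : phi' c <= 0).
  { unfold phi'.
    assert (Re D * Re (F' c) + Im D * Im (F' c) <= Cmod D * Cmod (F' c)).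
    { replace (Re D * Re (F' c) + Im D * Im (F' c)) with (Re (Cconj D * F' c)%C)
        by (unfold Re, Im; simpl; ring).
      rewrite <- (Cmod_conj D), <- Cmod_mult.
      eapply Rle_trans; [apply Rle_abs|apply re_le_Cmod]. }
    specialize (HB c Hc).
    assert (Cmod D * Cmod (F' c) <= Cmod D * g' c) by (apply Rmult_le_compat_l; lra).
    lra. }
  rewrite E1 in E.
  nra.
Qed.

(** * The complex exponential *)

Definition Cexp (z : C) : C := (exp (Re z) * cos (Im z), exp (Re z) * sin (Im z)).

Lemma Cexp_plus (z w : C) : Cexp (z + w) = (Cexp z * Cexp w)%C.
Proof.
unfold Cexp, Cmult; simpl. rewrite exp_plus, cos_plus, sin_plus. f_equal; unfold Re, Im; ring.
Qed.

Lemma Cexp_0 : Cexp 0 = 1.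
Proof. unfold Cexp; simpl. rewrite exp_0, cos_0, sin_0. unfold RtoC. f_equal; ring. Qed.

Lemma Cmod_cos_sin (r t : R) : 0 <= r -> Cmod (r * cos t, r * sin t) = r.
Proof.
intros Hr. unfold Cmod; simpl.
replace (_ + _) with (r * r * (Rsqr (sin t) + Rsqr (cos t))) by (unfold Rsqr; ring).
rewrite sin2_cos2, Rmult_1_r. now apply sqrt_square.
Qed.

Lemma Cmod_Cexp (z : C) : Cmod (Cexp z) = exp (Re z).
Proof. apply Cmod_cos_sin, Rlt_le, exp_pos. Qed.

Lemma Cexp_nz (z : C) : Cexp z <> 0.
Proof. apply Cmod_gt_0. rewrite Cmod_Cexp. apply exp_pos. Qed.

Lemma Cexp_opp (z : C) : Cexp (- z) = (/ Cexp z)%C.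
Proof.
assert (H := Cexp_plus z (- z)). rewrite Cplus_opp_r, Cexp_0 in H.
assert (Z := Cexp_nz z).
replace (Cexp (- z)) with (/ Cexp z * (Cexp z * Cexp (- z)))%C by (field; exact Z).
rewrite <- H; ring.
Qed.

Lemma Cexp_INR (n : nat) (z : C) : Cexp (INR n * z) = (Cexp z ^ n)%C.
Proof.
induction n as [|n IH].
- simpl. rewrite Cmult_0_l. apply Cexp_0.
- rewrite S_INR, RtoC_plus, Cpow_S, <- IH, <- Cexp_plus. f_equal; ring.
Qed.

Lemma Cexp_2PI (z : C) : Cexp (z + (0, 2 * PI)) = Cexp z.
Proof.
unfold Cexp; simpl. rewrite Rplus_0_r.
replace (snd z + 2 * PI) with (snd z + 2 * INR 1 * PI) by (simpl; ring).
unfold Re, Im; simpl fst; simpl snd.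
rewrite cos_period, sin_period; reflexivity.
Qed.

Lemma rderiv_Cexp_ray (h : C) (t : R) : rderiv (fun x : R => Cexp (h * x)%C) t (h * Cexp (h * t))%C.
Proof.
split.
- apply (is_derive_ext (fun x : R => exp (fst h * x) * cos (snd h * x))).
  + intros x; unfold Cexp, Re, Im; simpl. f_equal; f_equal; ring.
  + auto_derive; [exact I|]. unfold Cexp, Re, Im; simpl. rewrite !Rmult_0_r, Rminus_0_r, Rplus_0_l. ring.
- apply (is_derive_ext (fun x : R => exp (fst h * x) * sin (snd h * x))).
  + intros x; unfold Cexp, Re, Im; simpl. f_equal; f_equal; ring.
  + auto_derive; [exact I|]. unfold Cexp, Re, Im; simpl. rewrite !Rmult_0_r, Rminus_0_r, Rplus_0_l. ring.
Qed.

Lemma is_derive_lin (k t : R) : is_derive (fun x => k * x) t k.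
Proof. auto_derive; [exact I|ring]. Qed.

Lemma Cexp_ray_bound (h : C) (t : R) : 0 <= t <= 1 -> Cmod (Cexp (h * t)) <= exp (Cmod h).
Proof.
intros Ht. rewrite Cmod_Cexp.
assert (A : Re (h * t)%C <= Cmod h).
{ replace (Re (h * t)%C) with (Re h * t) by (unfold Re; simpl; ring).
  assert (T := re_le_Cmod h). assert (T2 := Rle_abs (Re h)).
  assert (T3 := Cmod_ge_0 h). nra. }
destruct A as [A|A]; [left; now apply exp_increasing|right; now rewrite A].
Qed.

Lemma Cexp_bound1 (h : C) : Cmod (Cexp h - 1)%C <= Cmod h * exp (Cmod h).
Proof.
replace (Cexp h - 1)%C with (Cexp (h * 1%R) - Cexp (h * 0%R))%C
  by (rewrite Cmult_0_r, Cmult_1_r, Cexp_0; reflexivity).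
replace (Cmod h * exp (Cmod h)) with (Cmod h * exp (Cmod h) * 1 - Cmod h * exp (Cmod h) * 0) by ring.
apply (mean_value_ineq (fun x : R => Cexp (h * x)%C) (fun x : R => (h * Cexp (h * x))%C)
        (fun x => Cmod h * exp (Cmod h) * x) (fun _ => Cmod h * exp (Cmod h))).
- lra.
- intros t _; apply rderiv_Cexp_ray.
- intros t _; apply is_derive_lin.
- intros t Ht. rewrite Cmod_mult. apply Rmult_le_compat_l; [apply Cmod_ge_0|now apply Cexp_ray_bound].
Qed.

(** Integrate [Cexp_bound1] once along the segment from [0] to [h]. This quadratic remainder gives
    the derivative of [Cexp] and later that of the logarithm. *)
Lemma Cexp_bound2 (h : C) : Cmod (Cexp h - 1 - h)%C <= Cmod h * Cmod h * exp (Cmod h).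
Proof.
assert (Ph := Cmod_ge_0 h).
replace (Cexp h - 1 - h)%C with ((Cexp (h * 1%R) - (0 + h * 1%R)) - (Cexp (h * 0%R) - (0 + h * 0%R)))%C
  by (rewrite !Cmult_0_r, !Cmult_1_r, Cexp_0; ring).
replace (Cmod h * Cmod h * exp (Cmod h))
  with (Cmod h * Cmod h * exp (Cmod h) * 1 - Cmod h * Cmod h * exp (Cmod h) * 0) by ring.
apply (mean_value_ineq (fun x : R => Cexp (h * x) - (0 + h * x))%C (fun x : R => (h * Cexp (h * x) - h)%C)
        (fun x => Cmod h * Cmod h * exp (Cmod h) * x) (fun _ => Cmod h * Cmod h * exp (Cmod h))).
- lra.
- intros t _; apply rderiv_minus; [apply rderiv_Cexp_ray|apply rderiv_line].
- intros t _; apply is_derive_lin.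
- intros t Ht. replace (h * Cexp (h * t) - h)%C with (h * (Cexp (h * t) - 1))%C by ring.
  rewrite Cmod_mult, Rmult_assoc. apply Rmult_le_compat_l; [apply Cmod_ge_0|].
  eapply Rle_trans; [apply Cexp_bound1|].
  assert (Q : Cmod (h * t) <= Cmod h).
  { rewrite Cmod_mult, Cmod_R, Rabs_pos_eq; [nra|lra]. }
  apply Rmult_le_compat; try apply Cmod_ge_0.
  + left; apply exp_pos.
  + exact Q.
  + destruct Q as [Q|Q]; [left; now apply exp_increasing|rewrite Q; right; reflexivity].
Qed.

Lemma cderiv_Cexp (z : C) : cderiv Cexp z (Cexp z).
Proof.
intros eps He.
assert (Pz := exp_pos (Re z)). assert (P1 := exp_pos 1).
assert (P : 0 < exp (Re z) * exp 1) by now apply Rmult_lt_0_compat.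
assert (Q : 0 < eps / (exp (Re z) * exp 1)) by now apply Rdiv_lt_0_compat.
exists (Rmin 1 (eps / (exp (Re z) * exp 1))); split; [apply Rmin_pos; lra|].
intros h Hh.
assert (H1 := Rlt_le_trans _ _ _ Hh (Rmin_l _ _)).
assert (H2 := Rlt_le_trans _ _ _ Hh (Rmin_r _ _)).
rewrite Cexp_plus.
replace (Cexp z * Cexp h - Cexp z - Cexp z * h)%C with (Cexp z * (Cexp h - 1 - h))%C by ring.
rewrite Cmod_mult, Cmod_Cexp.
assert (Ph := Cmod_ge_0 h).
assert (He1 : exp (Cmod h) <= exp 1) by (left; now apply exp_increasing).
apply (Rmult_lt_compat_r (exp (Re z) * exp 1)) in H2; [|exact P].
replace (eps / (exp (Re z) * exp 1) * (exp (Re z) * exp 1)) with eps in H2 by (field; lra).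
apply Rle_trans with (exp (Re z) * (Cmod h * Cmod h * exp 1)).
- apply Rmult_le_compat_l; [lra|]. eapply Rle_trans; [apply Cexp_bound2|].
  apply Rmult_le_compat_l; [now apply Rmult_le_pos|exact He1].
- replace (exp (Re z) * (Cmod h * Cmod h * exp 1)) with (Cmod h * (exp (Re z) * exp 1) * Cmod h) by ring.
  apply Rmult_le_compat_r; lra.
Qed.

(** * Integration and Goursat's theorem *)

Definition rcont (F : R -> C) (t : R) : Prop :=
  continuous (fun x => Re (F x)) t /\ continuous (fun x => Im (F x)) t.

Definition CInt (F : R -> C) (a b : R) : C :=
  (RInt (fun t => Re (F t)) a b, RInt (fun t => Im (F t)) a b).

Lemma rderiv_rcont (F : R -> C) (t : R) (l : C) : rderiv F t l -> rcont F t.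
Proof.
intros [H1 H2]; split.
- apply (ex_derive_continuous (fun x => Re (F x))). now exists (Re l).
- apply (ex_derive_continuous (fun x => Im (F x))). now exists (Im l).
Qed.

Lemma rcont_const (c : C) (t : R) : rcont (fun _ => c) t.
Proof. split; apply continuous_const. Qed.

Lemma rcont_mult (F G : R -> C) (t : R) :
  rcont F t -> rcont G t -> rcont (fun x => F x * G x)%C t.
Proof.
intros [H1 H2] [K1 K2]; split.
- apply (continuous_minus (V := R_NormedModule) (fun x => Re (F x) * Re (G x)) (fun x => Im (F x) * Im (G x)));
    apply (continuous_mult (K := R_AbsRing)); assumption.
- apply (continuous_plus (V := R_NormedModule) (fun x => Re (F x) * Im (G x)) (fun x => Im (F x) * Re (G x)));
    apply (continuous_mult (K := R_AbsRing)); assumption.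
Qed.

Lemma rcont_scal (c : C) (F : R -> C) (t : R) : rcont F t -> rcont (fun x => c * F x)%C t.
Proof. intros H; apply rcont_mult; [apply rcont_const|exact H]. Qed.

Lemma rcont_minus (F G : R -> C) (t : R) :
  rcont F t -> rcont G t -> rcont (fun x => F x - G x)%C t.
Proof.
intros [H1 H2] [K1 K2]; split.
- exact (continuous_minus (V := R_NormedModule) _ _ _ H1 K1).
- exact (continuous_minus (V := R_NormedModule) _ _ _ H2 K2).
Qed.

Lemma rcont_ex_RInt (F : R -> C) (a b : R) :
  a <= b -> (forall t, a <= t <= b -> rcont F t) ->
  ex_RInt (fun t => Re (F t)) a b /\ ex_RInt (fun t => Im (F t)) a b.
Proof.
intros Hab H; split; apply (ex_RInt_continuous (V := R_CompleteNormedModule));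
  intros z Hz; rewrite Rmin_left, Rmax_right in Hz; try lra; apply (H z Hz).
Qed.

Lemma CInt_ext (F G : R -> C) (a b : R) :
  a <= b -> (forall t, a <= t <= b -> F t = G t) -> CInt F a b = CInt G a b.
Proof.
intros Hab E; unfold CInt; f_equal; apply RInt_ext; intros x Hx;
  rewrite Rmin_left, Rmax_right in Hx; try lra; rewrite E; [reflexivity|lra|reflexivity|lra].
Qed.

Lemma CInt_plus (F G : R -> C) (a b : R) :
  a <= b -> (forall t, a <= t <= b -> rcont F t) -> (forall t, a <= t <= b -> rcont G t) ->
  CInt (fun t => F t + G t)%C a b = (CInt F a b + CInt G a b)%C.
Proof.
intros Hab HF HG.
destruct (rcont_ex_RInt F a b Hab HF) as [F1 F2].
destruct (rcont_ex_RInt G a b Hab HG) as [G1 G2].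
unfold CInt, Cplus; simpl; f_equal.
- exact (RInt_plus (V := R_CompleteNormedModule) _ _ _ _ F1 G1).
- exact (RInt_plus (V := R_CompleteNormedModule) _ _ _ _ F2 G2).
Qed.

Lemma CInt_scal (c : C) (F : R -> C) (a b : R) :
  a <= b -> (forall t, a <= t <= b -> rcont F t) ->
  CInt (fun t => c * F t)%C a b = (c * CInt F a b)%C.
Proof.
intros Hab HF.
destruct (rcont_ex_RInt F a b Hab HF) as [F1 F2].
unfold CInt, Cmult; simpl.
assert (ES : forall (k : R) (u : R -> R), ex_RInt u a b -> RInt (fun t => k * u t) a b = k * RInt u a b).
{ intros k u Hu. exact (RInt_scal (V := R_CompleteNormedModule) u a b k Hu). }
f_equal.
- rewrite (RInt_minus (V := R_CompleteNormedModule) (fun t => fst c * Re (F t)) (fun t => snd c * Im (F t))).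
  + rewrite !ES by assumption; reflexivity.
  + apply (ex_RInt_scal (V := R_NormedModule)); assumption.
  + apply (ex_RInt_scal (V := R_NormedModule)); assumption.
- rewrite (RInt_plus (V := R_CompleteNormedModule) (fun t => fst c * Im (F t)) (fun t => snd c * Re (F t))).
  + rewrite !ES by assumption; reflexivity.
  + apply (ex_RInt_scal (V := R_NormedModule)); assumption.
  + apply (ex_RInt_scal (V := R_NormedModule)); assumption.
Qed.

Lemma CInt_minus (F G : R -> C) (a b : R) :
  a <= b -> (forall t, a <= t <= b -> rcont F t) -> (forall t, a <= t <= b -> rcont G t) ->
  CInt (fun t => F t - G t)%C a b = (CInt F a b - CInt G a b)%C.
Proof.
intros Hab HF HG.
destruct (rcont_ex_RInt F a b Hab HF) as [F1 F2].
destruct (rcont_ex_RInt G a b Hab HG) as [G1 G2].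
unfold CInt, Cminus, Cplus, Copp; simpl; f_equal.
- exact (RInt_minus (V := R_CompleteNormedModule) _ _ _ _ F1 G1).
- exact (RInt_minus (V := R_CompleteNormedModule) _ _ _ _ F2 G2).
Qed.

Lemma CInt_Chasles (F : R -> C) (a m b : R) :
  a <= m <= b -> (forall t, a <= t <= b -> rcont F t) ->
  CInt F a b = (CInt F a m + CInt F m b)%C.
Proof.
intros Hm HF.
destruct (rcont_ex_RInt F a m) as [F1 F2]; [lra|intros; apply HF; lra|].
destruct (rcont_ex_RInt F m b) as [G1 G2]; [lra|intros; apply HF; lra|].
unfold CInt, Cplus; simpl; f_equal; symmetry.
- exact (RInt_Chasles (V := R_CompleteNormedModule) _ _ _ _ F1 G1).
- exact (RInt_Chasles (V := R_CompleteNormedModule) _ _ _ _ F2 G2).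
Qed.

Lemma CInt_FTC (F f : R -> C) (a b : R) :
  a <= b -> (forall t, a <= t <= b -> rderiv F t (f t)) ->
  (forall t, a <= t <= b -> rcont f t) -> CInt f a b = (F b - F a)%C.
Proof.
intros Hab HF Hf. unfold CInt, Cminus, Cplus, Copp; simpl; f_equal; apply is_RInt_unique.
- apply (is_RInt_derive (V := R_CompleteNormedModule) (fun t => Re (F t)));
    intros x Hx; rewrite Rmin_left, Rmax_right in Hx; try lra; [apply (HF x Hx)|apply (Hf x Hx)].
- apply (is_RInt_derive (V := R_CompleteNormedModule) (fun t => Im (F t)));
    intros x Hx; rewrite Rmin_left, Rmax_right in Hx; try lra; [apply (HF x Hx)|apply (Hf x Hx)].
Qed.

Lemma CInt_const (c : C) (a b : R) : CInt (fun _ => c) a b = (c * (b - a)%R)%C.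
Proof.
unfold CInt. rewrite !RInt_const. unfold scal; simpl; unfold mult; simpl.
unfold Cmult, Re, Im; simpl; f_equal; ring.
Qed.

(** Multiplying by the conjugate of the integral turns its squared modulus into the integral of a
    real part, to which the real comparison applies. *)
Lemma CInt_bound (F : R -> C) (a b M : R) :
  a <= b -> (forall t, a <= t <= b -> rcont F t) ->
  (forall t, a <= t <= b -> Cmod (F t) <= M) -> Cmod (CInt F a b) <= M * (b - a).
Proof.
intros Hab HF HM.
set (D := CInt F a b).
destruct (Req_dec (Cmod D) 0) as [Z|Z].
{ rewrite Z. apply Rmult_le_pos; [|lra].
  eapply Rle_trans; [apply Cmod_ge_0|apply (HM a); lra]. }
assert (PD : 0 < Cmod D) by (assert (T := Cmod_ge_0 D); lra).
assert (K : Cmod D * Cmod D <= Cmod D * M * (b - a)).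
{ rewrite <- Cconj_mult_self at 1. unfold D. rewrite <- (CInt_scal (Cconj (CInt F a b)) F a b Hab HF).
  fold D. change (RInt (fun t => Re (Cconj D * F t)%C) a b <= Cmod D * M * (b - a)).
  replace (Cmod D * M * (b - a)) with (RInt (V := R_CompleteNormedModule) (fun _ => Cmod D * M) a b)
    by (rewrite RInt_const; unfold scal; simpl; unfold mult; simpl; ring).
  apply RInt_le; try assumption.
  - apply (rcont_ex_RInt (fun t => Cconj D * F t)%C a b Hab).
    intros; now apply rcont_scal, HF.
  - apply ex_RInt_const.
  - intros x Hx. eapply Rle_trans; [apply Rle_abs|]. eapply Rle_trans; [apply re_le_Cmod|].
    rewrite Cmod_mult, Cmod_conj. apply Rmult_le_compat_l; [lra|apply HM; lra]. }
rewrite Rmult_assoc in K. now apply Rmult_le_reg_l in K.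
Qed.

Lemma cderiv_horizontal (f : C -> C) (x y : R) (l : C) :
  cderiv f (x, y) l -> rderiv (fun t => f (t, y)) x l.
Proof.
intros H.
assert (E : forall t : R, (t, y) = ((0, y) + 1 * t)%C)
  by (intros t; unfold Cplus, Cmult, RtoC; simpl; f_equal; ring).
rewrite E in H. apply cderiv_rderiv in H. rewrite Cmult_1_r in H.
destruct H as [H1 H2]; split.
- eapply is_derive_ext; [|exact H1]. intros t; simpl. now rewrite <- E.
- eapply is_derive_ext; [|exact H2]. intros t; simpl. now rewrite <- E.
Qed.

Lemma cderiv_vertical (f : C -> C) (x y : R) (l : C) :
  cderiv f (x, y) l -> rderiv (fun t => f (x, t)) y (l * Ci)%C.
Proof.
intros H.
assert (E : forall t : R, (x, t) = ((x, 0%R) + Ci * t)%C)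
  by (intros t; unfold Cplus, Cmult, RtoC, Ci; simpl; f_equal; ring).
rewrite E in H. apply cderiv_rderiv in H.
destruct H as [H1 H2]; split.
- eapply is_derive_ext; [|exact H1]. intros t; simpl. now rewrite <- E.
- eapply is_derive_ext; [|exact H2]. intros t; simpl. now rewrite <- E.
Qed.

Definition cdiff_rect (f : C -> C) (a b c d : R) : Prop :=
  forall x y, a <= x <= b -> c <= y <= d -> exists l, cderiv f (x, y) l.

Lemma cdiff_rect_incl (f : C -> C) (a b c d a' b' c' d' : R) :
  cdiff_rect f a b c d -> a <= a' -> b' <= b -> c <= c' -> d' <= d -> cdiff_rect f a' b' c' d'.
Proof. intros H; intros; intros x y Hx Hy; apply H; lra. Qed.

Lemma cdiff_rect_hcont (f : C -> C) (a b c d : R) : cdiff_rect f a b c d ->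
  forall y, c <= y <= d -> forall t, a <= t <= b -> rcont (fun x => f (x, y)) t.
Proof.
intros H y Hy t Ht. destruct (H t y Ht Hy) as [l Hl].
eapply rderiv_rcont, cderiv_horizontal, Hl.
Qed.

Lemma cdiff_rect_vcont (f : C -> C) (a b c d : R) : cdiff_rect f a b c d ->
  forall x, a <= x <= b -> forall t, c <= t <= d -> rcont (fun y => f (x, y)) t.
Proof.
intros H x Hx t Ht. destruct (H x t Hx Ht) as [l Hl].
eapply rderiv_rcont, cderiv_vertical, Hl.
Qed.

(** The counterclockwise contour integral over the boundary: [dz] is [dx] on the horizontal sides
    and [Ci dy] on the vertical ones. *)
Definition rect_int (f : C -> C) (a b c d : R) : C :=
  (CInt (fun x => f (x, c)) a b - CInt (fun x => f (x, d)) a b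
   + Ci * (CInt (fun y => f (b, y)) c d - CInt (fun y => f (a, y)) c d))%C.

Lemma rect_int_split_x (f : C -> C) (a m b c d : R) :
  a <= m <= b -> c <= d -> cdiff_rect f a b c d ->
  rect_int f a b c d = (rect_int f a m c d + rect_int f m b c d)%C.
Proof.
intros Hm Hcd H. unfold rect_int.
rewrite (CInt_Chasles (fun x => f (x, c)) a m b), (CInt_Chasles (fun x => f (x, d)) a m b).
- ring.
- exact Hm.
- apply (cdiff_rect_hcont f a b c d H); lra.
- exact Hm.
- apply (cdiff_rect_hcont f a b c d H); lra.
Qed.

Lemma rect_int_split_y (f : C -> C) (a b c m d : R) :
  a <= b -> c <= m <= d -> cdiff_rect f a b c d ->
  rect_int f a b c d = (rect_int f a b c m + rect_int f a b m d)%C.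
Proof.
intros Hab Hm H. unfold rect_int.
rewrite (CInt_Chasles (fun y => f (b, y)) c m d), (CInt_Chasles (fun y => f (a, y)) c m d).
- ring.
- exact Hm.
- apply (cdiff_rect_vcont f a b c d H); lra.
- exact Hm.
- apply (cdiff_rect_vcont f a b c d H); lra.
Qed.

Lemma rect_int_plus (f g : C -> C) (a b c d : R) :
  a <= b -> c <= d -> cdiff_rect f a b c d -> cdiff_rect g a b c d ->
  rect_int (fun z => f z + g z)%C a b c d = (rect_int f a b c d + rect_int g a b c d)%C.
Proof.
intros Hab Hcd Hf Hg. unfold rect_int.
rewrite !CInt_plus; try assumption; try ring;
  first [apply (cdiff_rect_hcont f a b c d Hf); lra | apply (cdiff_rect_hcont g a b c d Hg); lra
        |apply (cdiff_rect_vcont f a b c d Hf); lra | apply (cdiff_rect_vcont g a b c d Hg); lra].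
Qed.

Lemma rect_int_derivative (F f : C -> C) (a b c d : R) :
  a <= b -> c <= d -> cdiff_rect f a b c d ->
  (forall x y, a <= x <= b -> c <= y <= d -> cderiv F (x, y) (f (x, y))) ->
  rect_int f a b c d = 0.
Proof.
intros Hab Hcd Hf HF. unfold rect_int.
assert (EH : forall y, c <= y <= d -> CInt (fun x => f (x, y)) a b = (F (b, y) - F (a, y))%C).
{ intros y Hy. apply (CInt_FTC (fun x => F (x, y))); [exact Hab| |].
  - intros t Ht; apply cderiv_horizontal; now apply HF.
  - now apply (cdiff_rect_hcont f a b c d). }
assert (EV : forall x, a <= x <= b -> (Ci * CInt (fun y => f (x, y)) c d = F (x, d) - F (x, c))%C).
{ intros x Hx. rewrite <- CInt_scal; [|exact Hcd|now apply (cdiff_rect_vcont f a b c d)].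
  apply (CInt_FTC (fun y => F (x, y))); [exact Hcd| |].
  - intros t Ht. eapply rderiv_eq; [apply cderiv_vertical; now apply HF|ring].
  - intros; apply rcont_scal. now apply (cdiff_rect_vcont f a b c d). }
rewrite !EH by lra.
replace (Ci * (CInt (fun y => f (b, y)) c d - CInt (fun y => f (a, y)) c d))%C
  with (Ci * CInt (fun y => f (b, y)) c d - Ci * CInt (fun y => f (a, y)) c d)%C by ring.
rewrite !EV by lra. ring.
Qed.

Lemma rect_int_bound (f : C -> C) (a b c d M : R) :
  a <= b -> c <= d -> cdiff_rect f a b c d ->
  (forall x y, a <= x <= b -> c <= y <= d -> Cmod (f (x, y)) <= M) ->
  Cmod (rect_int f a b c d) <= M * (2 * ((b - a) + (d - c))).
Proof.
intros Hab Hcd Hf HM. unfold rect_int.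
assert (BH : forall y, c <= y <= d -> Cmod (CInt (fun x => f (x, y)) a b) <= M * (b - a)).
{ intros y Hy. apply CInt_bound; [exact Hab|now apply (cdiff_rect_hcont f a b c d)|].
  intros; now apply HM. }
assert (BV : forall x, a <= x <= b -> Cmod (CInt (fun y => f (x, y)) c d) <= M * (d - c)).
{ intros y Hy. apply CInt_bound; [exact Hcd|now apply (cdiff_rect_vcont f a b c d)|].
  intros; now apply HM. }
eapply Rle_trans; [apply Cmod_triangle|].
rewrite Cmod_mult, Cmod_Ci, Rmult_1_l.
assert (T1 := BH c ltac:(lra)). assert (T2 := BH d ltac:(lra)).
assert (T3 := BV a ltac:(lra)). assert (T4 := BV b ltac:(lra)).
unfold Cminus.
assert (Q1 := Cmod_triangle (CInt (fun x => f (x, c)) a b) (- CInt (fun x => f (x, d)) a b)%C).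
assert (Q2 := Cmod_triangle (CInt (fun y => f (b, y)) c d) (- CInt (fun y => f (a, y)) c d)%C).
rewrite Cmod_opp in Q1, Q2. lra.
Qed.

Lemma nested_intervals (u v : nat -> R) :
  (forall n, u n <= u (S n)) -> (forall n, v (S n) <= v n) -> (forall n, u n <= v n) ->
  exists x, forall n, u n <= x <= v n.
Proof.
intros Hu Hv Huv.
assert (Mu : forall n k, u n <= u (n + k)%nat).
{ intros n k; induction k as [|k IH]; [rewrite Nat.add_0_r; lra|].
  rewrite Nat.add_succ_r. specialize (Hu (n + k)%nat). lra. }
assert (Mv : forall n k, v (n + k)%nat <= v n).
{ intros n k; induction k as [|k IH]; [rewrite Nat.add_0_r; lra|].
  rewrite Nat.add_succ_r. specialize (Hv (n + k)%nat). lra. }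
assert (UV : forall n m, u n <= v m).
{ intros n m. specialize (Mu n m). specialize (Mv m n). rewrite (Nat.add_comm m n) in Mv.
  specialize (Huv (n + m)%nat). lra. }
destruct (completeness (fun x => exists n, x = u n)) as [x [Hx1 Hx2]].
- exists (v 0%nat). intros y [n ->]. apply UV.
- exists (u 0%nat), 0%nat; reflexivity.
- exists x. intros n; split.
  + apply Hx1. now exists n.
  + apply Hx2. intros y [m ->]. apply UV.
Qed.

(** The bisection step of Goursat's proof; rectangles are given by their lower left corners. The
    default [p4] is legitimate because, by the triangle inequality, the four quarters cannot all be
    too small. *)
Definition quarter_step (f : C -> C) (w h : R) (p : R * R) : R * R :=
  let I q := Cmod (rect_int f (fst q) (fst q + w / 2) (snd q) (snd q + h / 2)) in
  let T := Cmod (rect_int f (fst p) (fst p + w) (snd p) (snd p + h)) in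
  let ok q := Rle_dec T (4 * I q) in
  let p1 := p in
  let p2 := (fst p + w / 2, snd p) in
  let p3 := (fst p, snd p + h / 2) in
  let p4 := (fst p + w / 2, snd p + h / 2) in
  if ok p1 then p1 else if ok p2 then p2 else if ok p3 then p3 else p4.

Lemma quarter_step_spec (f : C -> C) (w h : R) (p : R * R) :
  0 < w -> 0 < h -> cdiff_rect f (fst p) (fst p + w) (snd p) (snd p + h) ->
  let q := quarter_step f w h p in
  fst p <= fst q <= fst p + w / 2 /\ snd p <= snd q <= snd p + h / 2 /\
  Cmod (rect_int f (fst p) (fst p + w) (snd p) (snd p + h)) <=
  4 * Cmod (rect_int f (fst q) (fst q + w / 2) (snd q) (snd q + h / 2)).
Proof.
intros Hw Hh Hf. destruct p as [a c]; simpl in *. unfold quarter_step; simpl.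
repeat match goal with |- context [Rle_dec ?x ?y] => destruct (Rle_dec x y) as [?L|?L] end;
  simpl; try (repeat split; lra).
split; [lra|]; split; [lra|].
rewrite (rect_int_split_x f a (a + w / 2) (a + w) c (c + h)) in L, L0, L1 |- *; try lra; try exact Hf.
rewrite (rect_int_split_y f a (a + w / 2) c (c + h / 2) (c + h)) in L, L0, L1 |- *; try lra;
  try (eapply cdiff_rect_incl; [exact Hf|lra|lra|lra|lra]).
rewrite (rect_int_split_y f (a + w / 2) (a + w) c (c + h / 2) (c + h)) in L, L0, L1 |- *; try lra;
  try (eapply cdiff_rect_incl; [exact Hf|lra|lra|lra|lra]).
replace (a + w / 2 + w / 2) with (a + w) in * by field.
replace (c + h / 2 + h / 2) with (c + h) in * by field.
set (A := rect_int f a (a + w / 2) c (c + h / 2)) in *.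
set (B := rect_int f a (a + w / 2) (c + h / 2) (c + h)) in *.
set (D := rect_int f (a + w / 2) (a + w) c (c + h / 2)) in *.
set (E := rect_int f (a + w / 2) (a + w) (c + h / 2) (c + h)) in *.
assert (Q1 := Cmod_triangle (A + B) (D + E)).
assert (Q2 := Cmod_triangle A B). assert (Q3 := Cmod_triangle D E). lra.
Qed.

Lemma rect_int_ext (f g : C -> C) (a b c d : R) :
  a <= b -> c <= d -> (forall z, f z = g z) -> rect_int f a b c d = rect_int g a b c d.
Proof.
intros Hab Hcd E. unfold rect_int.
rewrite (CInt_ext (fun x => f (x, c)) (fun x => g (x, c))), (CInt_ext (fun x => f (x, d)) (fun x => g (x, d))),
  (CInt_ext (fun y => f (a, y)) (fun y => g (a, y))), (CInt_ext (fun y => f (b, y)) (fun y => g (b, y)));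
  try assumption; intros; try apply E; reflexivity.
Qed.

Fixpoint quarter_seq (f : C -> C) (w h : R) (p : R * R) (n : nat) : R * R :=
  match n with
  | O => p
  | S n => quarter_step f (w / 2 ^ n) (h / 2 ^ n) (quarter_seq f w h p n)
  end.

Lemma half_pow (w : R) (n : nat) : w / 2 ^ S n = w / 2 ^ n / 2.
Proof. simpl. field. apply pow_nonzero; lra. Qed.

Lemma pow2_unbounded (x : R) : exists n, x < 2 ^ n.
Proof.
destruct (Pow_x_infinity 2) with (b := x + 1) as [N HN].
- rewrite Rabs_pos_eq; lra.
- exists N. specialize (HN N (le_n N)). rewrite Rabs_pos_eq in HN; [lra|].
  apply pow_le; lra.
Qed.

Lemma goursat (f : C -> C) (a b c d : R) :
  a < b -> c < d -> cdiff_rect f a b c d -> rect_int f a b c d = 0.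
Proof.
intros Hab Hcd Hf.
set (w := b - a). set (h := d - c).
assert (Hw : 0 < w) by (unfold w; lra). assert (Hh : 0 < h) by (unfold h; lra).
set (p := quarter_seq f w h (a, c)).
assert (P2n : forall n, 0 < 2 ^ n) by (intros; apply pow_lt; lra).
assert (Wn : forall n, 0 < w / 2 ^ n) by (intros; now apply Rdiv_lt_0_compat).
assert (Hn : forall n, 0 < h / 2 ^ n) by (intros; now apply Rdiv_lt_0_compat).
assert (Inside : forall n, a <= fst (p n) /\ fst (p n) + w / 2 ^ n <= b /\
                           c <= snd (p n) /\ snd (p n) + h / 2 ^ n <= d).
{ induction n as [|n IH].
  - unfold p; simpl. rewrite !Rdiv_1_r. unfold w, h. lra.
  - destruct (quarter_step_spec f (w / 2 ^ n) (h / 2 ^ n) (p n) (Wn n) (Hn n)) as [Q1 [Q2 _]].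
    + eapply cdiff_rect_incl; [exact Hf| | | |]; lra.
    + rewrite !half_pow. change (p (S n)) with (quarter_step f (w / 2 ^ n) (h / 2 ^ n) (p n)). lra. }
assert (Step : forall n, fst (p n) <= fst (p (S n)) <= fst (p n) + w / 2 ^ n / 2 /\
  snd (p n) <= snd (p (S n)) <= snd (p n) + h / 2 ^ n / 2 /\
  Cmod (rect_int f (fst (p n)) (fst (p n) + w / 2 ^ n) (snd (p n)) (snd (p n) + h / 2 ^ n)) <=
  4 * Cmod (rect_int f (fst (p (S n))) (fst (p (S n)) + w / 2 ^ S n) (snd (p (S n))) (snd (p (S n)) + h / 2 ^ S
    n))).
{ intros n. specialize (Inside n). rewrite !half_pow.
  apply (quarter_step_spec f (w / 2 ^ n) (h / 2 ^ n) (p n) (Wn n) (Hn n)).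
  eapply cdiff_rect_incl; [exact Hf| | | |]; lra. }
set (I := fun n => Cmod (rect_int f (fst (p n)) (fst (p n) + w / 2 ^ n) (snd (p n)) (snd (p n) + h / 2 ^ n))).
assert (Big : forall n, Cmod (rect_int f a b c d) <= 4 ^ n * I n).
{ induction n as [|n IH].
  - unfold I, p; simpl. rewrite !Rdiv_1_r. unfold w, h.
    replace (a + (b - a)) with b by ring. replace (c + (d - c)) with d by ring. lra.
  - destruct (Step n) as [_ [_ T]]. fold (I n) in T. fold (I (S n)) in T.
    simpl. assert (0 < 4 ^ n) by (apply pow_lt; lra).
    eapply Rle_trans; [exact IH|].
    replace (4 * 4 ^ n * I (S n)) with (4 ^ n * (4 * I (S n))) by ring.
    apply Rmult_le_compat_l; lra. }
destruct (nested_intervals (fun n => fst (p n)) (fun n => fst (p n) + w / 2 ^ n)) as [x Hx].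
{ intros n; destruct (Step n) as [T _]; lra. }
{ intros n; destruct (Step n) as [T _]; rewrite half_pow; lra. }
{ intros n; specialize (Wn n); lra. }
destruct (nested_intervals (fun n => snd (p n)) (fun n => snd (p n) + h / 2 ^ n)) as [y Hy].
{ intros n; destruct (Step n) as [_ [T _]]; lra. }
{ intros n; destruct (Step n) as [_ [T _]]; rewrite half_pow; lra. }
{ intros n; specialize (Hn n); lra. }
destruct (Hf x y) as [l Hl].
{ specialize (Hx O). specialize (Inside O). lra. }
{ specialize (Hy O). specialize (Inside O). lra. }
apply Cmod_eq_0. apply Rle_antisym; [|apply Cmod_ge_0].
apply Rnot_lt_le. intros Pos.
set (D := Cmod (rect_int f a b c d)) in *.
(* The remainder is at most [eps] times the sum of the sides, integrated over a perimeter of twice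
   that sum; after multiplication by [4 ^ n] this is [2 eps (w + h)^2], here equal to
   [D / 2 < D]. *)
set (eps := D / (4 * ((w + h) * (w + h)))).
assert (Pe : 0 < eps) by (apply Rdiv_lt_0_compat; nra).
destruct (Hl eps Pe) as [del [Pd Hd]].
destruct (pow2_unbounded ((w + h) / del)) as [n Nn].
assert (Small : (w + h) / 2 ^ n < del).
{ apply (Rmult_lt_reg_r (2 ^ n)); [apply P2n|].
  replace ((w + h) / 2 ^ n * 2 ^ n) with (w + h) by (field; specialize (P2n n); lra).
  apply (Rmult_lt_compat_r del) in Nn; [|exact Pd].
  replace ((w + h) / del * del) with (w + h) in Nn by (field; lra). lra. }
specialize (Big n). specialize (Inside n). specialize (Hx n). specialize (Hy n). simpl in Hx, Hy.
specialize (Wn n). specialize (Hn n).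
set (a' := fst (p n)) in *. set (c' := snd (p n)) in *.
set (wn := w / 2 ^ n) in *. set (hn := h / 2 ^ n) in *.
(* The affine part of [f] at the limit point has a primitive, so its boundary integral vanishes and
   only the remainder [r] counts. *)
set (aff := fun z : C => (f (x, y) - l * (x, y) + l * z)%C).
set (r := fun z : C => (f z - aff z)%C).
assert (Daff : forall z, cderiv aff z l).
{ intros z. unfold aff. eapply cderiv_eq; [apply cderiv_plus; [apply cderiv_const|apply cderiv_scal,
    cderiv_id]|ring]. }
assert (Hf' : cdiff_rect f a' (a' + wn) c' (c' + hn)).
{ eapply cdiff_rect_incl; [exact Hf| | | |]; lra. }
assert (Haff : cdiff_rect aff a' (a' + wn) c' (c' + hn)) by (intros u v _ _; eexists; apply Daff).
assert (Hr : cdiff_rect r a' (a' + wn) c' (c' + hn)).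
{ intros u v Hu Hv. destruct (Hf' u v Hu Hv) as [m Hm]. exists (m - l)%C. now apply cderiv_minus. }
assert (E : rect_int f a' (a' + wn) c' (c' + hn) = rect_int r a' (a' + wn) c' (c' + hn)).
{ transitivity (rect_int (fun z => aff z + r z)%C a' (a' + wn) c' (c' + hn)).
  - apply rect_int_ext; try lra. intros z; unfold r; ring.
  - rewrite rect_int_plus; try assumption; try lra.
    rewrite (rect_int_derivative (fun z => (f (x, y) - l * (x, y)) * z + l / 2 * (z * z))%C aff); try
      assumption; try lra.
    + ring.
    + intros u v _ _. eapply cderiv_eq.
      * apply cderiv_plus; [apply cderiv_scal, cderiv_id|apply cderiv_scal, cderiv_mult; apply cderiv_id].
      * unfold aff. field. }
assert (B : I n <= eps * ((w + h) / 2 ^ n) * (2 * ((w + h) / 2 ^ n))).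
{ unfold I. fold a' c' wn hn. rewrite E.
  replace ((w + h) / 2 ^ n) with (wn + hn) by (unfold wn, hn; field; specialize (P2n n); lra).
  replace (wn + hn) with ((a' + wn - a') + (c' + hn - c')) at 2 by ring.
  apply rect_int_bound; try lra; [exact Hr|].
  intros u v Hu Hv. unfold r, aff.
  assert (Hq : Cmod ((u, v) - (x, y))%C <= wn + hn).
  { eapply Rle_trans; [apply Cmod_le_Rabs|]. unfold Re, Im; simpl.
    apply Rplus_le_compat; apply Rabs_le; lra. }
  specialize (Hd ((u, v) - (x, y))%C).
  assert (Hlt : Cmod ((u, v) - (x, y))%C < del).
  { eapply Rle_lt_trans; [exact Hq|]. replace (wn + hn) with ((w + h) / 2 ^ n); [exact Small|].
    unfold wn, hn; field; specialize (P2n n); lra. }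
  specialize (Hd Hlt).
  assert (E1 : forall s t : C, (s + (t - s))%C = t) by (intros; ring).
  assert (E2 : forall A B s t : C, (A - (B - l * s + l * t) = A - B - l * (t - s))%C) by (intros; ring).
  rewrite E1 in Hd. rewrite E2.
  eapply Rle_trans; [exact Hd|]. apply Rmult_le_compat_l; lra. }
assert (F4 : 4 ^ n = 2 ^ n * 2 ^ n) by (rewrite <- Rpow_mult_distr; f_equal; ring).
assert (B2 : 4 ^ n * I n <= eps * (2 * ((w + h) * (w + h)))).
{ rewrite F4. specialize (P2n n).
  apply Rle_trans with (2 ^ n * 2 ^ n * (eps * ((w + h) / 2 ^ n) * (2 * ((w + h) / 2 ^ n)))).
  - apply Rmult_le_compat_l; [nra|exact B].
  - right; field; lra. }
assert (B3 : eps * (2 * ((w + h) * (w + h))) = D / 2).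
{ unfold eps. field. lra. }
lra.
Qed.

(** * Cauchy inequalities *)

Lemma le_of_eps (x y : R) : (forall eps, 0 < eps -> x <= y + eps) -> x <= y.
Proof.
intros H. apply Rnot_lt_le. intros L. specialize (H ((x - y) / 2)). lra.
Qed.

Lemma cderiv_Cexp_opp (z : C) : cderiv (fun w => Cexp (- w))%C z (- Cexp (- z))%C.
Proof.
eapply cderiv_eq.
- apply (cderiv_comp Cexp (fun w => - w)%C).
  + apply cderiv_Cexp.
  + apply (cderiv_ext_loc (fun w => (-1) * w)%C _ z _ 1 Rlt_0_1); [intros; ring|].
    apply cderiv_scal, cderiv_id.
- ring.
Qed.

Lemma cderiv_shift_Cexp (f : C -> C) (z0 w l : C) :
  cderiv f (z0 + Cexp w)%C l -> cderiv (fun w => f (z0 + Cexp w))%C w (l * Cexp w)%C.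
Proof.
intros H. apply (cderiv_comp f (fun w => z0 + Cexp w)%C); [exact H|].
eapply cderiv_eq; [apply cderiv_plus; [apply cderiv_const|apply cderiv_Cexp]|ring].
Qed.

(** The horizontal sides cancel, so Goursat's theorem leaves the vertical ones. In logarithmic
    coordinates these are circles or arcs, and the lemma says that the integral does not depend on
    the radius. *)
Lemma vertical_int_const (G : C -> C) (x1 x2 c d : R) :
  x1 < x2 -> c < d -> cdiff_rect G x1 x2 c d ->
  (forall x, x1 <= x <= x2 -> G (x, d) = G (x, c)) ->
  CInt (fun y => G (x1, y)) c d = CInt (fun y => G (x2, y)) c d.
Proof.
intros Hx Hcd HG Hp.
assert (E := goursat G x1 x2 c d Hx Hcd HG). unfold rect_int in E.
rewrite (CInt_ext (fun x => G (x, d)) (fun x => G (x, c)) x1 x2) in E; [|lra|exact Hp].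
assert (E2 : (Ci * (CInt (fun y => G (x2, y)) c d - CInt (fun y => G (x1, y)) c d) = 0)%C).
{ rewrite <- E; ring. }
assert (E3 : (CInt (fun y => G (x2, y)) c d - CInt (fun y => G (x1, y)) c d = 0)%C).
{ replace (CInt (fun y => G (x2, y)) c d - CInt (fun y => G (x1, y)) c d)%C
    with (/ Ci * (Ci * (CInt (fun y => G (x2, y)) c d - CInt (fun y => G (x1, y)) c d)))%C.
  - rewrite E2; ring.
  - field. apply Ci_nz. }
symmetry. now apply Ceq_minus.
Qed.

Lemma Cexp_2PI_0 (x : R) : Cexp (x, 2 * PI) = Cexp (x, 0).
Proof.
rewrite <- (Cexp_2PI (x, 0)). f_equal. unfold Cplus; simpl. f_equal; ring.
Qed.

Lemma Re_exp_pair (x y : R) : Cmod (Cexp (x, y)) = exp x.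
Proof. apply Cmod_Cexp. Qed.

(** In the coordinate [w = log (z - z0)] circles are vertical segments, and the integral of
    [f (z0 + e^w) e^(-w)] over a period does not depend on the radius. On a small circle it is close
    to [2 PI l], on the circle of radius [r] it is at most [2 PI M / r]. *)
Lemma cauchy_ineq (f : C -> C) (z0 l : C) (R0 M : R) :
  0 < R0 -> (forall z, Cmod (z - z0) < R0 -> exists m, cderiv f z m) ->
  (forall z, Cmod (z - z0) < R0 -> Cmod (f z) <= M) ->
  cderiv f z0 l -> Cmod l <= M / R0.
Proof.
intros HR Hf HM Hl.
assert (PI0 := PI_RGT_0).
assert (PM : 0 <= M).
{ eapply Rle_trans; [apply Cmod_ge_0|apply (HM z0)].
  replace (z0 - z0)%C with (RtoC 0) by ring. now rewrite Cmod_0. }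
assert (Main : forall r, 0 < r < R0 -> Cmod l <= M / r).
{ intros r Hr. apply le_of_eps. intros eps He.
  destruct (Hl eps He) as [del [Pd Hd]].
  (* [x2] is the circle of radius [r], [x1] a smaller one on which the difference quotient of [f] is
     within [eps] of [l]. *)
  set (x2 := ln r). set (x1 := ln (Rmin del r / 2)).
  assert (Pm : 0 < Rmin del r) by (apply Rmin_pos; lra).
  assert (Lm1 := Rmin_l del r). assert (Lm2 := Rmin_r del r).
  assert (Hx : x1 < x2) by (apply ln_increasing; lra).
  assert (Ex1 : exp x1 = Rmin del r / 2) by (apply exp_ln; lra).
  assert (Ex2 : exp x2 = r) by (apply exp_ln; lra).
  set (G := fun w : C => (f (z0 + Cexp w) * Cexp (- w))%C).
  assert (Dexp : forall x y, x <= x2 -> Cmod (z0 + Cexp (x, y) - z0)%C < R0).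
  { intros x y Hxx. replace (z0 + Cexp (x, y) - z0)%C with (Cexp (x, y)) by ring.
    rewrite Re_exp_pair. assert (exp x <= exp x2); [|lra].
    destruct Hxx as [Hxx|Hxx]; [left; now apply exp_increasing|right; now rewrite Hxx]. }
  assert (HG : cdiff_rect G x1 x2 0 (2 * PI)).
  { intros x y Hxx Hyy. destruct (Hf (z0 + Cexp (x, y))%C) as [m Hm]; [apply Dexp; lra|].
    eexists. apply cderiv_mult; [apply cderiv_shift_Cexp, Hm|apply cderiv_Cexp_opp]. }
  assert (EV := vertical_int_const G x1 x2 0 (2 * PI) Hx ltac:(lra) HG).
  assert (Hper : forall x, x1 <= x <= x2 -> G (x, 2 * PI) = G (x, 0)).
  { intros x _. unfold G.
    rewrite !Cexp_opp, Cexp_2PI_0. reflexivity. }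
  specialize (EV Hper).
  assert (B2 : Cmod (CInt (fun y => G (x2, y)) 0 (2 * PI)) <= M / r * (2 * PI - 0)).
  { apply CInt_bound; [lra|apply (cdiff_rect_vcont G x1 x2 0 (2 * PI) HG); lra|].
    intros y Hy. unfold G. rewrite Cmod_mult, Cexp_opp, Cmod_inv, Re_exp_pair, Ex2 by apply Cexp_nz.
    unfold Rdiv. apply Rmult_le_compat_r; [left; apply Rinv_0_lt_compat; lra|].
    apply HM, Dexp; lra. }
  (* [E1] integrates to [0] over a period. Subtracting it from [G] leaves the difference quotient
     [rho] of [f] at [z0]. *)
  set (E1 := fun w : C => (f z0 * Cexp (- w))%C).
  set (rho := fun w : C => (G w - E1 w)%C).
  assert (DE1 : forall w, cderiv E1 w (f z0 * - Cexp (- w))%C).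
  { intros w. apply cderiv_scal, cderiv_Cexp_opp. }
  assert (HE1 : cdiff_rect E1 x1 x2 0 (2 * PI)) by (intros x y _ _; eexists; apply DE1).
  assert (Hrho : cdiff_rect rho x1 x2 0 (2 * PI)).
  { intros x y Hxx Hyy. destruct (HG x y Hxx Hyy) as [m Hm]. eexists.
    apply cderiv_minus; [exact Hm|apply DE1]. }
  assert (IE1 : CInt (fun y => E1 (x1, y)) 0 (2 * PI) = 0).
  { rewrite (CInt_FTC (fun y => (Ci * E1 (x1, y))%C)).
    - unfold E1.
      rewrite !Cexp_opp, Cexp_2PI_0. ring.
    - lra.
    - intros t _. eapply rderiv_eq.
      + apply (cderiv_vertical (fun w => Ci * E1 w)%C). apply cderiv_scal, DE1.
      + unfold E1.
        replace (Ci * (f z0 * - Cexp (- (x1, t))) * Ci)%C with (- (Ci * Ci) * (f z0 * Cexp (- (x1, t))))%C by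
          ring.
        replace (Ci * Ci)%C with (RtoC (-1)).
        * ring.
        * unfold Ci, Cmult, RtoC; simpl; f_equal; ring.
    - apply (cdiff_rect_vcont E1 x1 x2 0 (2 * PI) HE1); lra. }
  assert (B1 : Cmod (CInt (fun y => rho (x1, y) - l)%C 0 (2 * PI)) <= eps * (2 * PI - 0)).
  { apply CInt_bound; [lra| |].
    - intros t Ht. apply rcont_minus; [|apply rcont_const].
      apply (cdiff_rect_vcont rho x1 x2 0 (2 * PI) Hrho); lra.
    - intros t Ht. unfold rho, G, E1.
      assert (Hs : Cmod (Cexp (x1, t)) < del) by (rewrite Re_exp_pair, Ex1; lra).
      specialize (Hd _ Hs). rewrite Re_exp_pair, Ex1 in Hd.
      rewrite Cexp_opp.
      replace (f (z0 + Cexp (x1, t)) * / Cexp (x1, t) - f z0 * / Cexp (x1, t) - l)%C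
        with ((f (z0 + Cexp (x1, t)) - f z0 - l * Cexp (x1, t)) * / Cexp (x1, t))%C
        by (field; apply Cexp_nz).
      rewrite Cmod_mult, Cmod_inv, Re_exp_pair, Ex1 by apply Cexp_nz.
      apply (Rmult_le_compat_r (/ (Rmin del r / 2))) in Hd; [|left; apply Rinv_0_lt_compat; lra].
      replace (eps * (Rmin del r / 2) * / (Rmin del r / 2)) with eps in Hd by (field; lra).
      exact Hd. }
  assert (EG : CInt (fun y => G (x1, y)) 0 (2 * PI) = (CInt (fun y => rho (x1, y) - l)%C 0 (2 * PI) + l * (2 *
    PI - 0)%R)%C).
  { rewrite CInt_minus.
    - rewrite CInt_const.
      replace (CInt (fun t => rho (x1, t)) 0 (2 * PI)) with (CInt (fun t => rho (x1, t)) 0 (2 * PI) + CInt (fun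
        y => E1 (x1, y)) 0 (2 * PI))%C
        by (rewrite IE1; ring).
      rewrite <- CInt_plus.
      + rewrite (CInt_ext (fun t => rho (x1, t) + E1 (x1, t))%C (fun y => G (x1, y))); [ring|lra|].
        intros t _; unfold rho; ring.
      + lra.
      + apply (cdiff_rect_vcont rho x1 x2 0 (2 * PI) Hrho); lra.
      + apply (cdiff_rect_vcont E1 x1 x2 0 (2 * PI) HE1); lra.
    - lra.
    - apply (cdiff_rect_vcont rho x1 x2 0 (2 * PI) Hrho); lra.
    - intros; apply rcont_const. }
  rewrite <- EV, EG in B2.
  set (J := CInt (fun y => rho (x1, y) - l)%C 0 (2 * PI)) in *.
  assert (T : Cmod (l * (2 * PI - 0)%R)%C <= M / r * (2 * PI - 0) + eps * (2 * PI - 0)).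
  { replace (l * (2 * PI - 0)%R)%C with ((J + l * (2 * PI - 0)%R) + - J)%C by ring.
    eapply Rle_trans; [apply Cmod_triangle|]. rewrite Cmod_opp. lra. }
  rewrite Cmod_mult, Cmod_R, Rabs_pos_eq in T by lra.
  apply (Rmult_le_reg_r (2 * PI - 0)); lra. }
apply le_of_eps. intros eps He.
set (K := M / R0).
assert (PK : 0 <= K) by (apply Rmult_le_pos; [exact PM|left; now apply Rinv_0_lt_compat]).
(* r is chosen so that M/r <= M/R0 + eps *)
set (r := R0 * (K + eps / 2) / (K + eps)).
assert (Hr : 0 < r < R0).
{ unfold r; split.
  - apply Rdiv_lt_0_compat; [apply Rmult_lt_0_compat|]; lra.
  - apply (Rmult_lt_reg_r (K + eps)); [lra|].
    replace (R0 * (K + eps / 2) / (K + eps) * (K + eps)) with (R0 * (K + eps / 2)) by (field; lra).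
    apply Rmult_lt_compat_l; lra. }
eapply Rle_trans; [apply (Main r Hr)|].
replace (M / r) with (K * (K + eps) / (K + eps / 2)).
- apply (Rmult_le_reg_r (K + eps / 2)); [lra|].
  replace (K * (K + eps) / (K + eps / 2) * (K + eps / 2)) with (K * (K + eps)) by (field; lra). nra.
- assert (EM : M = K * R0) by (unfold K; field; lra).
  rewrite EM. unfold r. field. repeat split; lra.
Qed.

Lemma real_cauchy_limit (u : nat -> R) (K : R) :
  (forall n m, Rabs (u n - u m) <= K * (/ INR (S n) + / INR (S m))) ->
  exists l : R, is_lim_seq u l.
Proof.
intros H.
assert (PK : 0 <= K).
{ specialize (H 0%nat 0%nat). simpl in H. assert (T := Rabs_pos (u 0%nat - u 0%nat)). nra. }
assert (E : ex_finite_lim_seq u).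
{ apply ex_lim_seq_cauchy_corr. intros [eps He].
  destruct (nfloor_ex (2 * (K + 1) / eps)) as [N [_ HN]].
  { apply Rmult_le_pos; [lra|left; now apply Rinv_0_lt_compat]. }
  exists N. intros n m Hn Hm. simpl.
  eapply Rle_lt_trans; [apply H|].
  assert (Q : forall p, (N <= p)%nat -> / INR (S p) < eps / (2 * (K + 1))).
  { intros p Hp. assert (0 < INR (S p)) by (apply lt_0_INR; lia).
    assert (INR N <= INR p) by now apply le_INR.
    rewrite S_INR in *.
    replace (eps / (2 * (K + 1))) with (/ (2 * (K + 1) / eps)) by (field; lra).
    apply Rinv_lt_contravar; [|lra].
    apply Rmult_lt_0_compat; [apply Rdiv_lt_0_compat; lra|lra]. }
  assert (Qn := Q n Hn). assert (Qm := Q m Hm).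
  apply Rle_lt_trans with (K * (eps / (2 * (K + 1)) + eps / (2 * (K + 1)))).
  - apply Rmult_le_compat_l; lra.
  - apply (Rmult_lt_reg_r (2 * (K + 1))); [lra|].
    replace (K * (eps / (2 * (K + 1)) + eps / (2 * (K + 1))) * (2 * (K + 1))) with (K * (2 * eps)) by (field;
      lra).
    nra. }
exact E.
Qed.

(** A Cauchy criterion at [0] with linear rate. The limit is taken along the points [e / (n + 1)] of
    [P], and every other point of [P] is compared with these. It serves both for difference
    quotients and for limits at the vertex of a sector. *)
Lemma cauchy_limit (P : C -> Prop) (q : C -> C) (e : C) (K : R) :
  (forall t, 0 < t <= 1 -> P (e * t)%C) ->
  (forall h k, P h -> P k -> Cmod (q h - q k)%C <= K * (Cmod h + Cmod k)) ->
  exists l, forall h, P h -> Cmod (q h - l)%C <= K * Cmod h.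
Proof.
intros He H.
set (s := fun n => (e * (/ INR (S n))%R)%C).
assert (IS : forall n, 0 < / INR (S n) <= 1).
{ intros n. split; [apply Rinv_0_lt_compat, lt_0_INR; lia|].
  rewrite <- Rinv_1. apply Rinv_le_contravar; [lra|]. rewrite S_INR. assert (T := pos_INR n). lra. }
assert (Ps : forall n, P (s n)) by (intros n; apply He, IS).
assert (Ms : forall n, Cmod (s n) = Cmod e * / INR (S n)).
{ intros n; unfold s. rewrite Cmod_mult, Cmod_R, Rabs_pos_eq; [reflexivity|]. specialize (IS n); lra. }
assert (Cs : forall n m, Cmod (q (s n) - q (s m))%C <= K * Cmod e * (/ INR (S n) + / INR (S m))).
{ intros n m. eapply Rle_trans; [now apply H|]. rewrite !Ms. right; ring. }
destruct (real_cauchy_limit (fun n => Re (q (s n))) (K * Cmod e)) as [l1 L1].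
{ intros n m. eapply Rle_trans; [|apply Cs].
  replace (Re (q (s n)) - Re (q (s m))) with (Re (q (s n) - q (s m))%C) by reflexivity.
  apply re_le_Cmod. }
destruct (real_cauchy_limit (fun n => Im (q (s n))) (K * Cmod e)) as [l2 L2].
{ intros n m. eapply Rle_trans; [|apply Cs].
  replace (Im (q (s n)) - Im (q (s m))) with (Im (q (s n) - q (s m))%C) by reflexivity.
  apply im_le_Cmod. }
exists (l1, l2). intros h Ph. apply le_of_eps. intros eps Heps.
apply is_lim_seq_spec in L1. apply is_lim_seq_spec in L2.
assert (Pe4 : 0 < eps / 4) by lra.
destruct (L1 (mkposreal _ Pe4)) as [N1 HN1]. destruct (L2 (mkposreal _ Pe4)) as [N2 HN2].
simpl in HN1, HN2.
assert (PK : 0 <= K * Cmod e).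
{ specialize (Cs 0%nat 0%nat). simpl in Cs. assert (T := Cmod_ge_0 (q (s 0%nat) - q (s 0%nat))%C). nra. }
destruct (nfloor_ex (2 * (K * Cmod e) / eps)) as [N3 [_ HN3]].
{ apply Rmult_le_pos; [lra|left; now apply Rinv_0_lt_compat]. }
set (n := (N1 + N2 + N3)%nat).
specialize (HN1 n ltac:(lia)). specialize (HN2 n ltac:(lia)).
assert (B1 := H h (s n) Ph (Ps n)). rewrite Ms in B1.
assert (B2 : K * Cmod e * / INR (S n) <= eps / 2).
{ assert (0 < INR (S n)) by (apply lt_0_INR; lia).
  assert (INR N3 <= INR n) by (apply le_INR; lia).
  apply (Rmult_le_reg_r (INR (S n))); [assumption|].
  rewrite Rmult_assoc, Rinv_l, Rmult_1_r by lra.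
  rewrite S_INR.
  apply (Rmult_lt_compat_r eps) in HN3; [|lra].
  replace (2 * (K * Cmod e) / eps * eps) with (2 * (K * Cmod e)) in HN3 by (field; lra).
  nra. }
assert (B3 : Cmod (q (s n) - (l1, l2))%C <= eps / 2).
{ eapply Rle_trans; [apply Cmod_le_Rabs|]. unfold Re, Im in *; simpl in *.
  unfold Rminus in HN1, HN2. lra. }
replace (q h - (l1, l2))%C with ((q h - q (s n)) + (q (s n) - (l1, l2)))%C by ring.
eapply Rle_trans; [apply Cmod_triangle|]. lra.
Qed.

Definition cdiff_disc (f : C -> C) (z0 : C) (r : R) : Prop :=
  forall z, Cmod (z - z0)%C < r -> ex_derive (V := C_NormedModule) f z.

Lemma segment_in_disc (z0 z w : C) (r t : R) :
  0 <= t <= 1 -> Cmod (z - z0) < r -> Cmod (w - z0) < r -> Cmod (w + (z - w) * t - z0) < r.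
Proof.
intros Ht Hz Hw.
replace (w + (z - w) * t - z0)%C with ((z - z0) * t + (w - z0) * (1 - t)%R)%C
  by (rewrite RtoC_minus; ring).
eapply Rle_lt_trans; [apply Cmod_triangle|].
rewrite !Cmod_mult, !Cmod_R, !Rabs_pos_eq by lra.
destruct (Req_dec t 0) as [->|Hn]; [lra|]. nra.
Qed.

Lemma lipschitz_disc (f f' : C -> C) (z0 : C) (r B : R) :
  (forall z, Cmod (z - z0) < r -> cderiv f z (f' z)) ->
  (forall z, Cmod (z - z0) < r -> Cmod (f' z) <= B) ->
  forall z w, Cmod (z - z0) < r -> Cmod (w - z0) < r -> Cmod (f z - f w) <= B * Cmod (z - w).
Proof.
intros Hf HB z w Hz Hw.
set (F := fun t : R => f (w + (z - w) * t)%C).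
assert (E : (f z - f w = F 1 - F 0)%C).
{ unfold F. f_equal; [f_equal; ring|f_equal; f_equal; ring]. }
rewrite E.
replace (B * Cmod (z - w)) with (B * Cmod (z - w) * 1 - B * Cmod (z - w) * 0) by ring.
apply (mean_value_ineq F (fun t : R => f' (w + (z - w) * t) * (z - w))%C (fun t => B * Cmod (z - w) * t)
  (fun _ => B * Cmod (z - w))).
- lra.
- intros t Ht. apply cderiv_rderiv, Hf, segment_in_disc; assumption.
- intros t _; apply is_derive_lin.
- intros t Ht. rewrite Cmod_mult. apply Rmult_le_compat_r; [apply Cmod_ge_0|].
  apply HB, segment_in_disc; assumption.
Qed.

Lemma Cmod_sub_triangle (a b c : C) : Cmod (a - c) <= Cmod (a - b) + Cmod (b - c).
Proof. replace (a - c)%C with ((a - b) + (b - c))%C by ring. apply Cmod_triangle. Qed.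

Lemma cauchy_ineq1 (f : C -> C) (z0 : C) (r M : R) :
  0 < r -> cdiff_disc f z0 r -> (forall z, Cmod (z - z0) < r -> Cmod (f z) <= M) ->
  Cmod (C_derive f z0) <= M / r.
Proof.
intros Hr Hf HM. apply (cauchy_ineq f z0); try assumption.
- intros z Hz. exists (C_derive f z). now apply ex_derive_cderiv, Hf.
- apply ex_derive_cderiv, Hf. replace (z0 - z0)%C with (RtoC 0) by ring. now rewrite Cmod_0.
Qed.

Lemma cderiv_shift (f : C -> C) (h z l : C) :
  cderiv f (z + h) l -> cderiv (fun w => f (w + h)%C) z l.
Proof.
intros H. eapply cderiv_eq; [apply (cderiv_comp f (fun w => w + h)%C); [exact H|]|].
- apply cderiv_plus; [apply cderiv_id|apply cderiv_const].
- ring.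
Qed.

(** Cauchy's inequality is applied to [f (w + h) - f w], which is of size [|h|] by a first
    application to [f]. No second derivative is involved, since its existence is still to be proved.
    Each application uses the radius [r / 4], whence the [16]. *)
Lemma derive_lipschitz_disc (f : C -> C) (z0 : C) (r M : R) :
  0 < r -> cdiff_disc f z0 r -> (forall z, Cmod (z - z0) < r -> Cmod (f z) <= M) ->
  forall z h, Cmod (z - z0) < r / 4 -> Cmod h < r / 4 ->
  Cmod (C_derive f (z + h) - C_derive f z) <= 16 * M / (r * r) * Cmod h.
Proof.
intros Hr Hf HM z h Hz Hh.
assert (L1 : forall w, Cmod (w - z0) < 3 * r / 4 -> Cmod (C_derive f w) <= M / (r / 4)).
{ intros w Hw. apply cauchy_ineq1; [lra| |].
  - intros v Hv. apply Hf. assert (T := Cmod_sub_triangle v w z0). lra.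
  - intros v Hv. apply HM. assert (T := Cmod_sub_triangle v w z0). lra. }
assert (Hc : forall w, Cmod (w - z0) < r -> cderiv f w (C_derive f w)).
{ intros w Hw. now apply ex_derive_cderiv, Hf. }
assert (Lip := lipschitz_disc f (C_derive f) z0 (3 * r / 4) (M / (r / 4))).
assert (Sh : forall w, Cmod (w + h - z0) <= Cmod (w - z0) + Cmod h).
{ intros w. replace (w + h - z0)%C with (w - z0 + h)%C by ring. apply Cmod_triangle. }
assert (Hz' := Sh z).
replace (16 * M / (r * r) * Cmod h) with (M / (r / 4) * Cmod h / (r / 4)) by (field; lra).
apply (cauchy_ineq (fun w => f (w + h) - f w)%C z); [lra| | |].
- intros w Hw. assert (T := Cmod_sub_triangle w z z0). specialize (Sh w).
  eexists. apply cderiv_minus; [apply cderiv_shift|]; apply Hc; lra.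
- intros w Hw. assert (T := Cmod_sub_triangle w z z0). specialize (Sh w).
  replace (Cmod h) with (Cmod (w + h - w)) by (f_equal; ring).
  apply Lip; try lra; intros v Hv; [apply Hc; lra|now apply L1].
- apply cderiv_minus; [apply cderiv_shift|]; apply Hc; lra.
Qed.

Lemma cauchy_quadratic (f : C -> C) (z0 : C) (r M : R) :
  0 < r -> cdiff_disc f z0 r -> (forall z, Cmod (z - z0) < r -> Cmod (f z) <= M) ->
  forall z h, Cmod (z - z0) < r / 4 -> Cmod h < r / 4 ->
  Cmod (f (z + h) - f z - C_derive f z * h)%C <= 16 * M / (r * r) * (Cmod h * Cmod h).
Proof.
intros Hr Hf HM z h Hz Hh.
assert (PM : 0 <= M).
{ eapply Rle_trans; [apply Cmod_ge_0|apply (HM z0)].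
  replace (z0 - z0)%C with (RtoC 0) by ring. now rewrite Cmod_0. }
set (L := 16 * M / (r * r)).
assert (PL : 0 <= L).
{ apply Rmult_le_pos; [lra|]. left; apply Rinv_0_lt_compat; nra. }
set (g := C_derive f z).
set (F := fun t : R => (f (z + h * t) - (0 + (g * h) * t))%C).
assert (Ph := Cmod_ge_0 h).
assert (E : (f (z + h) - f z - g * h = F 1 - F 0)%C).
{ unfold F. replace (z + h * 1%R)%C with (z + h)%C by ring. replace (z + h * 0%R)%C with z by ring. ring. }
rewrite E.
replace (L * (Cmod h * Cmod h)) with (L * (Cmod h * Cmod h) * 1 - L * (Cmod h * Cmod h) * 0) by ring.
assert (Sm : forall t, 0 <= t <= 1 -> Cmod (h * t) <= Cmod h).
{ intros t Ht. rewrite Cmod_mult, Cmod_R, Rabs_pos_eq by lra. nra. }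
apply (mean_value_ineq F (fun t : R => C_derive f (z + h * t) * h - g * h)%C (fun t => L * (Cmod h * Cmod h) *
  t)
  (fun _ => L * (Cmod h * Cmod h))).
- lra.
- intros t Ht. apply rderiv_minus; [|apply rderiv_line].
  apply cderiv_rderiv. apply ex_derive_cderiv, Hf.
  replace (z + h * t - z0)%C with ((z - z0) + h * t)%C by ring.
  eapply Rle_lt_trans; [apply Cmod_triangle|]. specialize (Sm t Ht). lra.
- intros t _; apply is_derive_lin.
- intros t Ht. replace (C_derive f (z + h * t) * h - g * h)%C with ((C_derive f (z + h * t) - g) * h)%C by ring.
  rewrite Cmod_mult, <- Rmult_assoc. apply Rmult_le_compat_r; [exact Ph|].
  specialize (Sm t Ht).
  eapply Rle_trans; [apply (derive_lipschitz_disc f z0 r M); try assumption; lra|].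
  apply Rmult_le_compat_l; assumption.
Qed.

(* By the Cauchy inequality, the derivatives at [z0] of the difference quotients of [f] form a Cauchy net. *)
Lemma derive_cdiff_bounded (f : C -> C) (z0 : C) (r M : R) :
  0 < r -> cdiff_disc f z0 r -> (forall z, Cmod (z - z0) < r -> Cmod (f z) <= M) ->
  exists l, cderiv (C_derive f) z0 l.
Proof.
intros Hr Hf HM.
assert (Z0 : forall R0, 0 < R0 -> Cmod (z0 - z0) < R0).
{ intros R0 H0. replace (z0 - z0)%C with (RtoC 0) by ring. now rewrite Cmod_0. }
assert (PM : 0 <= M).
{ eapply Rle_trans; [apply Cmod_ge_0|apply (HM z0); now apply Z0]. }
set (L := 16 * M / (r * r)).
assert (PL : 0 <= L).
{ apply Rmult_le_pos; [lra|]. left; apply Rinv_0_lt_compat; nra. }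
assert (Hc : forall w, Cmod (w - z0) < r -> cderiv f w (C_derive f w)).
{ intros w Hw. now apply ex_derive_cderiv, Hf. }
set (q := fun h => ((C_derive f (z0 + h) - C_derive f z0) / h)%C).
set (P := fun h : C => h <> RtoC 0 /\ Cmod h < r / 8).
set (K := L / (r / 8)).
assert (Quot : forall h w, P h -> Cmod (w - z0) < r / 8 ->
   Cmod ((f (w + h) - f w) / h - C_derive f w)%C <= L * Cmod h).
{ intros h w [Hn Hh] Hw.
  assert (Q := cauchy_quadratic f z0 r M Hr Hf HM w h ltac:(lra) ltac:(lra)).
  replace ((f (w + h) - f w) / h - C_derive f w)%C with ((f (w + h) - f w - C_derive f w * h) * / h)%C
    by (field; exact Hn).
  assert (0 < Cmod h) by now apply Cmod_gt_0.
  rewrite Cmod_mult, Cmod_inv by exact Hn. fold L in Q.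
  apply (Rmult_le_compat_r (/ Cmod h)) in Q; [|left; now apply Rinv_0_lt_compat].
  replace (L * (Cmod h * Cmod h) * / Cmod h) with (L * Cmod h) in Q by (field; lra). exact Q. }
assert (Dq : forall h w, P h -> Cmod (w - z0) < r / 8 ->
   cderiv (fun w => (f (w + h) - f w) / h)%C w ((C_derive f (w + h) - C_derive f w) / h)%C).
{ intros h w [Hn Hh] Hw.
  assert (Sh : Cmod (w + h - z0) <= Cmod (w - z0) + Cmod h).
  { replace (w + h - z0)%C with (w - z0 + h)%C by ring. apply Cmod_triangle. }
  apply (cderiv_ext_loc (fun w => / h * (f (w + h) - f w))%C _ w _ 1 Rlt_0_1); [intros; unfold Cdiv; ring|].
  eapply cderiv_eq; [apply cderiv_scal, cderiv_minus; [apply cderiv_shift|]; apply Hc; lra|].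
  unfold Cdiv; ring. }
destruct (cauchy_limit P q (RtoC (r / 16)) K) as [l Hl].
- intros t Ht. split.
  + rewrite <- RtoC_mult. intros Q. apply RtoC_inj in Q. nra.
  + rewrite <- RtoC_mult, Cmod_R, Rabs_pos_eq; nra.
- intros h k Hh Hk.
  replace (K * (Cmod h + Cmod k)) with (L * (Cmod h + Cmod k) / (r / 8)) by (unfold K; field; lra).
  apply (cauchy_ineq (fun w => (f (w + h) - f w) / h - (f (w + k) - f w) / k)%C z0); [lra| | |].
  + intros w Hw. eexists. apply cderiv_minus; now apply Dq.
  + intros w Hw. assert (Q1 := Quot h w Hh Hw). assert (Q2 := Quot k w Hk Hw).
    assert (T := Cmod_sub_triangle ((f (w + h) - f w) / h)%C (C_derive f w) ((f (w + k) - f w) / k)%C).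
    replace (C_derive f w - (f (w + k) - f w) / k)%C with (- ((f (w + k) - f w) / k - C_derive f w))%C in T by
      ring.
    rewrite Cmod_opp in T. lra.
  + apply cderiv_minus; apply Dq; try assumption; apply Z0; lra.
- exists l. intros eps He.
  assert (PK : 0 <= K) by (apply Rmult_le_pos; [exact PL|left; apply Rinv_0_lt_compat; lra]).
  exists (Rmin (r / 8) (eps / (K + 1))). split; [apply Rmin_pos; [lra|apply Rdiv_lt_0_compat; lra]|].
  intros h Hh.
  assert (H1 := Rlt_le_trans _ _ _ Hh (Rmin_l _ _)).
  assert (H2 := Rlt_le_trans _ _ _ Hh (Rmin_r _ _)).
  destruct (Ceq_dec h 0) as [->|Hn].
  { replace (C_derive f (z0 + 0) - C_derive f z0 - l * 0)%C with (RtoC 0) by (rewrite Cplus_0_r; ring).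
    rewrite Cmod_0; lra. }
  specialize (Hl h (conj Hn H1)).
  replace (C_derive f (z0 + h) - C_derive f z0 - l * h)%C with ((q h - l) * h)%C by (unfold q; field; exact Hn).
  rewrite Cmod_mult. apply Rmult_le_compat_r; [apply Cmod_ge_0|].
  apply (Rmult_lt_compat_r (K + 1)) in H2; [|lra].
  replace (eps / (K + 1) * (K + 1)) with eps in H2 by (field; lra).
  assert (T := Cmod_ge_0 h). nra.
Qed.

(** * Iterated derivatives of holomorphic functions *)

Definition C_open (U : C -> Prop) : Prop :=
  forall z, U z -> exists r, 0 < r /\ forall w, Cmod (w - z) < r -> U w.

Definition holo (U : C -> Prop) (f : C -> C) : Prop :=
  forall z, U z -> ex_derive (V := C_NormedModule) f z.

(** Continuity at [z] provides a disc on which [f] is bounded, as [derive_cdiff_bounded]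
    requires. *)
Lemma holo_derive (U : C -> Prop) (f : C -> C) : C_open U -> holo U f -> holo U (C_derive f).
Proof.
intros HU Hf z Hz.
destruct (HU z Hz) as [r [Hr HrU]].
destruct (cderiv_cont f z _ (proj1 (ex_derive_cderiv f z) (Hf z Hz)) 1 Rlt_0_1) as [d [Hd Hc]].
destruct (derive_cdiff_bounded f z (Rmin r d) (Cmod (f z) + 1)) as [l Hl].
- now apply Rmin_pos.
- intros w Hw. apply Hf, HrU. eapply Rlt_le_trans; [exact Hw|apply Rmin_l].
- intros w Hw. specialize (Hc (w - z)%C (Rlt_le_trans _ _ _ Hw (Rmin_r _ _))).
  replace (z + (w - z))%C with w in Hc by ring.
  replace (f w) with ((f w - f z) + f z)%C by ring.
  eapply Rle_trans; [apply Cmod_triangle|]. lra.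
- exists l. now apply cderiv_is_derive.
Qed.

Lemma holo_derive_n (U : C -> Prop) (f : C -> C) (k : nat) :
  C_open U -> holo U f -> holo U (C_derive_n f k).
Proof.
intros HU Hf; induction k as [|k IH]; [exact Hf|]. now apply holo_derive.
Qed.

Lemma cderiv_derive_n (U : C -> Prop) (f : C -> C) (k : nat) (z : C) :
  C_open U -> holo U f -> U z -> cderiv (C_derive_n f k) z (C_derive_n f (S k) z).
Proof.
intros HU Hf Hz. apply ex_derive_cderiv. now apply (holo_derive_n U f k HU Hf).
Qed.

(** Reads off all iterated derivatives from a guessed formula. Openness of [U] matters: the
    functions agree on [U] only, and differentiation needs agreement on a disc. *)
Lemma derive_n_chain (U : C -> Prop) (f : C -> C) (D : nat -> C -> C) :
  C_open U -> (forall z, U z -> D 0%nat z = f z) ->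
  (forall k z, U z -> cderiv (D k) z (D (S k) z)) ->
  forall k z, U z -> C_derive_n f k z = D k z.
Proof.
intros HU H0 HD. induction k as [|k IH]; intros z Hz; [symmetry; now apply H0|].
apply cderiv_C_derive. destruct (HU z Hz) as [r [Hr HrU]].
apply (cderiv_ext_loc (D k) _ z _ r Hr); [|now apply HD].
intros w Hw. symmetry. now apply IH, HrU.
Qed.

Definition C_disc (z0 : C) (r : R) (z : C) : Prop := Cmod (z - z0) < r.

Lemma disc_open (z0 : C) (r : R) : C_open (C_disc z0 r).
Proof.
intros z Hz. exists (r - Cmod (z - z0)). split; [unfold C_disc in Hz; lra|].
intros w Hw. unfold C_disc. assert (T := Cmod_sub_triangle w z z0). lra.
Qed.

Lemma disc_center (z0 : C) (r : R) : 0 < r -> C_disc z0 r z0.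
Proof. intros Hr. unfold C_disc. replace (z0 - z0)%C with (RtoC 0) by ring. now rewrite Cmod_0. Qed.

(** Induction with [(1 + 1/k)^k <= e]. Up to geometric factors this stands in for Stirling's
    formula. *)
Lemma pow_self_le_fact (k : nat) : INR k ^ k <= exp 1 ^ k * INR (fact k).
Proof.
assert (P1 := exp_pos 1).
induction k as [|k IH]; [simpl; lra|].
rewrite fact_simpl, mult_INR.
assert (Q : INR (S k) ^ k <= exp 1 * INR k ^ k).
{ destruct k as [|k].
  - simpl. assert (T := exp_ineq1 1). lra.
  - assert (Pk : 0 < INR (S k)) by (apply lt_0_INR; lia).
    replace (INR (S (S k))) with (INR (S k) * (1 + / INR (S k))) by (rewrite (S_INR (S k)); field; lra).
    rewrite Rpow_mult_distr.
    rewrite Rmult_comm. apply Rmult_le_compat_r; [left; now apply pow_lt|].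
    apply Rle_trans with (exp (/ INR (S k)) ^ S k).
    + apply pow_incr. assert (Pi : 0 < / INR (S k)) by now apply Rinv_0_lt_compat.
      split; [lra|]. assert (T := exp_ineq1_le (/ INR (S k))). lra.
    + assert (EI : forall m x, exp x ^ m = exp (INR m * x)).
      { induction m as [|m IHm]; intros x; [simpl; rewrite Rmult_0_l, exp_0; reflexivity|].
        simpl pow. rewrite IHm, <- exp_plus, S_INR. f_equal; ring. }
      rewrite EI, Rinv_r by lra. lra. }
change (INR (S k) ^ S k) with (INR (S k) * INR (S k) ^ k).
change (exp 1 ^ S k) with (exp 1 * exp 1 ^ k).
assert (Pk : 0 < INR (S k)) by (apply lt_0_INR; lia).
replace (exp 1 * exp 1 ^ k * (INR (S k) * INR (fact k)))
  with (INR (S k) * (exp 1 * (exp 1 ^ k * INR (fact k)))) by ring.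
apply Rmult_le_compat_l; [lra|].
eapply Rle_trans; [exact Q|]. apply Rmult_le_compat_l; lra.
Qed.

(** The first-order inequality iterated [k] times with radius [r / k] gives [M (k / r)^k], and
    [k^k <= e^k k!]. The factor [e^k] is the price for avoiding an integral formula for higher
    derivatives. *)
Lemma cauchy_ineq_n (f : C -> C) (z0 : C) (r M : R) (k : nat) :
  0 < r -> cdiff_disc f z0 r -> (forall z, Cmod (z - z0) < r -> Cmod (f z) <= M) ->
  Cmod (C_derive_n f k z0) <= M * (exp 1 / r) ^ k * INR (fact k).
Proof.
intros Hr Hf HM.
assert (PM : 0 <= M) by (eapply Rle_trans; [apply Cmod_ge_0|apply (HM z0), disc_center, Hr]).
assert (Main : forall rho, 0 < rho -> forall j z, Cmod (z - z0) < r -> Cmod (z - z0) + INR j * rho <= r ->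
  Cmod (C_derive_n f j z) <= M / rho ^ j).
{ intros rho Hrho. induction j as [|j IH]; intros z Hz Hj.
  - simpl. rewrite Rdiv_1_r. now apply HM.
  - rewrite S_INR in Hj. assert (T0 := pos_INR j).
    assert (Sub : forall w, Cmod (w - z) < rho -> Cmod (w - z0) < r /\ Cmod (w - z0) + INR j * rho <= r).
    { intros w Hw. assert (T := Cmod_sub_triangle w z z0). nra. }
    replace (M / rho ^ S j) with (M / rho ^ j / rho) by (simpl; field; split; [apply pow_nonzero|]; lra).
    apply cauchy_ineq1; [exact Hrho| |].
    + intros w Hw. apply (holo_derive_n (C_disc z0 r) f j); [apply disc_open|exact Hf|now apply Sub].
    + intros w Hw. now apply IH; apply Sub. }
destruct k as [|k].
- simpl. rewrite !Rmult_1_r. apply HM, disc_center, Hr.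
- assert (Pk : 0 < INR (S k)) by (apply lt_0_INR; lia).
  assert (Pr : 0 < r / INR (S k)) by now apply Rdiv_lt_0_compat.
  eapply Rle_trans; [apply (Main (r / INR (S k)))|].
  + exact Pr.
  + apply disc_center, Hr.
  + replace (z0 - z0)%C with (RtoC 0) by ring. rewrite Cmod_0. right; field; lra.
  + unfold Rdiv at 1. rewrite <- pow_inv, Rmult_assoc. apply Rmult_le_compat_l; [exact PM|].
    replace (/ (r / INR (S k))) with (INR (S k) * / r) by (field; lra).
    unfold Rdiv. rewrite !Rpow_mult_distr.
    replace (exp 1 ^ S k * (/ r) ^ S k * INR (fact (S k)))
      with (exp 1 ^ S k * INR (fact (S k)) * (/ r) ^ S k) by ring.
    apply Rmult_le_compat_r; [|apply pow_self_le_fact].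
    apply pow_le. left; now apply Rinv_0_lt_compat.
Qed.

(** Taylor's estimate with vanishing limits at [0]. Everything is required for [t > 0] alone,
    because in the main application [t = 0] is the vertex of a sector; each induction step
    integrates from a point [s] near [0]. *)
Lemma taylor_flat (n : nat) : forall (F : nat -> R -> C) (B : R),
  (forall k t, 0 < t <= 1 -> rderiv (F k) t (F (S k) t)) ->
  (forall k, (k < n)%nat -> forall eps, 0 < eps -> exists d, 0 < d /\
     forall t, 0 < t < d -> t <= 1 -> Cmod (F k t) <= eps) ->
  (forall t, 0 < t <= 1 -> Cmod (F n t) <= B) ->
  forall t, 0 < t <= 1 -> Cmod (F 0%nat t) <= B / INR (fact n) * t ^ n.
Proof.
induction n as [|n IH]; intros F B Hd Hz HB t Ht.
- simpl. unfold Rdiv. rewrite Rinv_1, !Rmult_1_r. now apply HB.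
- assert (PB : 0 <= B) by (eapply Rle_trans; [apply Cmod_ge_0|now apply (HB t)]).
  assert (IH1 := IH (fun k => F (S k)) B ltac:(intros; now apply Hd)
    ltac:(intros k Hk; apply Hz; lia) HB).
  assert (Pf : 0 < INR (fact n)) by (apply lt_0_INR, lt_O_fact).
  assert (PS : 0 < INR (S n)) by (apply lt_0_INR; lia).
  assert (PSf : 0 < INR (fact (S n))) by (apply lt_0_INR, lt_O_fact).
  set (c := B / INR (fact (S n))).
  assert (Pc : 0 <= c) by (apply Rmult_le_pos; [exact PB|left; now apply Rinv_0_lt_compat]).
  apply le_of_eps. intros eps He.
  destruct (Hz 0%nat ltac:(lia) eps He) as [d [Hd0 Hd1]].
  set (s := Rmin t d / 2).
  assert (Pm : 0 < Rmin t d) by (apply Rmin_pos; lra).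
  assert (L1 := Rmin_l t d). assert (L2 := Rmin_r t d).
  assert (Hs : 0 < s /\ s < d /\ s <= t) by (unfold s; lra).
  assert (Hs2 := Hd1 s ltac:(lra) ltac:(lra)).
  assert (MV : Cmod (F 0%nat t - F 0%nat s) <= c * t ^ S n - c * s ^ S n).
  { apply (mean_value_ineq (F 0%nat) (F 1%nat) (fun x => c * x ^ S n) (fun x => c * (INR (S n) * x ^ n))).
    - lra.
    - intros x Hx; apply Hd; lra.
    - intros x Hx. apply is_derive_scal.
      replace (INR (S n) * x ^ n) with (INR (S n) * 1 * x ^ pred (S n)) by (simpl pred; ring).
      apply is_derive_pow. apply (is_derive_id (K := R_AbsRing)).
    - intros x Hx. eapply Rle_trans; [apply IH1; lra|].
      right. unfold c. rewrite fact_simpl, mult_INR. field. split; apply Rgt_not_eq; assumption. }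
  assert (0 <= c * s ^ S n) by (apply Rmult_le_pos; [exact Pc|apply pow_le; lra]).
  replace (F 0%nat t) with ((F 0%nat t - F 0%nat s) + F 0%nat s)%C by ring.
  eapply Rle_trans; [apply Cmod_triangle|]. lra.
Qed.

Lemma pow_lt1_small (x M eps : R) : 0 <= x < 1 -> 0 < eps -> exists n, M * x ^ n <= eps.
Proof.
intros Hx He.
destruct (pow_lt_1_zero x) with (y := eps / (Rabs M + 1)) as [N HN].
- rewrite Rabs_pos_eq; lra.
- apply Rdiv_lt_0_compat; [lra|]. assert (T := Rabs_pos M). lra.
- exists N. specialize (HN N (le_n N)). rewrite Rabs_pos_eq in HN by (apply pow_le; lra).
  assert (T := Rabs_pos M). assert (T2 := Rle_abs M).
  apply (Rmult_lt_compat_l (Rabs M + 1)) in HN; [|lra].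
  replace ((Rabs M + 1) * (eps / (Rabs M + 1))) with eps in HN by (field; lra).
  assert (0 <= x ^ N) by (apply pow_le; lra). nra.
Qed.

Lemma exp1_lt_4 : exp 1 < 4.
Proof. assert (T := exp_le_3). lra. Qed.

(** Taylor's estimate on the segment gives [|f z| <= M (2 e |z - z0| / r)^n] for every [n]; the
    radius [r / 8] makes the ratio at most [e / 4 < 1]. *)
Lemma flat_point_zero (f : C -> C) (z0 : C) (r M : R) :
  0 < r -> cdiff_disc f z0 r -> (forall z, Cmod (z - z0) < r -> Cmod (f z) <= M) ->
  (forall k, C_derive_n f k z0 = 0) ->
  forall z, Cmod (z - z0) <= r / 8 -> f z = 0.
Proof.
intros Hr Hf HM H0 z Hz.
assert (Hd : forall k w, Cmod (w - z0) < r -> cderiv (C_derive_n f k) w (C_derive_n f (S k) w)).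
{ intros k w Hw. apply (cderiv_derive_n (C_disc z0 r)); [apply disc_open|exact Hf|exact Hw]. }
assert (Hn : forall n w, Cmod (w - z0) < r / 2 -> Cmod (C_derive_n f n w) <= M * (exp 1 / (r / 2)) ^ n * INR
  (fact n)).
{ intros n w Hw. apply cauchy_ineq_n; [lra| |].
  - intros v Hv. apply Hf. assert (T := Cmod_sub_triangle v w z0). lra.
  - intros v Hv. apply HM. assert (T := Cmod_sub_triangle v w z0). lra. }
set (v := (z - z0)%C) in *. assert (Pv := Cmod_ge_0 v).
assert (Seg : forall t, 0 <= t <= 1 -> Cmod (z0 + v * t - z0)%C <= Cmod v).
{ intros t Ht. replace (z0 + v * t - z0)%C with (v * t)%C by ring.
  rewrite Cmod_mult, Cmod_R, Rabs_pos_eq by lra. nra. }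
set (F := fun (k : nat) (t : R) => (v ^ k * C_derive_n f k (z0 + v * t))%C).
set (x := exp 1 / (r / 2) * Cmod v).
assert (Pe := exp_pos 1). assert (P4 := exp1_lt_4).
assert (Px0 : 0 < exp 1 / (r / 2)) by (apply Rdiv_lt_0_compat; lra).
assert (Hx : 0 <= x < 1).
{ unfold x. split; [nra|]. apply Rle_lt_trans with (exp 1 / (r / 2) * (r / 8)).
  - apply Rmult_le_compat_l; lra.
  - replace (exp 1 / (r / 2) * (r / 8)) with (exp 1 / 4) by (field; lra). lra. }
assert (B : forall n, Cmod (f z) <= M * x ^ n).
{ intros n.
  assert (Pf : 0 < INR (fact n)) by (apply lt_0_INR, lt_O_fact).
  replace (f z) with (F 0%nat 1) by (unfold F; simpl; rewrite Cmult_1_l; f_equal; unfold v; ring).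
  replace (M * x ^ n) with (M * x ^ n * INR (fact n) / INR (fact n) * 1 ^ n)
    by (rewrite pow1; field; lra).
  apply (taylor_flat n F); [| | |lra].
  - intros k t Ht. unfold F. specialize (Seg t ltac:(lra)).
    eapply rderiv_eq; [apply (cderiv_rderiv (fun w => v ^ k * C_derive_n f k w)%C); apply cderiv_scal, Hd;
      lra|].
    rewrite Cpow_S. ring.
  - intros k _ eps He. 
    destruct (cderiv_cont (fun w => v ^ k * C_derive_n f k w)%C z0 _
       (cderiv_scal _ (v ^ k)%C _ _ (Hd k z0 (disc_center z0 r Hr))) eps He) as [d [Pd Hc]].
    exists (d / (Cmod v + 1)). split; [apply Rdiv_lt_0_compat; lra|].
    intros t Ht Ht1.
    assert (Q : Cmod (v * t) < d).
    { rewrite Cmod_mult, Cmod_R, Rabs_pos_eq by lra.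
      destruct Ht as [Ht0 Ht]. apply (Rmult_lt_compat_l (Cmod v + 1)) in Ht; [|lra].
      replace ((Cmod v + 1) * (d / (Cmod v + 1))) with d in Ht by (field; lra). nra. }
    specialize (Hc _ Q). rewrite H0 in Hc. unfold F.
    replace (v ^ k * C_derive_n f k (z0 + v * t))%C
      with (v ^ k * C_derive_n f k (z0 + v * t) - v ^ k * 0)%C by ring. exact Hc.
  - intros t Ht. unfold F. rewrite Cmod_mult, Cmod_pow.
    specialize (Seg t ltac:(lra)).
    apply Rle_trans with (Cmod v ^ n * (M * (exp 1 / (r / 2)) ^ n * INR (fact n))).
    + apply Rmult_le_compat_l; [now apply pow_le|apply Hn; lra].
    + right. unfold x. rewrite Rpow_mult_distr. ring. }
apply Cmod_eq_0. apply Rle_antisym; [|apply Cmod_ge_0].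
apply le_of_eps. intros eps He. rewrite Rplus_0_l.
destruct (pow_lt1_small x M eps Hx He) as [n Hn']. specialize (B n). lra.
Qed.

(** * Sectors *)

Lemma make_sector (r a b : R) :
  0 < r -> a < b -> b - a <= 2 * PI ->
  exists S : sector, radius S = r /\ arg_inf S = a /\ arg_sup S = b.
Proof.
intros Hr Hab H.
assert (H2 : 0 < b - a <= 2 * PI) by lra.
exists (Sector r a b Hr H2). now simpl.
Qed.

(** Polar coordinates with [x = ln |z|]. Most arguments on sectors are carried out in the variable
    [(x, t)], where sectors are half strips and rotations are translations. *)
Lemma in_sector_iff (S : sector) (z : C) :
  in_sector S z <-> exists x t, exp x < radius S /\ arg_inf S < t < arg_sup S /\ z = Cexp (x, t).
Proof.
split.
- intros [[H0 H1] [t [Ht E]]]. exists (ln (Cmod z)), t. repeat split; try tauto.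
  + now rewrite exp_ln.
  + rewrite E at 1. unfold Cexp; simpl. now rewrite exp_ln.
- intros [x [t [Hx [Ht ->]]]]. split.
  + rewrite Cmod_Cexp. simpl. split; [apply exp_pos|exact Hx].
  + exists t. split; [exact Ht|]. rewrite Cmod_Cexp. reflexivity.
Qed.

Lemma in_sector_Cexp (S : sector) (x t : R) :
  exp x < radius S -> arg_inf S < t < arg_sup S -> in_sector S (Cexp (x, t)).
Proof. intros Hx Ht. apply in_sector_iff. now exists x, t. Qed.

Lemma Rabs_atan_le (x : R) : Rabs (atan x) <= Rabs x.
Proof.
destruct (MVT_gen atan 0 x (fun y => / (1 + y ^ 2))) as [c [_ E]].
- intros y _. auto_derive; [exact I|]. field. nra.
- intros y _. apply continuity_pt_filterlim, (ex_derive_continuous atan). auto_derive. exact I.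
- rewrite atan_0, !Rminus_0_r in E. rewrite E, Rabs_mult.
  assert (0 < 1 + c ^ 2) by nra.
  assert (Q : Rabs (/ (1 + c ^ 2)) <= 1).
  { rewrite Rabs_pos_eq; [|left; now apply Rinv_0_lt_compat].
    rewrite <- Rinv_1. apply Rinv_le_contravar; nra. }
  assert (T := Rabs_pos x). nra.
Qed.

Lemma polar_right_half (p q : R) :
  0 < p -> (p, q) = Cexp (ln (Cmod (p, q)), atan (q / p)).
Proof.
intros Hp.
assert (HC : 0 < Cmod (p, q)).
{ apply Cmod_gt_0. intros E. injection E. lra. }
assert (E : Cmod (p, q) = p * sqrt (1 + (q / p)²)).
{ unfold Cmod; simpl.
  replace (p * (p * 1) + q * (q * 1)) with (p * p * (1 + (q / p)²)) by (unfold Rsqr; field; lra).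
  assert (T := Rle_0_sqr (q / p)).
  rewrite sqrt_mult, sqrt_square; try lra; nra. }
assert (Ps : 0 < sqrt (1 + (q / p)²)) by (apply sqrt_lt_R0; assert (T := Rle_0_sqr (q / p)); lra).
unfold Cexp; simpl. rewrite exp_ln by exact HC. rewrite cos_atan, sin_atan, E.
f_equal; field; lra.
Qed.

(** Write [z + h = z (1 + u)] with [|u| <= eta]: the argument and the logarithm of the modulus move
    by amounts independent of [z]. Hence the discs may have radius proportional to [|z|]. *)
Lemma sector_disc (S' S : sector) :
  subsector S' S -> exists eta, 0 < eta < 1 /\
    forall z h, in_sector S' z -> Cmod h <= eta * Cmod z -> in_sector S (z + h)%C.
Proof.
intros [Hr [Ha Hb]].
assert (R' := radius_pos S').
set (g := Rmin (arg_inf S' - arg_inf S) (arg_sup S - arg_sup S')).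
assert (Pg : 0 < g) by (apply Rmin_pos; lra).
assert (Lg1 := Rmin_l (arg_inf S' - arg_inf S) (arg_sup S - arg_sup S')). fold g in Lg1.
assert (Lg2 := Rmin_r (arg_inf S' - arg_inf S) (arg_sup S - arg_sup S')). fold g in Lg2.
set (k := (radius S - radius S') / radius S').
assert (Pk : 0 < k) by (apply Rdiv_lt_0_compat; lra).
(* [1 / 2] keeps the real part of [1 + u] at least [1 / 2], so that its argument is at most [2 eta];
   [g / 4] makes this at most half the angular margin; [k] takes care of the radius. *)
set (eta := Rmin (1 / 2) (Rmin (g / 4) k)).
assert (Pe : 0 < eta) by (repeat apply Rmin_pos; lra).
assert (e1 : eta <= 1 / 2) by apply Rmin_l.
assert (e2 : eta <= g / 4) by (eapply Rle_trans; [apply Rmin_r|apply Rmin_l]).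
assert (e3 : eta <= k) by (eapply Rle_trans; [apply Rmin_r|apply Rmin_r]).
exists eta; split; [lra|].
intros z h Hz Hh.
apply in_sector_iff in Hz. destruct Hz as [x [t [Hx [Ht Ez]]]].
assert (Mz : Cmod z = exp x) by (rewrite Ez; apply Cmod_Cexp).
assert (Nz : z <> RtoC 0) by (rewrite Ez; apply Cexp_nz).
assert (Pz := exp_pos x).
set (u := (h / z)%C).
assert (Mu : Cmod u <= eta).
{ unfold u. rewrite Cmod_div by exact Nz. rewrite Mz in *.
  apply (Rmult_le_reg_r (exp x)); [exact Pz|]. replace (Cmod h / exp x * exp x) with (Cmod h) by (field; lra).
    exact Hh. }
assert (Ezh : (z + h = z * (1 + u))%C) by (unfold u; field; exact Nz).
assert (U1 := Rle_trans _ _ _ (re_le_Cmod u) Mu). assert (U2 := Rle_trans _ _ _ (im_le_Cmod u) Mu).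
apply Rabs_le_between in U1. 
set (p := 1 + Re u). set (q := Im u).
assert (Pp : 1 / 2 <= p) by (unfold p; lra).
assert (Epq : (1 + u)%C = (p, q)).
{ unfold p, q. destruct u as [u1 u2]. unfold Cplus, RtoC, Re, Im; simpl. f_equal; ring. }
assert (HC : 0 < Cmod (p, q)).
{ apply Cmod_gt_0. intros E. injection E. lra. }
apply in_sector_iff. exists (x + ln (Cmod (p, q))), (t + atan (q / p)).
split; [|split].
- rewrite exp_plus, exp_ln by exact HC.
  assert (B : Cmod (p, q) <= 1 + k).
  { rewrite <- Epq. eapply Rle_trans; [apply Cmod_triangle|]. rewrite Cmod_1. lra. }
  assert (EK : radius S' * (1 + k) = radius S) by (unfold k; field; lra).
  apply Rle_lt_trans with (exp x * (1 + k)); [apply Rmult_le_compat_l; lra|].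
  rewrite <- EK. apply Rmult_lt_compat_r; lra.
- assert (B : Rabs (atan (q / p)) <= g / 2).
  { eapply Rle_trans; [apply Rabs_atan_le|]. unfold Rdiv at 1. rewrite Rabs_mult.
    rewrite (Rabs_pos_eq (/ p)) by (left; apply Rinv_0_lt_compat; lra).
    apply (Rmult_le_reg_r p); [lra|]. rewrite Rmult_assoc, Rinv_l, Rmult_1_r by lra.
    unfold q. nra. }
  apply Rabs_le_between in B. lra.
- rewrite Ezh, Ez, Epq. rewrite (polar_right_half p q) at 1 by lra.
  rewrite <- Cexp_plus. f_equal.
Qed.

Lemma subsector_incl (S' S : sector) (z : C) : subsector S' S -> in_sector S' z -> in_sector S z.
Proof.
intros [Hr [Ha Hb]] [H0 [t [Ht E]]]. split; [lra|]. exists t. split; [lra|exact E].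
Qed.

Lemma subsector_interp (S' S : sector) :
  subsector S' S -> exists S'', subsector S' S'' /\ subsector S'' S.
Proof.
intros [Hr [Ha Hb]].
assert (B := arg_bounds S). assert (B' := arg_bounds S'). assert (P := radius_pos S').
destruct (make_sector ((radius S' + radius S) / 2) ((arg_inf S' + arg_inf S) / 2) ((arg_sup S' + arg_sup S) /
  2))
  as [T [T1 [T2 T3]]]; try lra.
exists T. unfold subsector. rewrite T1, T2, T3. lra.
Qed.

Lemma in_some_subsector (S : sector) (z : C) :
  in_sector S z -> exists S', subsector S' S /\ in_sector S' z.
Proof.
intros [H0 [t [Ht E]]].
assert (B := arg_bounds S).
destruct (make_sector ((Cmod z + radius S) / 2) ((t + arg_inf S) / 2) ((t + arg_sup S) / 2))
  as [T [T1 [T2 T3]]]; try lra.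
exists T. unfold subsector, in_sector. rewrite T1, T2, T3. split; [lra|]. split; [lra|].
exists t. split; [lra|exact E].
Qed.

Lemma subsector_join (S S1 S2 : sector) :
  subsector S1 S -> subsector S2 S -> exists S3, subsector S3 S /\
    (forall z, in_sector S1 z -> in_sector S3 z) /\ (forall z, in_sector S2 z -> in_sector S3 z).
Proof.
intros [R1 [A1 B1]] [R2 [A2 B2]].
assert (B := arg_bounds S). assert (BS1 := arg_bounds S1). assert (P1 := radius_pos S1).
assert (M1 := Rmax_l (radius S1) (radius S2)). assert (M2 := Rmax_r (radius S1) (radius S2)).
assert (M3 := Rmax_l (arg_sup S1) (arg_sup S2)). assert (M4 := Rmax_r (arg_sup S1) (arg_sup S2)).
assert (M5 := Rmin_l (arg_inf S1) (arg_inf S2)). assert (M6 := Rmin_r (arg_inf S1) (arg_inf S2)).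
assert (M7 := Rmax_lub_lt _ _ _ R1 R2). assert (M8 := Rmax_lub_lt _ _ _ B1 B2).
assert (M9 := Rmin_glb_lt _ _ _ A1 A2).
destruct (make_sector (Rmax (radius S1) (radius S2)) (Rmin (arg_inf S1) (arg_inf S2)) (Rmax (arg_sup S1)
  (arg_sup S2)))
  as [T [T1 [T2 T3]]]; try lra.
exists T. unfold subsector, in_sector. rewrite T1, T2, T3. split; [lra|].
split; intros z [H0 [t [Ht E]]]; (split; [lra|exists t; split; [lra|exact E]]).
Qed.

Lemma in_sector_open (S : sector) : C_open (in_sector S).
Proof.
intros z Hz. destruct (in_some_subsector S z Hz) as [S' [HS' Hz']].
destruct (sector_disc S' S HS') as [eta [He H]].
assert (Pz : 0 < Cmod z) by apply Hz.
exists (eta * Cmod z). split; [nra|].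
intros w Hw. replace w with (z + (w - z))%C by ring. apply H; [exact Hz'|lra].
Qed.

(** * Limits of derivatives at the vertex *)

Lemma gevrey_holo (s : R) (S : sector) (f : C -> C) : gevrey_function s S f -> holo (in_sector S) f.
Proof. intros [H _]. exact H. Qed.

Lemma mean_value_between (F F' : R -> C) (a b B : R) :
  (forall t, Rmin a b <= t <= Rmax a b -> rderiv F t (F' t)) ->
  (forall t, Rmin a b <= t <= Rmax a b -> Cmod (F' t) <= B) ->
  Cmod (F b - F a) <= B * Rabs (b - a).
Proof.
intros HF HB. destruct (Rle_dec a b) as [L|L].
- rewrite Rmin_left, Rmax_right in HF, HB by lra. rewrite Rabs_pos_eq by lra.
  replace (B * (b - a)) with (B * b - B * a) by ring.
  apply (mean_value_ineq F F' (fun t => B * t) (fun _ => B)); try assumption. intros; apply is_derive_lin.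
- rewrite Rmin_right, Rmax_left in HF, HB by lra. rewrite Rabs_left by lra.
  replace (F b - F a)%C with (- (F a - F b))%C by ring. rewrite Cmod_opp.
  replace (B * - (b - a)) with (B * a - B * b) by ring.
  apply (mean_value_ineq F F' (fun t => B * t) (fun _ => B)); try assumption; try lra. intros; apply
    is_derive_lin.
Qed.

(* Join two points of the sector by a circular arc followed by a radial segment. *)
Lemma sector_path_bound (S : sector) (F F' : C -> C) (B : R) :
  (forall z, in_sector S z -> cderiv F z (F' z)) ->
  (forall z, in_sector S z -> Cmod (F' z) <= B) ->
  forall z w, in_sector S z -> in_sector S w ->
    Cmod (F z - F w) <= 8 * B * (Cmod z + Cmod w).
Proof.
intros HF HB z w Hz Hw.
assert (PB : 0 <= B) by (eapply Rle_trans; [apply Cmod_ge_0|apply (HB z Hz)]).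
assert (Pz := Cmod_ge_0 z). assert (Pw := Cmod_ge_0 w).
apply in_sector_iff in Hz. destruct Hz as [x [t [Hx [Ht Ez]]]].
apply in_sector_iff in Hw. destruct Hw as [x' [t' [Hx' [Ht' Ew]]]].
assert (Bd := arg_bounds S).
assert (Between : forall a b c l u, l < a < u -> l < b < u -> Rmin a b <= c <= Rmax a b -> l < c < u).
{ intros a b c l u Ha Hb Hc. assert (T1 := Rmin_glb_lt a b l). assert (T2 := Rmax_lub_lt a b u). lra. }
assert (Arc : Cmod (F z - F (Cexp (x, t'))) <= 7 * B * Cmod z).
{ rewrite Ez.
  eapply Rle_trans; [apply (mean_value_between (fun y => F (Cexp (x, y))) (fun y => F' (Cexp (x, y)) * Cexp (x,
    y) * Ci)%C t' t (B * Cmod z))|].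
  - intros y Hy. apply (cderiv_vertical (fun w => F (Cexp w))).
    apply cderiv_comp; [|apply cderiv_Cexp]. apply HF, in_sector_Cexp; [exact Hx|].
    now apply (Between t' t).
  - intros y Hy. rewrite !Cmod_mult, Cmod_Ci, Rmult_1_r.
    replace (Cmod z) with (Cmod (Cexp (x, y))) by (rewrite Ez, !Cmod_Cexp; reflexivity).
    apply Rmult_le_compat_r; [apply Cmod_ge_0|]. apply HB, in_sector_Cexp; [exact Hx|].
    now apply (Between t' t).
  (* The angles differ by less than [2 PI <= 7]; the bound [PI <= 7 / 2] comes from a partial sum of
     Leibniz's series. With the radial segment this makes the constant [8]. *)
  - rewrite <- Ez. assert (Q : Rabs (t - t') <= 7).
    { assert (T := PI2_3_2). assert (T2 := PI_4). assert (T3 := PI_RGT_0). apply Rabs_le.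
      assert (PI <= 7 / 2); [|lra].
      assert (T4 := PI_ineq 2). unfold tg_alt, PI_tg in T4; simpl in T4. lra. }
    apply Rle_trans with (B * Cmod z * 7); [apply Rmult_le_compat_l; [nra|exact Q]|right; ring]. }
assert (Ray : Cmod (F (Cexp (x, t')) - F w) <= B * (Cmod z + Cmod w)).
{ set (e := Cexp (0, t')).
  assert (Ee : forall y, Cexp (y, t') = (0 + e * exp y)%C).
  { intros y. unfold e, Cexp, Cplus, Cmult, RtoC; simpl. rewrite exp_0. f_equal; ring. }
  assert (Me : Cmod e = 1) by (unfold e; rewrite Cmod_Cexp; simpl; apply exp_0).
  rewrite Ew, !Ee.
  assert (P1 := exp_pos x). assert (P2 := exp_pos x').
  eapply Rle_trans; [apply (mean_value_between (fun r : R => F (0 + e * r)%C) (fun r : R => F' (0 + e * r) *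
    e)%C (exp x') (exp x) B)|].
  - intros r Hr. destruct (Between (exp x') (exp x) r 0 (radius S)) as [Q1 Q2]; try lra.
    apply cderiv_rderiv. apply HF.
    rewrite <- (exp_ln r Q1), <- Ee. apply in_sector_Cexp; [now rewrite exp_ln|exact Ht'].
  - intros r Hr. destruct (Between (exp x') (exp x) r 0 (radius S)) as [Q1 Q2]; try lra.
    rewrite Cmod_mult, Me, Rmult_1_r. apply HB.
    rewrite <- (exp_ln r Q1), <- Ee. apply in_sector_Cexp; [now rewrite exp_ln|exact Ht'].
  - apply Rmult_le_compat_l; [exact PB|].
    assert (Mz : Cmod z = exp x) by (rewrite Ez; apply Cmod_Cexp).
    rewrite <- Ee, Cmod_Cexp, Mz. simpl. apply Rabs_le; lra. }
eapply Rle_trans; [apply (Cmod_sub_triangle _ (F (Cexp (x, t'))))|]. nra.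
Qed.

Lemma sector_scale (S : sector) (z : C) (t : R) : in_sector S z -> 0 < t <= 1 -> in_sector S (z * t)%C.
Proof.
intros [H0 [y [Hy E]]] Ht. unfold in_sector. rewrite Cmod_mult, Cmod_R, Rabs_pos_eq by lra.
split; [nra|]. exists y. split; [exact Hy|].
rewrite E at 1. unfold Cmult, RtoC; simpl. f_equal; ring.
Qed.

Lemma sector_nonempty (S : sector) : exists z, in_sector S z.
Proof.
assert (B := arg_bounds S). assert (P := radius_pos S).
exists (Cexp (ln (radius S / 2), (arg_inf S + arg_sup S) / 2)). apply in_sector_Cexp; [|lra].
rewrite exp_ln; lra.
Qed.

Lemma subsector_exists (S : sector) : exists S', subsector S' S.
Proof.
destruct (sector_nonempty S) as [z Hz]. destruct (in_some_subsector S z Hz) as [S' [H _]]. now exists S'.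
Qed.

(** Convergence at the vertex with a linear rate. The rate is available because the next derivative
    is bounded on subsectors, and it makes subtraction, rotation and restriction immediate. *)
Definition vertex_bound (S : sector) (F : C -> C) (a : C) : Prop :=
  forall S', subsector S' S -> exists K, forall z, in_sector S' z -> Cmod (F z - a) <= K * Cmod z.

Lemma gevrey_vertex_bound (s : R) (S : sector) (f : C -> C) (k : nat) :
  gevrey_function s S f -> exists a, vertex_bound S (C_derive_n f k) a.
Proof.
intros Hf. assert (Hh := gevrey_holo s S f Hf). destruct Hf as [_ Hg].
assert (Loc : forall S', subsector S' S -> exists a K, forall z, in_sector S' z -> Cmod (C_derive_n f k z -
  a)%C <= K * Cmod z).
{ intros S' HS'. destruct (Hg S' HS') as [M [A [PM [PA HB]]]].
  set (B := M * A ^ Datatypes.S k * Rpower (INR (fact (Datatypes.S k))) s).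
  destruct (sector_nonempty S') as [e He].
  destruct (cauchy_limit (in_sector S') (C_derive_n f k) e (8 * B)) as [a Ha].
  - intros t Ht. now apply sector_scale.
  - intros h w Hh' Hw. apply (sector_path_bound S' _ (C_derive_n f (Datatypes.S k))); try assumption.
    + intros z Hz. apply (cderiv_derive_n (in_sector S)); [apply in_sector_open|exact Hh|].
      now apply (subsector_incl S').
    + intros z Hz. now apply HB.
  - now exists a, (8 * B). }
destruct (subsector_exists S) as [S0 HS0].
destruct (Loc S0 HS0) as [a [K0 H0]]. exists a.
intros S' HS'.
destruct (subsector_join S S0 S' HS0 HS') as [S3 [HS3 [I1 I2]]].
destruct (Loc S3 HS3) as [a3 [K3 H3]].
(* Both limits are approached along the ray through a point [e] of [S0], which lies in both
   subsectors; hence the limit does not depend on the subsector. *)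
assert (E : a = a3).
{ destruct (sector_nonempty S0) as [e He].
  apply Ceq_minus. apply Cmod_eq_0. apply Rle_antisym; [|apply Cmod_ge_0].
  apply le_of_eps. intros eps Heps. rewrite Rplus_0_l.
  set (q := (Rabs K0 + Rabs K3) * Cmod e + 1).
  assert (Pe := Cmod_ge_0 e). assert (T0 := Rabs_pos K0). assert (T3 := Rabs_pos K3).
  assert (Pq : 1 <= q) by (unfold q; nra).
  set (t := Rmin 1 (eps / q)).
  assert (Pt : 0 < t <= 1) by (split; [apply Rmin_pos; [lra|apply Rdiv_lt_0_compat; lra]|apply Rmin_l]).
  assert (Lt : t <= eps / q) by apply Rmin_r.
  assert (Hz := sector_scale S0 e t He Pt).
  specialize (H0 _ Hz). specialize (H3 _ (I1 _ Hz)).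
  rewrite Cmod_mult, Cmod_R, Rabs_pos_eq in H0, H3 by lra.
  set (v := C_derive_n f k (e * t)) in *.
  assert (T := Cmod_sub_triangle a v a3).
  replace (a - v)%C with (- (v - a))%C in T by ring. rewrite Cmod_opp in T.
  assert (L0 := Rle_abs K0). assert (L3 := Rle_abs K3).
  assert (tq : t * q <= eps).
  { apply (Rmult_le_compat_r q) in Lt; [|lra]. replace (eps / q * q) with eps in Lt by (field; lra). exact Lt. }
  assert (0 <= Cmod e * t) by nra.
  assert ((Rabs K0 + Rabs K3) * Cmod e * t <= q * t) by (apply Rmult_le_compat_r; [lra|unfold q; lra]).
  nra. }
subst a3. exists K3. intros z Hz. apply H3, I2, Hz.
Qed.

(** The balls of [C_UniformSpace] are squares; halving a radius passes from them to discs. *)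
Lemma filterlim_sector (S : sector) (F : C -> C) (a : C) :
  filterlim F (within (in_sector S) (locally (T := C_UniformSpace) (RtoC 0)))
    (locally (T := C_UniformSpace) a) <->
  (forall eps, 0 < eps -> exists d, 0 < d /\
     forall z, in_sector S z -> Cmod z < d -> Cmod (F z - a) < eps).
Proof.
split.
- intros H eps He.
  assert (Pe : 0 < eps / 2) by lra.
  specialize (H (fun w => ball (M := C_UniformSpace) a (eps / 2) w) (locally_ball a (mkposreal _ Pe))).
  destruct H as [d Hd]. exists d. split; [apply cond_pos|].
  intros z Hz Hzd.
  assert (B : ball (M := C_UniformSpace) (RtoC 0) d z).
  { split; unfold ball; simpl; unfold AbsRing_ball, abs, minus, plus, opp; simpl.
    - eapply Rle_lt_trans; [|exact Hzd]. rewrite Ropp_0, Rplus_0_r. apply re_le_Cmod.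
    - eapply Rle_lt_trans; [|exact Hzd]. rewrite Ropp_0, Rplus_0_r. apply im_le_Cmod. }
  destruct (Hd z B Hz) as [B1 B2].
  unfold ball in B1, B2; simpl in B1, B2; unfold AbsRing_ball, abs, minus, plus, opp in B1, B2; simpl in B1, B2.
  eapply Rle_lt_trans; [apply Cmod_le_Rabs|]. unfold Re, Im; simpl. lra.
- intros H P [eps HP].
  destruct (H eps (cond_pos eps)) as [d [Pd Hd]].
  assert (Pd2 : 0 < d / 2) by lra.
  exists (mkposreal _ Pd2). intros z Bz Hz. apply HP.
  destruct Bz as [B1 B2].
  unfold ball in B1, B2; simpl in B1, B2; unfold AbsRing_ball, abs, minus, plus, opp in B1, B2; simpl in B1, B2.
  rewrite Ropp_0, Rplus_0_r in B1, B2.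
  assert (Q : Cmod z < d).
  { eapply Rle_lt_trans; [apply Cmod_le_Rabs|]. unfold Re, Im. lra. }
  specialize (Hd z Hz Q).
  split; unfold ball; simpl; unfold AbsRing_ball, abs, minus, plus, opp; simpl.
  + eapply Rle_lt_trans; [|exact Hd]. apply (re_le_Cmod (F z - a)%C).
  + eapply Rle_lt_trans; [|exact Hd]. apply (im_le_Cmod (F z - a)%C).
Qed.

(** [iota] returns [a] as soon as the limit is unique, and a single subsector, whose points come
    arbitrarily close to [0], already determines it. *)
Lemma derivative_at_vertex_eq (S : sector) (f : C -> C) (k : nat) (a : C) :
  vertex_bound S (C_derive_n f k) a -> derivative_at_vertex S f k = a.
Proof.
intros H.
set (P := fun a : C => forall S' : sector, subsector S' S ->
      filterlim (C_derive_n f k)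
        (within (in_sector S') (locally (T := C_UniformSpace) (RtoC 0)))
        (locally (T := C_UniformSpace) a)).
assert (Pa : P a).
{ intros S' HS'. destruct (H S' HS') as [K HK]. apply filterlim_sector. intros eps He.
  assert (T := Rabs_pos K). assert (L := Rle_abs K).
  exists (eps / (Rabs K + 1)). split; [apply Rdiv_lt_0_compat; lra|].
  intros z Hz Hd. eapply Rle_lt_trans; [now apply HK|].
  apply (Rmult_lt_compat_l (Rabs K + 1)) in Hd; [|lra].
  replace ((Rabs K + 1) * (eps / (Rabs K + 1))) with eps in Hd by (field; lra).
  assert (T2 := Cmod_ge_0 z). nra. }
assert (U : forall b, P b -> a = b).
{ intros b Pb. destruct (subsector_exists S) as [S' HS'].
  specialize (Pa S' HS'). specialize (Pb S' HS').
  rewrite filterlim_sector in Pa.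
  rewrite filterlim_sector in Pb.
  apply Ceq_minus. apply Cmod_eq_0. apply Rle_antisym; [|apply Cmod_ge_0].
  apply le_of_eps. intros eps He. rewrite Rplus_0_l.
  destruct (Pa (eps / 2)) as [d1 [Pd1 H1]]; [lra|].
  destruct (Pb (eps / 2)) as [d2 [Pd2 H2]]; [lra|].
  destruct (sector_nonempty S') as [e Hse].
  assert (Pe : 0 < Cmod e) by apply Hse.
  set (d := Rmin d1 d2). assert (Pd : 0 < d) by now apply Rmin_pos.
  assert (Ld1 : d <= d1) by apply Rmin_l. assert (Ld2 : d <= d2) by apply Rmin_r.
  set (t := Rmin 1 (d / (2 * Cmod e))).
  assert (Pt : 0 < t <= 1) by (split; [apply Rmin_pos; [lra|apply Rdiv_lt_0_compat; lra]|apply Rmin_l]).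
  assert (Lt : t <= d / (2 * Cmod e)) by apply Rmin_r.
  assert (Hz := sector_scale S' e t Hse Pt).
  assert (Mz : Cmod (e * t) < d).
  { rewrite Cmod_mult, Cmod_R, Rabs_pos_eq by lra.
    apply (Rmult_le_compat_l (Cmod e)) in Lt; [|lra].
    replace (Cmod e * (d / (2 * Cmod e))) with (d / 2) in Lt by (field; lra). lra. }
  specialize (H1 _ Hz ltac:(lra)). specialize (H2 _ Hz ltac:(lra)).
  set (v := C_derive_n f k (e * t)) in *.
  assert (T := Cmod_sub_triangle a v b).
  replace (a - v)%C with (- (v - a))%C in T by ring. rewrite Cmod_opp in T. lra. }
assert (EU : exists ! x : C, P x) by (exists a; split; [exact Pa|exact U]).
symmetry. apply U.
exact (iota_correct (V := C_CompleteNormedModule) P EU).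
Qed.

(** * The maximum principle *)

Definition rect (a b c d x y : R) : Prop := a <= x <= b /\ c <= y <= d.

Definition rect_cont (phi : R -> R -> R) (a b c d : R) : Prop :=
  forall x y, rect a b c d x y -> forall eps, 0 < eps -> exists del, 0 < del /\
    forall u v, rect a b c d u v -> Rabs (u - x) < del -> Rabs (v - y) < del ->
      Rabs (phi u v - phi x y) < eps.

(* The Lebesgue number [d] of a cover by balls of radius at most [1 / (2 + |phi|)] bounds [|phi|] at
   the centres by [1 / d]. *)
Lemma rect_bounded (phi : R -> R -> R) (a b c d : R) :
  rect_cont phi a b c d -> exists M, forall x y, rect a b c d x y -> phi x y <= M.
Proof.
intros Hc.
assert (Ex : forall x y, exists del : posreal, rect a b c d x y ->
  (del <= / (2 + Rabs (phi x y))) /\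
  forall u v, rect a b c d u v -> Rabs (u - x) < del -> Rabs (v - y) < del -> Rabs (phi u v - phi x y) < 1).
{ intros x y. destruct (excluded_middle_informative (rect a b c d x y)) as [H|H].
  - destruct (Hc x y H 1 Rlt_0_1) as [del [Pd Hd]].
    assert (T := Rabs_pos (phi x y)).
    assert (P : 0 < Rmin del (/ (2 + Rabs (phi x y)))).
    { apply Rmin_pos; [exact Pd|apply Rinv_0_lt_compat; lra]. }
    exists (mkposreal _ P). intros _. simpl. split; [apply Rmin_r|].
    intros u v Huv H1 H2. apply Hd; try assumption; eapply Rlt_le_trans; try eassumption; apply Rmin_l.
  - exists (mkposreal 1 Rlt_0_1). intros K; contradiction. }
set (delta := fun x y => proj1_sig (constructive_indefinite_description _ (Ex x y))).
assert (Hdelta : forall x y, rect a b c d x y -> (delta x y <= / (2 + Rabs (phi x y))) /\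
  forall u v, rect a b c d u v -> Rabs (u - x) < delta x y -> Rabs (v - y) < delta x y -> Rabs (phi u v - phi x
    y) < 1).
{ intros x y. exact (proj2_sig (constructive_indefinite_description _ (Ex x y))). }
destruct (compactness_value_2d a b c d delta) as [e He].
exists (/ e + 1). intros x y Hxy. apply Rnot_lt_le. intros L.
apply (He x y (proj1 Hxy) (proj2 Hxy)). intros [u [v [Hu [Hv [H1 [H2 H3]]]]]].
destruct (Hdelta u v (conj Hu Hv)) as [K1 K2].
specialize (K2 x y Hxy H1 H2). apply Rabs_def2 in K2.
assert (Pe := cond_pos e). assert (T2 := Rle_abs (phi u v)).
assert (Q : e <= / (2 + Rabs (phi u v))) by lra.
apply Rinv_le_contravar in Q; [|exact Pe]. rewrite Rinv_inv in Q. lra.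
Qed.

(** If the supremum [M] were not attained, [1 / (M - phi)] would be continuous, hence bounded, and
    [M] could be lowered. *)
Lemma rect_max (phi : R -> R -> R) (a b c d : R) :
  a <= b -> c <= d -> rect_cont phi a b c d ->
  exists x0 y0, rect a b c d x0 y0 /\ forall x y, rect a b c d x y -> phi x y <= phi x0 y0.
Proof.
intros Hab Hcd Hc.
destruct (rect_bounded phi a b c d Hc) as [M0 HM0].
destruct (completeness (fun v => exists x y, rect a b c d x y /\ v = phi x y)) as [M [HM1 HM2]].
- exists M0. intros v [x [y [H ->]]]. now apply HM0.
- exists (phi a c), a, c. now split.
- assert (UB : forall x y, rect a b c d x y -> phi x y <= M).
  { intros x y H. apply HM1. now exists x, y. }
  apply NNPP. intros N.
  assert (Str : forall x y, rect a b c d x y -> phi x y < M).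
  { intros x y H. destruct (UB x y H) as [L|L]; [exact L|]. exfalso; apply N.
    exists x, y. split; [exact H|]. intros u v Huv. rewrite L. now apply UB. }
  destruct (rect_bounded (fun x y => / (M - phi x y)) a b c d) as [K HK].
  { intros x y H eps He. assert (S := Str x y H).
    set (g := M - phi x y). assert (Pg : 0 < g) by (unfold g; lra).
    assert (Peg : 0 < Rmin (g / 2) (eps * (g * g) / 4)).
    { apply Rmin_pos; [lra|]. assert (0 < eps * (g * g)) by (apply Rmult_lt_0_compat; nra). lra. }
    destruct (Hc x y H _ Peg) as [del [Pd Hd]]. exists del; split; [exact Pd|].
    intros u v Huv H1 H2. specialize (Hd u v Huv H1 H2).
    assert (L1 := Rlt_le_trans _ _ _ Hd (Rmin_l _ _)). assert (L2 := Rlt_le_trans _ _ _ Hd (Rmin_r _ _)).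
    assert (S2 := Str u v Huv).
    cbv beta. replace (/ (M - phi u v) - / g) with ((phi u v - phi x y) * / ((M - phi u v) * g))
      by (unfold g; field; lra).
    apply Rabs_def2 in L1. assert (G2 : g / 2 <= M - phi u v) by (unfold g in *; lra).
    assert (PG : 0 < (M - phi u v) * g) by nra.
    rewrite Rabs_mult, (Rabs_pos_eq (/ _)) by (left; now apply Rinv_0_lt_compat).
    apply (Rmult_lt_reg_r ((M - phi u v) * g)); [exact PG|].
    rewrite Rmult_assoc, Rinv_l, Rmult_1_r by lra.
    eapply Rlt_le_trans; [exact L2|].
    assert (Q : eps * (g / 2 * g) <= eps * ((M - phi u v) * g)).
    { apply Rmult_le_compat_l; [lra|]. apply Rmult_le_compat_r; lra. }
    nra. }
  set (K' := Rmax K 1). assert (PK : 1 <= K') by apply Rmax_r. assert (LK : K <= K') by apply Rmax_l.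
  assert (B : M <= M - / K').
  { apply HM2. intros w [x [y [H ->]]]. specialize (HK x y H). specialize (Str x y H).
    assert (Q : / K' <= M - phi x y).
    { rewrite <- (Rinv_inv (M - phi x y)). apply Rinv_le_contravar; [apply Rinv_0_lt_compat|]; lra. }
    lra. }
  assert (0 < / K') by (apply Rinv_0_lt_compat; lra). lra.
Qed.

(** The first-order expansion of [C_derive f] at [p], integrated along the segment from [p] to
    [p + h]. *)
Lemma second_order (f : C -> C) (U : C -> Prop) (p : C) : C_open U -> holo U f -> U p ->
  exists l m, forall eta, 0 < eta -> exists del, 0 < del /\
    forall h, Cmod h < del -> Cmod (f (p + h) - f p - l * h - m / 2 * (h * h))%C <= eta * (Cmod h * Cmod h).
Proof.
intros HU Hf Hp.
set (l := C_derive f p). set (m := C_derive (C_derive f) p).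
exists l, m. intros eta He.
assert (D2 : cderiv (C_derive f) p m).
{ apply ex_derive_cderiv. now apply (holo_derive U f HU Hf). }
destruct (D2 eta He) as [d1 [Pd1 H1]].
destruct (HU p Hp) as [r [Pr Hr]].
exists (Rmin d1 r). split; [now apply Rmin_pos|].
intros h Hh.
assert (Hh1 := Rlt_le_trans _ _ _ Hh (Rmin_l _ _)). assert (Hh2 := Rlt_le_trans _ _ _ Hh (Rmin_r _ _)).
assert (Ph := Cmod_ge_0 h).
set (F := fun t : R => (f (p + h * t) - ((fun w => l * w + m / 2 * (w * w)) (0 + h * t)))%C).
assert (E : (f (p + h) - f p - l * h - m / 2 * (h * h) = F 1 - F 0)%C).
{ unfold F. replace (p + h * 1%R)%C with (p + h)%C by ring. replace (p + h * 0%R)%C with p by ring.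
  replace (0 + h * 1%R)%C with h by ring. replace (0 + h * 0%R)%C with (RtoC 0) by ring. ring. }
rewrite E.
replace (eta * (Cmod h * Cmod h)) with (eta * (Cmod h * Cmod h) * 1 - eta * (Cmod h * Cmod h) * 0) by ring.
assert (Sm : forall t, 0 <= t <= 1 -> Cmod (h * t) <= Cmod h).
{ intros t Ht. rewrite Cmod_mult, Cmod_R, Rabs_pos_eq by lra. nra. }
apply (mean_value_ineq F (fun t : R => C_derive f (p + h * t) * h - (l + m * (h * t)) * h)%C
  (fun t => eta * (Cmod h * Cmod h) * t) (fun _ => eta * (Cmod h * Cmod h))).
- lra.
- intros t Ht. specialize (Sm t Ht). apply rderiv_minus.
  + apply cderiv_rderiv. apply ex_derive_cderiv, Hf, Hr.
    replace (p + h * t - p)%C with (h * t)%C by ring. lra.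
  + apply (cderiv_rderiv (fun w => l * w + m / 2 * (w * w))%C).
    eapply cderiv_eq; [apply cderiv_plus; [apply cderiv_scal, cderiv_id|apply cderiv_scal, cderiv_mult; apply
      cderiv_id]|].
    cbv beta; field.
- intros t _; apply is_derive_lin.
- intros t Ht. specialize (Sm t Ht).
  replace (C_derive f (p + h * t) * h - (l + m * (h * t)) * h)%C
    with ((C_derive f (p + h * t) - l - m * (h * t)) * h)%C by ring.
  rewrite Cmod_mult, <- Rmult_assoc. apply Rmult_le_compat_r; [exact Ph|].
  eapply Rle_trans; [apply H1; lra|]. apply Rmult_le_compat_l; lra.
Qed.

Lemma cderiv_rect_cont (f : C -> C) (a b c d : R) :
  cdiff_rect f a b c d -> rect_cont (fun x y => Re (f (x, y))) a b c d.
Proof.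
intros H x y [Hx Hy] eps He. destruct (H x y Hx Hy) as [l Hl].
destruct (cderiv_cont f _ l Hl (eps / 2) ltac:(lra)) as [del [Pd Hd]].
exists (del / 2). split; [lra|]. intros u v _ H1 H2.
assert (Q : Cmod ((u, v) - (x, y))%C < del).
{ eapply Rle_lt_trans; [apply Cmod_le_Rabs|]. unfold Re, Im; simpl. unfold Rminus in H1, H2. lra. }
specialize (Hd _ Q).
assert (E1 : forall s t : C, (s + (t - s))%C = t) by (intros; ring). rewrite E1 in Hd.
replace (Re (f (u, v)) - Re (f (x, y))) with (Re (f (u, v) - f (x, y))%C) by reflexivity.
assert (T := re_le_Cmod (f (u, v) - f (x, y))%C). lra.
Qed.

Lemma rect_cont_plus (f g : R -> R -> R) (a b c d : R) :
  rect_cont f a b c d -> rect_cont g a b c d -> rect_cont (fun x y => f x y + g x y) a b c d.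
Proof.
intros Hf Hg x y H eps He.
destruct (Hf x y H (eps / 2) ltac:(lra)) as [d1 [P1 K1]].
destruct (Hg x y H (eps / 2) ltac:(lra)) as [d2 [P2 K2]].
exists (Rmin d1 d2). split; [now apply Rmin_pos|]. intros u v Huv H1 H2.
specialize (K1 u v Huv (Rlt_le_trans _ _ _ H1 (Rmin_l _ _)) (Rlt_le_trans _ _ _ H2 (Rmin_l _ _))).
specialize (K2 u v Huv (Rlt_le_trans _ _ _ H1 (Rmin_r _ _)) (Rlt_le_trans _ _ _ H2 (Rmin_r _ _))).
replace (f u v + g u v - (f x y + g x y)) with ((f u v - f x y) + (g u v - g x y)) by ring.
eapply Rle_lt_trans; [apply Rabs_triang|]. lra.
Qed.

(* At an interior maximum of [Re G + eps * x^2] the average over [p +- t], [p +- i t] is too large. *)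
Lemma max_principle_Re (G : C -> C) (U : C -> Prop) (a b c d B eps : R) :
  a <= b -> c <= d -> 0 < eps -> C_open U -> holo U G -> (forall x y, rect a b c d x y -> U (x, y)) ->
  (forall x y, rect a b c d x y -> x = a \/ x = b \/ y = c \/ y = d -> Re (G (x, y)) <= B) ->
  forall x y, rect a b c d x y -> Re (G (x, y)) <= B + eps * (a * a + b * b).
Proof.
intros Hab Hcd He HU HG HR HB x y Hxy.
set (phi := fun x y => Re (G (x, y)) + Re ((fun z => RtoC (eps * (Re z * Re z))) (x, y))).
assert (Hphi : rect_cont phi a b c d).
{ apply rect_cont_plus.
  - apply cderiv_rect_cont. intros u v Hu Hv. eexists. apply ex_derive_cderiv, HG, HR. now split.
  - intros u v Huv e' He'.
    destruct ((proj1 (is_derive_eps (fun x => eps * (x * x)) u (eps * (u + u)))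
      ltac:(auto_derive; [exact I|ring])) 1 Rlt_0_1) as [d1 [Pd1 H1]].
    set (K := 1 + Rabs (eps * (u + u))). assert (T := Rabs_pos (eps * (u + u))).
    exists (Rmin d1 (e' / K)). split; [apply Rmin_pos; [lra|apply Rdiv_lt_0_compat; unfold K; lra]|].
    intros u' v' _ Hu' _. simpl.
    specialize (H1 (u' - u) (Rlt_le_trans _ _ _ Hu' (Rmin_l _ _))).
    replace (u + (u' - u)) with u' in H1 by ring.
    assert (L := Rlt_le_trans _ _ _ Hu' (Rmin_r _ _)).
    replace (eps * (u' * u') - eps * (u * u))
      with ((eps * (u' * u') - eps * (u * u) - eps * (u + u) * (u' - u)) + eps * (u + u) * (u' - u)) by ring.
    eapply Rle_lt_trans; [apply Rabs_triang|]. rewrite (Rabs_mult (eps * (u + u))).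
    apply Rle_lt_trans with (K * Rabs (u' - u)); [unfold K; lra|].
    apply (Rmult_lt_compat_l K) in L; [|unfold K; lra].
    replace (K * (e' / K)) with e' in L by (field; unfold K; lra). exact L. }
destruct (rect_max phi a b c d Hab Hcd Hphi) as [x0 [y0 [H0 Hmax]]].
assert (X0 : x0 * x0 <= a * a + b * b).
{ destruct H0 as [H0 _]. destruct (Rle_dec 0 x0); nra. }
destruct (classic (x0 = a \/ x0 = b \/ y0 = c \/ y0 = d)) as [Bd|Int].
- specialize (HB x0 y0 H0 Bd). specialize (Hmax x y Hxy). unfold phi in Hmax; simpl in Hmax. unfold Re in *;
    simpl in *.
  assert (0 <= eps * (x * x)) by nra.
  assert (eps * (x0 * x0) <= eps * (a * a + b * b)) by (apply Rmult_le_compat_l; lra). lra.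
- exfalso. destruct H0 as [Hx0 Hy0].
  destruct (second_order G U (x0, y0) HU HG) as [l [m Hlm]].
  { apply HR. split; lra. }
  destruct (Hlm (eps / 4) ltac:(lra)) as [del [Pd Hd]].
  set (t := Rmin (Rmin (x0 - a) (b - x0)) (Rmin (Rmin (y0 - c) (d - y0)) (del / 2))).
  assert (Pt : 0 < t) by (repeat apply Rmin_pos; lra).
  assert (t1 : t <= x0 - a) by (eapply Rle_trans; [apply Rmin_l|apply Rmin_l]).
  assert (t2 : t <= b - x0) by (eapply Rle_trans; [apply Rmin_l|apply Rmin_r]).
  assert (t3 : t <= y0 - c) by (eapply Rle_trans; [apply Rmin_r|]; eapply Rle_trans; apply Rmin_l).
  assert (t4 : t <= d - y0) by (eapply Rle_trans; [apply Rmin_r|]; eapply Rle_trans; [apply Rmin_l|apply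
    Rmin_r]).
  assert (t5 : t <= del / 2) by (eapply Rle_trans; [apply Rmin_r|apply Rmin_r]).
  (* In the sum over [h = t, - t, i t, - i t] the linear terms cancel in pairs and the quadratic
     ones because [(i t)^2 = - t^2]. The term [eps x^2] gains [2 eps t^2], while the four errors
     cost [eps t^2]. *)
  assert (Four : forall h : C, Cmod h = t -> Re (G (x0, y0)) + Re (l * h)%C + Re (m / 2 * (h * h))%C - eps / 4
    * (t * t) <= Re (G ((x0, y0) + h)%C)).
  { intros h Mh. specialize (Hd h ltac:(lra)). rewrite Mh in Hd.
    assert (Q := re_le_Cmod (G ((x0, y0) + h) - G (x0, y0) - l * h - m / 2 * (h * h))%C).
    assert (Q' := Rle_trans _ _ _ Q Hd). clear Q. rename Q' into Q.
    apply Rabs_le_between in Q.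
    unfold Cminus in Q. rewrite !re_plus, !re_opp in Q. lra. }
  assert (F1 := Four (RtoC t) ltac:(rewrite Cmod_R, Rabs_pos_eq; lra)).
  assert (F2 := Four (- RtoC t)%C ltac:(rewrite Cmod_opp, Cmod_R, Rabs_pos_eq; lra)).
  assert (F3 := Four (Ci * RtoC t)%C ltac:(rewrite Cmod_mult, Cmod_Ci, Cmod_R, Rabs_pos_eq; lra)).
  assert (F4 := Four (- (Ci * RtoC t))%C ltac:(rewrite Cmod_opp, Cmod_mult, Cmod_Ci, Cmod_R, Rabs_pos_eq; lra)).
  replace ((x0, y0) + RtoC t)%C with (x0 + t, y0) in F1 by (unfold Cplus, RtoC; simpl; f_equal; ring).
  replace ((x0, y0) + - RtoC t)%C with (x0 - t, y0) in F2 by (unfold Cplus, Copp, RtoC; simpl; f_equal; ring).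
  replace ((x0, y0) + Ci * RtoC t)%C with (x0, y0 + t) in F3 by (unfold Cplus, Cmult, Ci, RtoC; simpl; f_equal;
    ring).
  replace ((x0, y0) + - (Ci * RtoC t))%C with (x0, y0 - t) in F4 by (unfold Cplus, Cmult, Copp, Ci, RtoC;
    simpl; f_equal; ring).
  assert (M1 := Hmax (x0 + t) y0 ltac:(split; lra)).
  assert (M2 := Hmax (x0 - t) y0 ltac:(split; lra)).
  assert (M3 := Hmax x0 (y0 + t) ltac:(split; lra)).
  assert (M4 := Hmax x0 (y0 - t) ltac:(split; lra)).
  unfold phi in M1, M2, M3, M4. 
  set (m2 := (m / 2)%C) in *.
  unfold Re, Cmult, Copp, Ci, RtoC in *; simpl in *.
  assert (0 < eps * (t * t)) by (apply Rmult_lt_0_compat; nra). nra.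
Qed.

(** Multiply [G] by the unimodular [u] that makes [u G (x, y)] real and positive, apply the version
    for real parts, and let its perturbation tend to [0]. *)
Lemma max_principle (G : C -> C) (U : C -> Prop) (a b c d B : R) :
  a <= b -> c <= d -> C_open U -> holo U G -> (forall x y, rect a b c d x y -> U (x, y)) ->
  (forall x y, rect a b c d x y -> x = a \/ x = b \/ y = c \/ y = d -> Cmod (G (x, y)) <= B) ->
  forall x y, rect a b c d x y -> Cmod (G (x, y)) <= B.
Proof.
intros Hab Hcd HU HG HR HB x y Hxy.
set (g := G (x, y)).
destruct (Req_dec (Cmod g) 0) as [Z|Z].
{ rewrite Z. eapply Rle_trans; [apply Cmod_ge_0|apply (HB a c)]; [unfold rect; lra|tauto]. }
assert (Pg : 0 < Cmod g) by (assert (T := Cmod_ge_0 g); lra).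
set (u := (Cconj g * RtoC (/ Cmod g))%C).
assert (Mu : Cmod u = 1).
{ unfold u. rewrite Cmod_mult, Cmod_conj, Cmod_R, Rabs_pos_eq by (left; now apply Rinv_0_lt_compat). field;
    lra. }
assert (Eu : Re (u * g)%C = Cmod g).
{ replace (u * g)%C with ((Cconj g * g) * RtoC (/ Cmod g))%C by (unfold u; ring).
  rewrite re_scal_r, Cconj_mult_self. field; lra. }
apply le_of_eps. intros eps He.
assert (PK : 0 < 1 + (a * a + b * b)) by nra.
rewrite <- Eu.
apply Rle_trans with (B + eps / (1 + (a * a + b * b)) * (a * a + b * b)).
- apply (max_principle_Re (fun z => u * G z)%C U a b c d); try assumption.
  + now apply Rdiv_lt_0_compat.
  + intros z Hz. exists (u * C_derive G z)%C. apply cderiv_is_derive, cderiv_scal, ex_derive_cderiv. now apply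
      HG.
  + intros x' y' H1 H2. eapply Rle_trans; [apply Rle_abs|]. eapply Rle_trans; [apply re_le_Cmod|].
    rewrite Cmod_mult, Mu, Rmult_1_l. now apply HB.
- apply Rplus_le_compat_l. apply (Rmult_le_reg_r (1 + (a * a + b * b))); [exact PK|].
  replace (eps / (1 + (a * a + b * b)) * (a * a + b * b) * (1 + (a * a + b * b))) with (eps * (a * a + b * b))
    by (field; lra).
  nra.
Qed.

(** * Watson's lemma *)

(** For [u = ln r] this half strip is a sector of radius [r] seen in the coordinate [log z];
    functions are pulled back by [Cexp], so no branch has to be chosen. *)
Definition strip (u a b : R) (w : C) : Prop := Re w < u /\ a < Im w < b.

Lemma strip_open (u a b : R) : C_open (strip u a b).
Proof.
intros z [H1 H2].
exists (Rmin (u - Re z) (Rmin (Im z - a) (b - Im z))). split; [repeat apply Rmin_pos; lra|].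
intros w Hw.
assert (T1 := re_le_Cmod (w - z)%C). assert (T2 := im_le_Cmod (w - z)%C).
assert (L1 := Rlt_le_trans _ _ _ Hw (Rmin_l _ _)).
assert (L0 := Rlt_le_trans _ _ _ Hw (Rmin_r _ _)).
assert (L2 := Rlt_le_trans _ _ _ L0 (Rmin_l _ _)). assert (L3 := Rlt_le_trans _ _ _ L0 (Rmin_r _ _)).
unfold Cminus in T1, T2. rewrite re_plus, re_opp in T1. rewrite im_plus, im_opp in T2.
unfold strip in *.
assert (S1 := Rabs_def2 (Re w + - Re z) _ (Rle_lt_trans _ _ _ T1 L1)).
assert (S2 := Rabs_def2 (Im w + - Im z) _ (Rle_lt_trans _ _ _ T2 L2)).
assert (S3 := Rabs_def2 (Im w + - Im z) _ (Rle_lt_trans _ _ _ T2 L3)).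
lra.
Qed.

Lemma strip_in_sector (S : sector) (w : C) :
  strip (ln (radius S)) (arg_inf S) (arg_sup S) w -> in_sector S (Cexp w).
Proof.
intros [H1 H2]. destruct w as [x y]. apply in_sector_Cexp; [|exact H2].
rewrite <- (exp_ln (radius S) (radius_pos S)). now apply exp_increasing.
Qed.

Lemma ln_exp_lt (x r : R) : 0 < r -> exp x < r -> x < ln r.
Proof. intros Hr H. rewrite <- (ln_exp x). apply ln_increasing; [apply exp_pos|exact H]. Qed.

Lemma holo_Cexp (S : sector) (h : C -> C) :
  holo (in_sector S) h -> holo (strip (ln (radius S)) (arg_inf S) (arg_sup S)) (fun w => h (Cexp w)).
Proof.
intros Hh w Hw. eexists. apply cderiv_is_derive. apply (cderiv_comp h Cexp); [|apply cderiv_Cexp].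
apply ex_derive_cderiv, Hh, strip_in_sector, Hw.
Qed.

(* Phragmen-Lindelof in the coordinate [log z]: [h] is multiplied by [exp (lambda w - eps w^(k'/kappa))] with
   [w = (z e^(- i phi))^(- kappa)], on a sector narrow enough that [lambda Re w <= c |w|] on its sides. *)
Lemma watson_ray (S : sector) (h : C -> C) (kappa c M phi : R) :
  0 < kappa -> 0 < c -> holo (in_sector S) h ->
  (forall x t, in_sector S (Cexp (x, t)) -> Cmod (h (Cexp (x, t))) <= M * exp (- c * exp (- kappa * x))) ->
  arg_inf S <= phi - PI / (2 * kappa) -> phi + PI / (2 * kappa) <= arg_sup S ->
  forall x, exp x < radius S -> h (Cexp (x, phi)) = 0.
Proof.
intros Hk Hc Hh HM Hphi1 Hphi2 x Hx.
assert (PI0 := PI_RGT_0).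
set (xr := ln (radius S)). assert (Hxr : x < xr) by (apply ln_exp_lt; [apply radius_pos|exact Hx]).
set (x0 := (x + xr) / 2). assert (Hx0 : x < x0 < xr) by (unfold x0; lra).
assert (PQ : 0 < PI / (2 * kappa)) by (apply Rdiv_lt_0_compat; lra).
assert (PM : 0 <= M).
{ assert (Q := HM x phi ltac:(apply in_sector_Cexp; [exact Hx|lra])).
  assert (T := Cmod_ge_0 (h (Cexp (x, phi)))). assert (E := exp_pos (- c * exp (- kappa * x))).
  apply Rnot_lt_le; intros N. nra. }
(* [x0] will be the right side of the rectangle. [D] is what the exponent gains at [x] over that
   side, per unit of [lambda]. *)
set (D := exp (- kappa * x) - exp (- kappa * x0)).
assert (PD : 0 < D).
{ unfold D. assert (exp (- kappa * x0) < exp (- kappa * x)); [apply exp_increasing; nra|lra]. }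
assert (Main : forall lambda, 0 < lambda -> Cmod (h (Cexp (x, phi))) <= M * exp (1 - lambda * D)).
{ intros lambda Hl.
  (* The half height [beta] falls short of [PI / (2 kappa)] by [theta / kappa], so that [lambda cos
     (kappa beta) = lambda sin theta <= c]: on the horizontal sides the decay of [h] outweighs the
     growth of the factor. *)
  set (theta := Rmin (c / lambda) (PI / 4)).
  assert (Pc : 0 < c / lambda) by now apply Rdiv_lt_0_compat.
  assert (Pth : 0 < theta) by (apply Rmin_pos; lra).
  assert (th1 : theta <= c / lambda) by apply Rmin_l. assert (th2 : theta <= PI / 4) by apply Rmin_r.
  set (beta := (PI / 2 - theta) / kappa).
  assert (kb : kappa * beta = PI / 2 - theta) by (unfold beta; field; lra).
  assert (Pb : 0 < beta) by (apply Rdiv_lt_0_compat; lra).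
  assert (beta < PI / (2 * kappa)).
  { apply (Rmult_lt_reg_l kappa); [exact Hk|]. rewrite kb. replace (kappa * (PI / (2 * kappa))) with (PI / 2)
      by (field; lra). lra. }
  (* An exponent above [kappa] for which [cos (k' y)] still stays above [sg > 0] on the whole
     rectangle; its exponential dominates far to the left. *)
  set (k' := (PI / 2 - theta / 2) / beta).
  assert (k'b : k' * beta = PI / 2 - theta / 2) by (unfold k'; field; lra).
  assert (Hk' : kappa < k') by (apply (Rmult_lt_reg_r beta); [exact Pb|lra]).
  set (sg := sin (theta / 2)).
  assert (Psg : 0 < sg) by (apply sin_gt_0; lra).
  assert (lcos : lambda * cos (kappa * beta) <= c).
  { rewrite kb. rewrite cos_shift.
    assert (sin theta <= theta) by (left; apply sin_lt_x; exact Pth).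
    apply Rle_trans with (lambda * (c / lambda)); [apply Rmult_le_compat_l; lra|right; field; lra]. }
  assert (cos' : forall y, - beta <= y <= beta -> sg <= cos (k' * y)).
  { intros y Hy. assert (Q : forall v, 0 <= v <= beta -> sg <= cos (k' * v)).
    { intros v Hv. unfold sg. rewrite <- (cos_shift (theta / 2)), <- k'b.
      apply cos_decr_1; nra. }
    destruct (Rle_dec 0 y) as [Ly|Ly]; [apply Q; lra|].
    rewrite <- cos_neg. replace (- (k' * y)) with (k' * - y) by ring. apply Q; lra. }
  (* Instead of tending to [0], [eps] is normalised by [eps exp (- k' x) = 1]: the damping factor
     costs only [exp 1] at the point itself, whatever [lambda] is. *)
  set (eps := exp (k' * x)). assert (Pe : 0 < eps) by apply exp_pos.
  (* Far enough to the left for the [k'] term to beat the [lambda] term on that side. *)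
  set (X := Rmin (x - 1) (- ln (lambda / (eps * sg)) / (k' - kappa))).
  assert (X1 : X <= x - 1) by apply Rmin_l.
  assert (X2 : lambda * exp (- kappa * X) - eps * (exp (- k' * X) * sg) <= 0).
  { assert (PL : 0 < lambda / (eps * sg)) by (apply Rdiv_lt_0_compat; nra).
    assert (Q : X * (k' - kappa) <= - ln (lambda / (eps * sg))).
    { apply Rle_trans with (- ln (lambda / (eps * sg)) / (k' - kappa) * (k' - kappa)).
      - apply Rmult_le_compat_r; [lra|apply Rmin_r].
      - right; field; lra. }
    replace (- k' * X) with (- kappa * X + - (X * (k' - kappa))) by ring. rewrite exp_plus.
    assert (Q2 : lambda / (eps * sg) <= exp (- (X * (k' - kappa)))).
    { rewrite <- (exp_ln _ PL) at 1.
      destruct Q as [Q|Q]; [left; apply exp_increasing; lra|right; f_equal; lra]. }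
    assert (PE := exp_pos (- kappa * X)).
    apply (Rmult_le_compat_l (eps * sg)) in Q2; [|nra].
    replace (eps * sg * (lambda / (eps * sg))) with lambda in Q2 by (field; split; lra).
    set (E2 := exp (- (X * (k' - kappa)))) in *. nra. }
  set (G := fun z : C => (h (Cexp (z + (0%R, phi))) * Cexp (lambda * Cexp (- kappa * z) - eps * Cexp (- k' *
    z)))%C).
  assert (MG : forall u v, Cmod (G (u, v)) = Cmod (h (Cexp (u, v + phi))) *
    exp (lambda * (exp (- kappa * u) * cos (kappa * v)) - eps * (exp (- k' * u) * cos (k' * v)))).
  { intros u v. unfold G. rewrite Cmod_mult, Cmod_Cexp. f_equal.
    - f_equal. f_equal. f_equal. unfold Cplus; simpl. f_equal; ring.
    - f_equal. unfold Cminus. rewrite re_plus, re_opp, !re_scal_l.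
      unfold Cexp, Re, Im; simpl.
      rewrite <- (cos_neg (kappa * v)), <- (cos_neg (k' * v)).
      replace (- kappa * u - -0 * v) with (- kappa * u) by ring.
      replace (- k' * u - -0 * v) with (- k' * u) by ring.
      replace (- kappa * v + -0 * u) with (- (kappa * v)) by ring.
      replace (- k' * v + -0 * u) with (- (k' * v)) by ring. ring. }
  assert (HB : Cmod (G (x, 0)) <= M * exp (lambda * exp (- kappa * x0))).
  { apply (max_principle G (strip xr (arg_inf S - phi) (arg_sup S - phi)) X x0 (- beta) beta); try lra.
    - apply strip_open.
    - intros z Hz. eexists. apply cderiv_is_derive. unfold G. apply cderiv_mult.
      + apply (cderiv_shift (fun w => h (Cexp w))). apply ex_derive_cderiv. apply (holo_Cexp S h Hh).
        destruct Hz as [Z1 Z2]. unfold strip. rewrite re_plus, im_plus. unfold Re, Im in *; simpl in *. fold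
          xr. lra.
      + apply (cderiv_comp Cexp (fun z => lambda * Cexp (- kappa * z) - eps * Cexp (- k' * z))%C); [apply
          cderiv_Cexp|].
        apply cderiv_minus; apply cderiv_scal.
        * apply (cderiv_comp Cexp (fun z => - kappa * z)%C); [apply cderiv_Cexp|apply cderiv_scal, cderiv_id].
        * apply (cderiv_comp Cexp (fun z => - k' * z)%C); [apply cderiv_Cexp|apply cderiv_scal, cderiv_id].
    - intros u v [Hu Hv]. unfold strip, Re, Im; simpl. lra.
    - intros u v [Hu Hv] Bd. rewrite MG.
      assert (Hs : in_sector S (Cexp (u, v + phi))).
      { apply (strip_in_sector S (u, v + phi)). unfold strip, Re, Im; simpl. fold xr. lra. }
      specialize (HM u (v + phi) Hs).
      assert (E1 := exp_pos (- kappa * u)). assert (E2 := exp_pos (- k' * u)).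
      specialize (cos' v Hv).
      assert (C1 := COS_bound (kappa * v)).
      eapply Rle_trans; [apply Rmult_le_compat_r; [left; apply exp_pos|exact HM]|].
      rewrite Rmult_assoc, <- exp_plus. apply Rmult_le_compat_l; [exact PM|].
      assert (P0 := exp_pos (- kappa * x0)).
      assert (PX : 0 <= eps * (exp (- k' * u) * cos (k' * v))).
      { apply Rmult_le_pos; [lra|]. apply Rmult_le_pos; lra. }
      assert (Goal : - c * exp (- kappa * u) + (lambda * (exp (- kappa * u) * cos (kappa * v)) - eps * (exp (-
        k' * u) * cos (k' * v)))
               <= lambda * exp (- kappa * x0)).
      { destruct Bd as [-> | [-> | [-> | ->]]].
        - assert (lambda * (exp (- kappa * X) * cos (kappa * v)) <= lambda * exp (- kappa * X)).
          { apply Rmult_le_compat_l; [lra|]. nra. }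
          assert (eps * (exp (- k' * X) * sg) <= eps * (exp (- k' * X) * cos (k' * v))).
          { apply Rmult_le_compat_l; [lra|]. apply Rmult_le_compat_l; lra. }
          nra.
        - assert (lambda * (exp (- kappa * x0) * cos (kappa * v)) <= lambda * exp (- kappa * x0)).
          { apply Rmult_le_compat_l; [lra|]. nra. }
          nra.
        - replace (kappa * - beta) with (- (kappa * beta)) in * by ring. rewrite cos_neg in *.
          nra.
        - assert (exp (- kappa * u) * (lambda * cos (kappa * beta)) <= exp (- kappa * u) * c) by (apply
            Rmult_le_compat_l; lra).
          nra. }
      destruct Goal as [Goal|Goal]; [left; now apply exp_increasing|rewrite Goal; right; reflexivity].
    - unfold rect; lra. }
  rewrite MG in HB. rewrite Rplus_0_l, !Rmult_0_r, cos_0, !Rmult_1_r in HB.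
  assert (Ee : eps * exp (- k' * x) = 1).
  { unfold eps. rewrite <- exp_plus. replace (k' * x + - k' * x) with 0 by ring. apply exp_0. }
  rewrite Ee in HB.
  set (E3 := exp (lambda * exp (- kappa * x) - 1)) in *. assert (P3 : 0 < E3) by apply exp_pos.
  apply (Rmult_le_reg_r E3); [exact P3|]. eapply Rle_trans; [exact HB|].
  rewrite Rmult_assoc. right. f_equal. unfold E3. rewrite <- exp_plus. f_equal. unfold D. ring. }
apply Cmod_eq_0. apply Rle_antisym; [|apply Cmod_ge_0].
apply le_of_eps. intros eps He. rewrite Rplus_0_l.
(* Then [M exp (1 - lambda D) = M exp (- M / eps) <= M / (1 + M / eps) <= eps]. *)
set (lambda := (1 + M / eps) / D).
assert (PMe : 0 <= M / eps) by (apply Rmult_le_pos; [exact PM|left; now apply Rinv_0_lt_compat]).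
eapply Rle_trans; [apply (Main lambda)|].
- apply Rdiv_lt_0_compat; lra.
- replace (1 - lambda * D) with (- (M / eps)) by (unfold lambda; field; lra).
  rewrite exp_Ropp. assert (T := exp_ineq1_le (M / eps)).
  apply (Rmult_le_reg_r (exp (M / eps))); [apply exp_pos|].
  rewrite Rmult_assoc, Rinv_l, Rmult_1_r by (apply Rgt_not_eq, exp_pos).
  apply Rle_trans with (eps * (1 + M / eps)); [|apply Rmult_le_compat_l; lra].
  replace (eps * (1 + M / eps)) with (eps + M) by (field; lra). lra.
Qed.

Definition zero_near (f : C -> C) (p : C) : Prop :=
  exists r, 0 < r /\ forall w, Cmod (w - p) < r -> f w = 0.

Lemma zero_near_derive_n (f : C -> C) (p : C) (k : nat) : zero_near f p -> C_derive_n f k p = 0.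
Proof.
intros [r [Hr H]].
apply (derive_n_chain (C_disc p r) f (fun _ _ => RtoC 0)).
- apply disc_open.
- intros z Hz. symmetry. now apply H.
- intros _ z _. apply cderiv_const.
- now apply disc_center.
Qed.

(** In the coordinate [log z] zeros propagate along the vertical segment from [t0] to [t] by steps
    of at most [rho / 16]. A point within [rho / 16] of the new centre is within [rho / 8] of the
    old one, the radius of [flat_point_zero]; all discs of radius [rho] about the segment stay in
    the strip. *)
Lemma identity_along_arcs (S : sector) (h : C -> C) (M t1 t2 : R) :
  holo (in_sector S) h -> (forall z, in_sector S z -> Cmod (h z) <= M) ->
  arg_inf S <= t1 -> t1 < t2 -> t2 <= arg_sup S ->
  (forall x t, exp x < radius S -> t1 < t < t2 -> h (Cexp (x, t)) = 0) ->
  forall z, in_sector S z -> h z = 0.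
Proof.
intros Hh HM H1 H12 H2 H0 z Hz.
apply in_sector_iff in Hz. destruct Hz as [x [t [Hx [Ht ->]]]].
set (xr := ln (radius S)). assert (Hxr : x < xr) by (apply ln_exp_lt; [apply radius_pos|exact Hx]).
set (U := strip xr (arg_inf S) (arg_sup S)).
set (H := fun w => h (Cexp w)).
assert (HH : holo U H) by now apply holo_Cexp.
assert (HHM : forall w, U w -> Cmod (H w) <= M) by (intros w Hw; now apply HM, strip_in_sector).
set (t0 := (t1 + t2) / 2).
assert (B1 := Rmin_l t t0). assert (B2 := Rmin_r t t0). assert (B3 := Rmax_l t t0). assert (B4 := Rmax_r t t0).
assert (B5 : arg_inf S < Rmin t t0) by (apply Rmin_glb_lt; unfold t0; lra).
assert (B6 : Rmax t t0 < arg_sup S) by (apply Rmax_lub_lt; unfold t0; lra).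
set (rho := Rmin (xr - x) (Rmin (Rmin t t0 - arg_inf S) (arg_sup S - Rmax t t0))).
assert (Pr : 0 < rho) by (repeat apply Rmin_pos; lra).
assert (r1 : rho <= xr - x) by apply Rmin_l.
assert (r2 : rho <= Rmin t t0 - arg_inf S) by (eapply Rle_trans; [apply Rmin_r|apply Rmin_l]).
assert (r3 : rho <= arg_sup S - Rmax t t0) by (eapply Rle_trans; [apply Rmin_r|apply Rmin_r]).
assert (InU : forall y, Rmin t t0 <= y <= Rmax t t0 -> forall w, Cmod (w - (x, y)) < rho -> U w).
{ intros y Hy w Hw.
  assert (T1 := re_le_Cmod (w - (x, y))%C). assert (T2 := im_le_Cmod (w - (x, y))%C).
  unfold Cminus in T1, T2. rewrite re_plus, re_opp in T1. rewrite im_plus, im_opp in T2.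
  assert (S1 := Rabs_def2 _ _ (Rle_lt_trans _ _ _ T1 Hw)).
  assert (S2 := Rabs_def2 _ _ (Rle_lt_trans _ _ _ T2 Hw)).
  unfold U, strip. unfold Re, Im in *; simpl in *. lra. }
assert (Step : forall n y, Rmin t t0 <= y <= Rmax t t0 -> Rabs (y - t0) <= INR n * (rho / 16) -> zero_near H
  (x, y)).
{ induction n as [|n IH]; intros y Hy Hn.
  - simpl in Hn. rewrite Rmult_0_l in Hn. assert (T := Rabs_pos (y - t0)).
    assert (E : y = t0). { apply Rminus_diag_uniq. destruct (Req_dec (y - t0) 0) as [Q|Q]; [exact Q|].
      apply Rabs_pos_lt in Q. lra. }
    exists (Rmin (xr - x) ((t2 - t1) / 2)). split; [apply Rmin_pos; lra|].
    intros w Hw. destruct w as [wx wy].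
    assert (T1 := re_le_Cmod ((wx, wy) - (x, y))%C). assert (T2 := im_le_Cmod ((wx, wy) - (x, y))%C).
    unfold Cminus in T1, T2. rewrite re_plus, re_opp in T1. rewrite im_plus, im_opp in T2.
    unfold Re, Im in T1, T2; simpl in T1, T2.
    assert (S1 := Rabs_def2 _ _ (Rle_lt_trans _ _ _ T1 (Rlt_le_trans _ _ _ Hw (Rmin_l _ _)))).
    assert (S2 := Rabs_def2 _ _ (Rle_lt_trans _ _ _ T2 (Rlt_le_trans _ _ _ Hw (Rmin_r _ _)))).
    apply H0.
    + rewrite <- (exp_ln (radius S) (radius_pos S)). apply exp_increasing. fold xr. lra.
    + unfold t0 in *. lra.
  - set (q := INR n / INR (Datatypes.S n)).
    assert (Pn := pos_INR n). assert (PS : 0 < INR (Datatypes.S n)) by (apply lt_0_INR; lia).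
    assert (Hq : 0 <= q /\ 1 - q = / INR (Datatypes.S n)).
    { unfold q. split; [apply Rmult_le_pos; [exact Pn|left; now apply Rinv_0_lt_compat]|].
      rewrite S_INR in *. field. lra. }
    assert (Pi : 0 < / INR (Datatypes.S n)) by now apply Rinv_0_lt_compat.
    (* The point at the fraction [n / (n + 1)] of the way from [t0] to [y]: within reach of the
       induction hypothesis and at distance at most [rho / 16] from [y]. *)
    set (y1 := t0 + (y - t0) * q).
    assert (Hy1 : Rmin t t0 <= y1 <= Rmax t t0).
    { unfold y1. destruct (Rle_dec t0 y); split; nra. }
    assert (Z1 : zero_near H (x, y1)).
    { apply IH; [exact Hy1|]. unfold y1. replace (t0 + (y - t0) * q - t0) with ((y - t0) * q) by ring.
      rewrite Rabs_mult, (Rabs_pos_eq q) by tauto.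
      apply Rle_trans with (INR (Datatypes.S n) * (rho / 16) * q); [apply Rmult_le_compat_r; tauto|].
      right. unfold q. field. lra. }
    exists (rho / 16). split; [lra|]. intros w Hw.
    apply (flat_point_zero H (x, y1) rho M Pr).
    + intros v Hv. now apply HH, (InU y1).
    + intros v Hv. now apply HHM, (InU y1).
    + intros k. now apply zero_near_derive_n.
    + assert (T := Cmod_sub_triangle w (x, y) (x, y1)).
      assert (Q : Cmod ((x, y) - (x, y1)) <= rho / 16).
      { eapply Rle_trans; [apply Cmod_le_Rabs|]. unfold Re, Im; simpl.
        replace (x + - x) with 0 by ring. rewrite Rabs_R0, Rplus_0_l.
        replace (y + - y1) with ((y - t0) * (1 - q)) by (unfold y1; ring).
        rewrite Rabs_mult. destruct Hq as [_ ->]. rewrite (Rabs_pos_eq (/ _)) by lra.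
        apply Rle_trans with (INR (Datatypes.S n) * (rho / 16) * / INR (Datatypes.S n)).
        - apply Rmult_le_compat_r; lra.
        - right; field; lra. }
      lra. }
destruct (nfloor_ex (Rabs (t - t0) / (rho / 16))) as [n [_ Hn]].
{ apply Rmult_le_pos; [apply Rabs_pos|left; apply Rinv_0_lt_compat; lra]. }
destruct (Step (n + 1)%nat t) as [r [Hr HZ]].
- split; assumption.
- rewrite plus_INR. simpl.
  apply (Rmult_lt_compat_r (rho / 16)) in Hn; [|lra].
  replace (Rabs (t - t0) / (rho / 16) * (rho / 16)) with (Rabs (t - t0)) in Hn by (field; lra). lra.
- apply HZ. replace ((x, t) - (x, t))%C with (RtoC 0) by (unfold Cminus, Cplus, Copp, RtoC; simpl; f_equal;
    ring).
  now rewrite Cmod_0.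
Qed.

(** * Flat functions of the Gevrey class and injectivity *)

Lemma fact_pos (n : nat) : 0 < INR (fact n).
Proof. apply lt_0_INR, lt_O_fact. Qed.

Lemma Rpower_pos (x y : R) : 0 < Rpower x y.
Proof. apply exp_pos. Qed.

Lemma Rpower_fact_split (n : nat) (s : R) :
  Rpower (INR (fact n)) s = Rpower (INR (fact n)) (s - 1) * INR (fact n).
Proof.
rewrite <- (Rpower_1 (INR (fact n))) at 3 by apply fact_pos.
rewrite <- Rpower_plus. f_equal; ring.
Qed.

Lemma derive_n_minus (U : C -> Prop) (f g : C -> C) (k : nat) (z : C) :
  C_open U -> holo U f -> holo U g -> U z ->
  C_derive_n (fun w => f w - g w)%C k z = (C_derive_n f k z - C_derive_n g k z)%C.
Proof.
intros HU Hf Hg.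
apply (derive_n_chain U (fun w => f w - g w)%C (fun k w => C_derive_n f k w - C_derive_n g k w)%C HU).
- reflexivity.
- intros j w Hw. apply cderiv_minus; now apply (cderiv_derive_n U).
Qed.

Lemma gevrey_minus (s : R) (S : sector) (f g : C -> C) :
  gevrey_function s S f -> gevrey_function s S g -> gevrey_function s S (fun z => f z - g z)%C.
Proof.
intros Hf Hg. assert (Hhf := gevrey_holo s S f Hf). assert (Hhg := gevrey_holo s S g Hg).
split.
- intros z Hz. eexists. apply cderiv_is_derive, cderiv_minus; apply ex_derive_cderiv; [now apply Hhf|now apply
    Hhg].
- intros S' HS'. destruct (proj2 Hf S' HS') as [M1 [A1 [PM1 [PA1 B1]]]].
  destruct (proj2 Hg S' HS') as [M2 [A2 [PM2 [PA2 B2]]]].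
  assert (LA1 := Rmax_l A1 A2). assert (LA2 := Rmax_r A1 A2).
  exists (M1 + M2), (Rmax A1 A2). split; [lra|]. split; [lra|].
  intros k z Hz. rewrite (derive_n_minus (in_sector S)); try assumption; [|apply in_sector_open|now apply
    (subsector_incl S')].
  unfold Cminus. eapply Rle_trans; [apply Cmod_triangle|]. rewrite Cmod_opp.
  specialize (B1 k z Hz). specialize (B2 k z Hz).
  assert (P := Rpower_pos (INR (fact k)) s).
  assert (I1 : A1 ^ k <= Rmax A1 A2 ^ k) by (apply pow_incr; lra).
  assert (I2 : A2 ^ k <= Rmax A1 A2 ^ k) by (apply pow_incr; lra).
  set (p := Rpower (INR (fact k)) s) in *. set (X := Rmax A1 A2 ^ k) in *.
  assert (M1 * A1 ^ k * p <= M1 * X * p) by (apply Rmult_le_compat_r; [lra|]; apply Rmult_le_compat_l; lra).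
  assert (M2 * A2 ^ k * p <= M2 * X * p) by (apply Rmult_le_compat_r; [lra|]; apply Rmult_le_compat_l; lra).
  lra.
Qed.

(** Taylor's estimate along the segment from the vertex to [z]; its denominator [n!] lowers the
    exponent from [s] to [s - 1]. *)
Lemma flat_gevrey_bound (s : R) (S S' : sector) (h : C -> C) :
  gevrey_function s S h -> (forall k, vertex_bound S (C_derive_n h k) 0) -> subsector S' S ->
  exists M A, 0 < M /\ 0 < A /\ forall n z, in_sector S' z ->
    Cmod (h z) <= M * (A * Cmod z) ^ n * Rpower (INR (fact n)) (s - 1).
Proof.
intros Hg Hv HS'. assert (Hh := gevrey_holo s S h Hg).
destruct (proj2 Hg S' HS') as [M [A [PM [PA HB]]]].
exists M, A. split; [exact PM|]. split; [exact PA|]. intros n z Hz.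
assert (Pz := Cmod_ge_0 z).
set (F := fun (k : nat) (t : R) => (z ^ k * C_derive_n h k (0 + z * t))%C).
assert (InS : forall t, 0 < t <= 1 -> in_sector S' (0 + z * t)%C).
{ intros t Ht. rewrite Cplus_0_l. now apply sector_scale. }
assert (Pf := fact_pos n).
replace (h z) with (F 0%nat 1) by (unfold F; simpl; rewrite Cmult_1_l, Cplus_0_l, Cmult_1_r; reflexivity).
replace (M * (A * Cmod z) ^ n * Rpower (INR (fact n)) (s - 1))
  with ((Cmod z ^ n * (M * A ^ n * Rpower (INR (fact n)) s)) / INR (fact n) * 1 ^ n)
  by (rewrite (Rpower_fact_split n s), Rpow_mult_distr, pow1; field; lra).
apply (taylor_flat n F); [| | |lra].
- intros k t Ht. unfold F.
  eapply rderiv_eq; [apply (cderiv_rderiv (fun w => z ^ k * C_derive_n h k w)%C); apply cderiv_scal|].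
  + apply (cderiv_derive_n (in_sector S)); [apply in_sector_open|exact Hh|]. apply (subsector_incl S' S _ HS').
      now apply InS.
  + rewrite Cpow_S. ring.
- intros k _ eps He. destruct (Hv k S' HS') as [K HK].
  set (Q := Cmod z ^ k * (Rabs K * Cmod z) + 1).
  assert (PQ : 1 <= Q).
  { unfold Q. assert (0 <= Cmod z ^ k * (Rabs K * Cmod z)); [|lra].
    apply Rmult_le_pos; [now apply pow_le|]. apply Rmult_le_pos; [apply Rabs_pos|exact Pz]. }
  exists (eps / Q). split; [apply Rdiv_lt_0_compat; lra|]. intros t Ht Ht1.
  unfold F. rewrite Cmod_mult, Cmod_pow.
  specialize (HK _ (InS t ltac:(lra))).
  replace (C_derive_n h k (0 + z * t) - 0)%C with (C_derive_n h k (0 + z * t)) in HK by ring.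
  apply Rle_trans with (Cmod z ^ k * (Rabs K * (Cmod z * t))).
  + apply Rmult_le_compat_l; [now apply pow_le|]. eapply Rle_trans; [exact HK|].
    rewrite Cplus_0_l, Cmod_mult, Cmod_R, Rabs_pos_eq by lra.
    apply Rmult_le_compat_r; [|apply Rle_abs]. apply Rmult_le_pos; lra.
  + destruct Ht as [Ht0 Ht]. apply (Rmult_lt_compat_r Q) in Ht; [|lra].
    replace (eps / Q * Q) with eps in Ht by (field; lra).
    unfold Q in Ht. lra.
- intros t Ht. unfold F. rewrite Cmod_mult, Cmod_pow.
  apply Rmult_le_compat_l; [now apply pow_le|]. now apply HB, InS.
Qed.

Lemma fact_le_pow (n : nat) : INR (fact n) <= INR n ^ n.
Proof.
induction n as [|n IH]; [simpl; lra|].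
rewrite fact_simpl, mult_INR. change (INR (S n) ^ S n) with (INR (S n) * INR (S n) ^ n). apply
  Rmult_le_compat_l; [apply pos_INR|].
eapply Rle_trans; [exact IH|]. apply pow_incr. split; [apply pos_INR|apply le_INR; lia].
Qed.

Lemma pow_exp_ln (x : R) (n : nat) : 0 < x -> x ^ n = exp (INR n * ln x).
Proof. intros Hx. rewrite <- Rpower_pow by exact Hx. reflexivity. Qed.

Lemma exp_le (x y : R) : x <= y -> exp x <= exp y.
Proof. intros [H|H]; [left; now apply exp_increasing|rewrite H; right; reflexivity]. Qed.

Lemma ln_le (x y : R) : 0 < x -> x <= y -> ln x <= ln y.
Proof. intros Hx [H|H]; [left; now apply ln_increasing|rewrite H; right; reflexivity]. Qed.

(* Optimal truncation: take for [n] the integer part of [(e A |z|)^(-1/a)]. *)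
Lemma flat_to_exp (M A a y x : R) :
  0 < M -> 0 < A -> 0 < a ->
  (forall n, y <= M * (A * exp x) ^ n * Rpower (INR (fact n)) a) ->
  y <= M * exp 1 * exp (- exp (- (1 + ln A) / a) * exp (- / a * x)).
Proof.
intros PM PA Pa H.
set (L := ln A + x).
set (Y := exp (- (1 + L) / a)).
assert (EY : exp (- (1 + ln A) / a) * exp (- / a * x) = Y).
{ rewrite <- exp_plus. unfold Y, L. f_equal. field. lra. }
replace (- exp (- (1 + ln A) / a) * exp (- / a * x)) with (- Y) by (rewrite <- EY; ring).
assert (PY : 0 < Y) by apply exp_pos.
destruct (nfloor_ex Y) as [n [Hn1 Hn2]]; [lra|].
specialize (H n).
rewrite Rmult_assoc, <- exp_plus.
eapply Rle_trans; [exact H|]. rewrite Rmult_assoc.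
apply Rmult_le_compat_l; [lra|].
destruct n as [|n].
(* For [n = 0] one has [Y < 1], and the factor [exp 1] compensates [exp (- Y)]. *)
- simpl. unfold Rpower. rewrite ln_1, Rmult_0_r, exp_0. simpl in Hn2.
  assert (T := exp_ineq1_le (1 + - Y)). lra.
- set (N := INR (S n)) in *. assert (PN : 0 < N) by (apply lt_0_INR; lia).
  assert (PX : 0 < A * exp x) by (apply Rmult_lt_0_compat; [exact PA|apply exp_pos]).
  rewrite pow_exp_ln by exact PX. unfold Rpower. rewrite <- exp_plus. fold N.
  rewrite ln_mult, ln_exp by (try exact PA; apply exp_pos). fold L.
  assert (B1 : ln (INR (fact (S n))) <= N * ln N).
  { replace (N * ln N) with (ln (N ^ S n)).
    - apply ln_le; [apply fact_pos|apply fact_le_pow].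
    - rewrite pow_exp_ln, ln_exp by exact PN. reflexivity. }
  (* From [N <= Y]. It brings the exponent [N L + a ln n!] below [- N], and [Y < N + 1] accounts for
     the factor [exp 1]. *)
  assert (B2 : ln N <= - (1 + L) / a).
  { replace (- (1 + L) / a) with (ln Y) by apply ln_exp. now apply ln_le. }
  assert (B3 : a * ln (INR (fact (S n))) <= N * (- (1 + L))).
  { apply Rle_trans with (a * (N * ln N)); [apply Rmult_le_compat_l; lra|].
    apply Rle_trans with (a * (N * (- (1 + L) / a))).
    - apply Rmult_le_compat_l; [lra|]. apply Rmult_le_compat_l; lra.
    - right; field; lra. }
  apply exp_le. lra.
Qed.

Lemma taylor_map_eq (S : sector) (f : C -> C) (k : nat) (a : C) :
  vertex_bound S (C_derive_n f k) a -> taylor_map S f k = (a / INR (fact k))%C.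
Proof. intros H. unfold taylor_map. now rewrite (derivative_at_vertex_eq S f k a). Qed.

Lemma INR_fact_nz (k : nat) : RtoC (INR (fact k)) <> RtoC 0.
Proof. intros Q. apply RtoC_inj in Q. assert (T := fact_pos k). lra. Qed.

Lemma gevrey_vertex_taylor (s : R) (S : sector) (f : C -> C) (k : nat) :
  gevrey_function s S f -> vertex_bound S (C_derive_n f k) (taylor_map S f k * INR (fact k))%C.
Proof.
intros Hf. destruct (gevrey_vertex_bound s S f k Hf) as [a Ha].
rewrite (taylor_map_eq S f k a Ha).
replace (a / INR (fact k) * INR (fact k))%C with a; [exact Ha|].
field. apply INR_fact_nz.
Qed.

(** Rays at angular distance at least [a PI / 2] from both sides of a subsector fall under
    [watson_ray] with [kappa = 1 / a]. They fill a nonempty open angle, from which the identity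
    theorem reaches every point. *)
Lemma injective_of_large_opening (s : R) (S : sector) :
  1 < s -> (s - 1) * PI < opening S -> taylor_injective s S.
Proof.
intros Hs Hop f g Hf Hg Heq z Hz.
unfold opening in Hop.
set (a := s - 1) in *. assert (Pa : 0 < a) by (unfold a; lra).
set (h := fun w => (f w - g w)%C).
assert (Hgh : gevrey_function s S h) by now apply gevrey_minus.
assert (Hv : forall k, vertex_bound S (C_derive_n h k) 0).
{ intros k S' HS'.
  destruct (gevrey_vertex_taylor s S f k Hf S' HS') as [K1 H1].
  destruct (gevrey_vertex_taylor s S g k Hg S' HS') as [K2 H2].
  exists (K1 + K2). intros w Hw.
  specialize (H1 w Hw). specialize (H2 w Hw). rewrite Heq in H1.
  unfold h. rewrite (derive_n_minus (in_sector S)); [|apply in_sector_open|apply (gevrey_holo s S f Hf)|apply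
    (gevrey_holo s S g Hg)|now apply (subsector_incl S')].
  set (v := (taylor_map S g k * INR (fact k))%C) in *.
  replace (C_derive_n f k w - C_derive_n g k w - 0)%C with ((C_derive_n f k w - v) + - (C_derive_n g k w -
    v))%C by ring.
  eapply Rle_trans; [apply Cmod_triangle|]. rewrite Cmod_opp. lra. }
destruct Hz as [Hzr [t [Ht Ez]]].
(* The subsector [T] must contain [z] and keep an opening above [a PI]; each side gives up at most a
   quarter of the excess. *)
set (gap := (arg_sup S - arg_inf S - a * PI) / 4).
assert (Pg : 0 < gap) by (unfold gap; lra).
assert (Bd := arg_bounds S).
set (i1 := Rmin (arg_inf S + gap) ((arg_inf S + t) / 2)).
set (s1 := Rmax (arg_sup S - gap) ((arg_sup S + t) / 2)).
assert (I1 : i1 <= arg_inf S + gap) by apply Rmin_l. assert (I2 : i1 <= (arg_inf S + t) / 2) by apply Rmin_r.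
assert (I3 : arg_inf S < i1) by (apply Rmin_glb_lt; lra).
assert (J1 : arg_sup S - gap <= s1) by apply Rmax_l. assert (J2 : (arg_sup S + t) / 2 <= s1) by apply Rmax_r.
assert (J3 : s1 < arg_sup S) by (apply Rmax_lub_lt; lra).
assert (Wide : a * PI < s1 - i1).
{ assert (4 * gap = arg_sup S - arg_inf S - a * PI) by (unfold gap; field). lra. }
destruct (make_sector ((Cmod z + radius S) / 2) i1 s1) as [T [T1 [T2 T3]]]; try lra.
assert (HT : subsector T S) by (unfold subsector; rewrite T1, T2, T3; lra).
assert (HzT : in_sector T z).
{ unfold in_sector. rewrite T1, T2, T3. split; [lra|]. exists t. split; [lra|exact Ez]. }
assert (HhT : holo (in_sector T) h).
{ intros w Hw. apply (gevrey_holo s S h Hgh). now apply (subsector_incl T). }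
destruct (flat_gevrey_bound s S T h Hgh Hv HT) as [M [A [PM [PA HB]]]].
destruct (proj2 Hgh T HT) as [M0 [A0 [PM0 [PA0 HB0]]]].
assert (Hzero : h z = 0).
{ apply (identity_along_arcs T h M0 (i1 + a * PI / 2) (s1 - a * PI / 2) HhT).
  - intros w Hw. specialize (HB0 0%nat w Hw). simpl in HB0.
    unfold Rpower in HB0. rewrite ln_1, Rmult_0_r, exp_0, !Rmult_1_r in HB0. exact HB0.
  - rewrite T2. nra.
  - lra.
  - rewrite T3. nra.
  - intros x phi Hx Hphi.
    assert (Eh : PI / (2 * / a) = a * PI / 2) by (field; lra).
    apply (watson_ray T h (/ a) (exp (- (1 + ln A) / a)) (M * exp 1) phi); try assumption.
    + now apply Rinv_0_lt_compat.
    + apply exp_pos.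
    + intros u v Huv. apply flat_to_exp; try assumption.
      intros n. specialize (HB n _ Huv). rewrite Cmod_Cexp in HB. exact HB.
    + rewrite Eh, T2. lra.
    + rewrite Eh, T3. lra.
  - exact HzT. }
unfold h in Hzero. now apply Ceq_minus.
Qed.

(** * Invariance under rotation *)

(** The inequalities are not strict, so that [theta = 0] expresses inclusion of sectors with common
    sides, which [subsector] excludes. *)
Definition rotates_into (S T : sector) (theta : R) : Prop :=
  radius S <= radius T /\ arg_inf T <= arg_inf S + theta /\ arg_sup S + theta <= arg_sup T.

Lemma rotate_in (S T : sector) (theta : R) (z : C) :
  rotates_into S T theta -> in_sector S z -> in_sector T (Cexp (0, theta) * z)%C.
Proof.
intros [Hr [Ha Hb]] Hz. apply in_sector_iff in Hz. destruct Hz as [x [t [Hx [Ht ->]]]].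
rewrite <- Cexp_plus.
replace ((0, theta) + (x, t))%C with (x, t + theta) by (unfold Cplus; simpl; f_equal; ring).
apply in_sector_Cexp; lra.
Qed.

Lemma rotate_subsector (S T S' : sector) (theta : R) :
  rotates_into S T theta -> subsector S' S ->
  exists T', subsector T' T /\ forall z, in_sector S' z -> in_sector T' (Cexp (0, theta) * z)%C.
Proof.
intros [Hr [Ha Hb]] [Hr' [Ha' Hb']].
assert (B := arg_bounds S'). assert (P := radius_pos S').
destruct (make_sector (radius S') (arg_inf S' + theta) (arg_sup S' + theta)) as [T' [T1 [T2 T3]]]; try lra.
exists T'. split; [unfold subsector; rewrite T1, T2, T3; lra|].
intros z. apply rotate_in. unfold rotates_into. rewrite T1, T2, T3. lra.
Qed.

Lemma rotate_derive_n (S T : sector) (theta : R) (f : C -> C) (k : nat) (z : C) :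
  rotates_into S T theta -> holo (in_sector T) f -> in_sector S z ->
  C_derive_n (fun w => f (Cexp (0, theta) * w)%C) k z =
  (Cexp (0, theta) ^ k * C_derive_n f k (Cexp (0, theta) * z))%C.
Proof.
intros HST Hf. set (om := Cexp (0, theta)).
apply (derive_n_chain (in_sector S) (fun w => f (om * w)%C) (fun k w => om ^ k * C_derive_n f k (om * w))%C).
- apply in_sector_open.
- intros w _. simpl. ring.
- intros j w Hw. eapply cderiv_eq.
  + apply cderiv_scal. apply (cderiv_comp (C_derive_n f j) (fun w => om * w)%C).
    * apply (cderiv_derive_n (in_sector T)); [apply in_sector_open|exact Hf|]. now apply (rotate_in S T).
    * apply cderiv_scal, cderiv_id.
  + rewrite Cpow_S. ring.
Qed.

Lemma Cmod_rotate (theta : R) (z : C) : Cmod (Cexp (0, theta) * z) = Cmod z.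
Proof. rewrite Cmod_mult, Cmod_Cexp. simpl. rewrite exp_0. ring. Qed.

Lemma Cmod_rotation_pow (theta : R) (k : nat) : Cmod (Cexp (0, theta) ^ k) = 1.
Proof. rewrite Cmod_pow, Cmod_Cexp. simpl. rewrite exp_0. apply pow1. Qed.

Lemma rotate_vertex_bound (S T : sector) (theta : R) (f : C -> C) (k : nat) (a : C) :
  rotates_into S T theta -> holo (in_sector T) f ->
  vertex_bound T (C_derive_n f k) a ->
  vertex_bound S (C_derive_n (fun w => f (Cexp (0, theta) * w)%C) k) (Cexp (0, theta) ^ k * a)%C.
Proof.
intros HST Hf Hv S' HS'. destruct (rotate_subsector S T S' theta HST HS') as [T' [HT' HI]].
destruct (Hv T' HT') as [K HK]. exists K. intros z Hz.
rewrite (rotate_derive_n S T); try assumption; [|now apply (subsector_incl S')].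
set (om := Cexp (0, theta)) in *.
replace (om ^ k * C_derive_n f k (om * z) - om ^ k * a)%C with (om ^ k * (C_derive_n f k (om * z) - a))%C by
  ring.
rewrite Cmod_mult. unfold om at 1. rewrite Cmod_rotation_pow, Rmult_1_l.
specialize (HK _ (HI z Hz)). unfold om in HK at 2. rewrite Cmod_rotate in HK. exact HK.
Qed.

Lemma rotate_gevrey (s : R) (S T : sector) (theta : R) (f : C -> C) :
  rotates_into S T theta -> gevrey_function s T f ->
  gevrey_function s S (fun w => f (Cexp (0, theta) * w)%C).
Proof.
intros HST Hf. assert (Hh := gevrey_holo s T f Hf). split.
- intros z Hz. eexists. apply cderiv_is_derive. apply (cderiv_comp f (fun w => Cexp (0, theta) * w)%C).
  + apply ex_derive_cderiv, Hh. now apply (rotate_in S T).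
  + apply cderiv_scal, cderiv_id.
- intros S' HS'. destruct (rotate_subsector S T S' theta HST HS') as [T' [HT' HI]].
  destruct (proj2 Hf T' HT') as [M [A [PM [PA HB]]]]. exists M, A. split; [exact PM|]. split; [exact PA|].
  intros k z Hz. rewrite (rotate_derive_n S T); try assumption; [|now apply (subsector_incl S')].
  rewrite Cmod_mult, Cmod_rotation_pow, Rmult_1_l. now apply HB, HI.
Qed.

(** With [z = e^w] this is [f^(j)(z) z^(j - k)]. For [j = 0] it is the integrand of the k-th
    coefficient in Cauchy's formula, with [dz / z] written as [dw]; for [j = k] only the k-th
    derivative remains. *)
Definition arc_integrand (f : C -> C) (k : nat) (j : nat) (w : C) : C :=
  (C_derive_n f j (Cexp w) * Cexp (- (INR (k - j) * w)))%C.

(** Integrated over an arc at whose ends the integrand takes the same value, this is the integration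
    by parts that raises [j] by one. *)
Lemma arc_integrand_cderiv (S : sector) (f : C -> C) (k j : nat) (w : C) :
  holo (in_sector S) f -> in_sector S (Cexp w) -> (j < k)%nat ->
  cderiv (arc_integrand f k j) w (arc_integrand f k (Datatypes.S j) w - INR (k - j) * arc_integrand f k j w)%C.
Proof.
intros Hf Hw Hjk. unfold arc_integrand. eapply cderiv_eq.
- apply cderiv_mult.
  + apply (cderiv_comp (C_derive_n f j) Cexp); [|apply cderiv_Cexp].
    apply (cderiv_derive_n (in_sector S)); [apply in_sector_open|exact Hf|exact Hw].
  + apply (cderiv_ext_loc (fun w => Cexp ((- INR (k - j)) * w))%C _ w _ 1 Rlt_0_1); [intros v _; f_equal;
      ring|].
    apply (cderiv_comp Cexp (fun w => (- INR (k - j)) * w)%C); [apply cderiv_Cexp|apply cderiv_scal, cderiv_id].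
- replace (k - j)%nat with (Datatypes.S (k - Datatypes.S j)) by lia.
  set (p := (k - Datatypes.S j)%nat). rewrite S_INR.
  assert (E : Cexp (- (INR p * w)) = (Cexp w * Cexp (- ((INR p + 1)%R * w)))%C).
  { rewrite <- Cexp_plus. f_equal. rewrite RtoC_plus. ring. }
  rewrite E. replace (- (INR p + 1)%R * w)%C with (- ((INR p + 1)%R * w))%C by ring. ring.
Qed.

(* Goursat's theorem makes the integral independent of [x]; [k] integrations by parts, whose boundary terms
   cancel by invariance, turn it into a mean of the k-th derivative, which converges as [x] tends to [-oo]. *)
Lemma arc_means (S : sector) (s theta t0 x : R) (f : C -> C) (k : nat) :
  gevrey_function s S f -> 0 < theta ->
  arg_inf S < t0 -> t0 + theta < arg_sup S -> exp x < radius S ->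
  (forall j u, exp u < radius S -> C_derive_n f j (Cexp (u, t0)) =
     (Cexp (0, theta) ^ j * C_derive_n f j (Cexp (0, theta) * Cexp (u, t0)))%C) ->
  (Cexp (0, theta) ^ k)%C = 1 ->
  (CInt (fun y => arc_integrand f k 0 (x, y)) t0 (t0 + theta) = theta * taylor_map S f k)%C.
Proof.
intros Hg Hth Ht0 Ht1 Hx Hrot Hk.
assert (Hh := gevrey_holo s S f Hg).
set (om := Cexp (0, theta)) in *.
set (xr := ln (radius S)). assert (Hxr : x < xr) by (apply ln_exp_lt; [apply radius_pos|exact Hx]).
set (t1 := t0 + theta) in *.
assert (InS : forall u y, u < xr -> t0 <= y <= t1 -> in_sector S (Cexp (u, y))).
{ intros u y Hu Hy. apply (strip_in_sector S (u, y)). unfold strip, Re, Im; simpl. fold xr. lra. }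
assert (Nom : om <> RtoC 0) by apply Cexp_nz.
(* From one end of the arc to the other the j-th derivative is multiplied by [om^(- j)] and the
   power of [z] by [om^(j - k)]; the product is [om^(- k) = 1]. *)
assert (Per : forall j u, (j <= k)%nat -> u < xr -> arc_integrand f k j (u, t1) = arc_integrand f k j (u, t0)).
{ intros j u Hj Hu. unfold arc_integrand.
  assert (E : ((u, t1) : C) = ((0, theta) + (u, t0))%C) by (unfold t1, Cplus; simpl; f_equal; ring).
  assert (E2 : Cexp (u, t1) = (om * Cexp (u, t0))%C) by (rewrite E, Cexp_plus; reflexivity).
  rewrite E2. rewrite (Hrot j u); [|rewrite <- (exp_ln (radius S) (radius_pos S)); now apply exp_increasing].
  rewrite !Cexp_opp, !Cexp_INR, E2, Cpow_mult_l.
  replace (om ^ j)%C with (/ om ^ (k - j))%C.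
  - field. split; apply Cpow_nz; [apply Cexp_nz|exact Nom].
  - replace (om ^ j)%C with (om ^ j * om ^ (k - j) * / om ^ (k - j))%C by (field; now apply Cpow_nz).
    rewrite <- Cpow_add_r. replace (j + (k - j))%nat with k by lia. rewrite Hk. ring. }
assert (HD : forall j, (j <= k)%nat -> forall u v, u < xr -> v < xr -> cdiff_rect (arc_integrand f k j) u v t0
  t1).
{ intros j Hj u v Hu Hv p q Hp Hq.
  destruct (Nat.eq_dec j k) as [->|Nj].
  - eexists. unfold arc_integrand. apply cderiv_mult.
    + apply (cderiv_comp (C_derive_n f k) Cexp); [|apply cderiv_Cexp].
      apply (cderiv_derive_n (in_sector S)); [apply in_sector_open|exact Hh|]. apply InS; lra.
    + apply (cderiv_ext_loc (fun w => Cexp ((- INR (k - k)) * w))%C _ _ _ 1 Rlt_0_1); [intros w _; f_equal;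
        ring|].
      apply (cderiv_comp Cexp (fun w => (- INR (k - k)) * w)%C); [apply cderiv_Cexp|apply cderiv_scal,
        cderiv_id].
  - eexists. apply (arc_integrand_cderiv S); [exact Hh| |lia]. apply InS; lra. }
assert (Cont : forall j u, (j <= k)%nat -> u < xr -> forall y, t0 <= y <= t1 -> rcont (fun y => arc_integrand f
  k j (u, y)) y).
{ intros j u Hj Hu. apply (cdiff_rect_vcont _ u u t0 t1); [now apply HD|lra]. }
assert (L01 : t0 <= t1) by (unfold t1; lra).
assert (Parts : forall j u, (j < k)%nat -> u < xr ->
  (INR (k - j) * CInt (fun y => arc_integrand f k j (u, y)) t0 t1 = CInt (fun y => arc_integrand f k
    (Datatypes.S j) (u, y)) t0 t1)%C).
{ intros j u Hj Hu.
  assert (F := CInt_FTC (fun y => arc_integrand f k j (u, y)) (fun y => Ci * (arc_integrand f k (Datatypes.S j)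
    (u, y) - INR (k - j) * arc_integrand f k j (u, y)))%C t0 t1 L01).
  assert (C1 := Cont j u ltac:(lia) Hu). assert (C2 := Cont (Datatypes.S j) u ltac:(lia) Hu).
  set (A := fun y => arc_integrand f k (Datatypes.S j) (u, y)) in *.
  set (B := fun y => arc_integrand f k j (u, y)) in *.
  set (c := RtoC (INR (k - j))) in *.
  assert (CB : forall y, t0 <= y <= t1 -> rcont (fun y => c * B y)%C y) by (intros y Hy; apply rcont_scal; now
    apply C1).
  assert (F0 : CInt (fun y => Ci * (A y - c * B y))%C t0 t1 = 0).
  { etransitivity; [apply F|].
    3:{ unfold B. rewrite (Per j u); [ring|lia|exact Hu]. }
    - intros y Hy. eapply rderiv_eq; [apply cderiv_vertical; apply (arc_integrand_cderiv S); [exact Hh|now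
        apply InS|exact Hj]|].
      unfold A, B, c. ring.
    - intros y Hy. apply rcont_scal, rcont_minus; [now apply C2|now apply CB]. }
  rewrite CInt_scal, CInt_minus, CInt_scal in F0; try assumption.
  2:{ intros y Hy. apply rcont_minus; [now apply C2|now apply CB]. }
  set (IA := CInt A t0 t1) in *. set (IB := CInt B t0 t1) in *.
  replace (c * IB)%C with (IA - / Ci * (Ci * (IA - c * IB)))%C by (field; apply Ci_nz).
  rewrite F0. ring. }
assert (Fact : forall u, u < xr -> forall i, (i <= k)%nat ->
  (CInt (fun y => arc_integrand f k k (u, y)) t0 t1 = INR (fact i) * CInt (fun y => arc_integrand f k (k - i)
    (u, y)) t0 t1)%C).
{ intros u Hu. induction i as [|i IH]; intros Hi.
  - rewrite Nat.sub_0_r. simpl. ring.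
  - rewrite IH by lia. assert (E := Parts (k - Datatypes.S i)%nat u ltac:(lia) Hu).
    replace (Datatypes.S (k - Datatypes.S i)) with (k - i)%nat in E by lia.
    rewrite <- E. replace (k - (k - Datatypes.S i))%nat with (Datatypes.S i) by lia.
    rewrite fact_simpl, mult_INR, RtoC_mult. ring. }
set (tk := taylor_map S f k).
set (I0 := CInt (fun y => arc_integrand f k 0 (x, y)) t0 t1) in *.
destruct (make_sector ((exp x + radius S) / 2) ((arg_inf S + t0) / 2) ((arg_sup S + t1) / 2)) as [S' [R1 [R2
  R3]]].
{ assert (T := exp_pos x). lra. } { lra. } { assert (B := arg_bounds S). lra. }
assert (HS' : subsector S' S) by (unfold subsector; rewrite R1, R2, R3; lra).
destruct (gevrey_vertex_taylor s S f k Hg S' HS') as [K HK]. fold tk in HK.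
(* [I0] does not depend on the radius, so it may be evaluated at radius [exp u], where the k-th
   derivative is within [K exp u] of its limit at the vertex. *)
assert (Ik : forall u, u < x -> Cmod (INR (fact k) * I0 - theta * (tk * INR (fact k)))%C <= Rabs K * exp u *
  theta).
{ intros u Hu.
  assert (E0 : I0 = CInt (fun y => arc_integrand f k 0 (u, y)) t0 t1).
  { symmetry. apply vertical_int_const; [exact Hu|unfold t1; lra|apply HD; [lia|lra|lra]|].
    intros v Hv. apply Per; [lia|lra]. }
  assert (E1 := Fact u ltac:(lra) k (le_n k)). rewrite Nat.sub_diag in E1. rewrite E0, <- E1.
  replace (theta * (tk * INR (fact k)))%C with (CInt (fun _ => tk * INR (fact k))%C t0 t1).
  2:{ rewrite CInt_const. unfold t1. replace (t0 + theta - t0) with theta by ring. ring. }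
  rewrite <- CInt_minus; [|exact L01|apply Cont; [lia|lra]|intros; apply rcont_const].
  replace (Rabs K * exp u * theta) with (Rabs K * exp u * (t1 - t0)) by (unfold t1; ring).
  apply CInt_bound; [exact L01| |].
  - intros y Hy. apply rcont_minus; [apply Cont; [lia|lra|exact Hy]|apply rcont_const].
  - intros y Hy. unfold arc_integrand. rewrite Nat.sub_diag.
    replace (Cexp (- (INR 0 * (u, y)))) with (RtoC 1).
    2:{ rewrite <- Cexp_0. f_equal. simpl. ring. }
    rewrite Cmult_1_r. eapply Rle_trans; [apply HK|].
    + apply in_sector_Cexp; [|rewrite R2, R3; lra]. rewrite R1.
      assert (exp u < exp x) by now apply exp_increasing. lra.
    + rewrite Cmod_Cexp. simpl. apply Rmult_le_compat_r; [left; apply exp_pos|apply Rle_abs]. }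
assert (Z : (INR (fact k) * I0 - theta * (tk * INR (fact k)))%C = 0).
{ apply Cmod_eq_0. apply Rle_antisym; [|apply Cmod_ge_0].
  apply le_of_eps. intros eps He. rewrite Rplus_0_l.
  assert (T := Rabs_pos K).
  assert (Pq : 0 < eps / ((Rabs K + 1) * theta)) by (apply Rdiv_lt_0_compat; [exact He|apply Rmult_lt_0_compat;
    lra]).
  set (u := Rmin (x - 1) (ln (eps / ((Rabs K + 1) * theta)))).
  assert (U1 : u <= x - 1) by apply Rmin_l.
  assert (U2 : exp u <= eps / ((Rabs K + 1) * theta)).
  { rewrite <- (exp_ln _ Pq). apply exp_le, Rmin_r. }
  eapply Rle_trans; [apply (Ik u); lra|].
  apply (Rmult_le_compat_r ((Rabs K + 1) * theta)) in U2; [|left; apply Rmult_lt_0_compat; lra].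
  replace (eps / ((Rabs K + 1) * theta) * ((Rabs K + 1) * theta)) with eps in U2 by (field; lra).
  assert (0 < exp u * theta) by (apply Rmult_lt_0_compat; [apply exp_pos|exact Hth]). nra. }
assert (Nf := INR_fact_nz k).
replace I0 with (theta * tk + / INR (fact k) * (INR (fact k) * I0 - theta * (tk * INR (fact k))))%C by (field;
  exact Nf).
rewrite Z. ring.
Qed.

Lemma rotates_0_subsector (S T S' : sector) : rotates_into S T 0 -> subsector S' S -> subsector S' T.
Proof. intros [H1 [H2 H3]] [K1 [K2 K3]]. unfold subsector. lra. Qed.

Lemma gevrey_restrict (s : R) (S T : sector) (f : C -> C) :
  rotates_into S T 0 -> gevrey_function s T f -> gevrey_function s S f.
Proof.
intros HST [Hh Hg]. split.
- intros z Hz. apply Hh. destruct (in_some_subsector S z Hz) as [S' [HS' Hz']].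
  apply (subsector_incl S'); [now apply (rotates_0_subsector S T)|exact Hz'].
- intros S' HS'. now apply Hg, (rotates_0_subsector S T).
Qed.

Lemma exp1_pow_fact (k : nat) : (INR k / exp 1) ^ k <= INR (fact k).
Proof.
assert (P := exp_pos 1). assert (Pk : 0 < exp 1 ^ k) by now apply pow_lt.
unfold Rdiv. rewrite Rpow_mult_distr, pow_inv.
apply (Rmult_le_reg_r (exp 1 ^ k)); [exact Pk|].
rewrite Rmult_assoc, Rinv_l, Rmult_1_r by lra. rewrite Rmult_comm. rewrite Rmult_comm.
assert (T := pow_self_le_fact k). lra.
Qed.

Lemma Rpower_pow_base (x a : R) (k : nat) : 0 < x -> Rpower (x ^ k) a = Rpower x a ^ k.
Proof.
intros Hx. rewrite pow_exp_ln by exact Hx. unfold Rpower. rewrite ln_exp.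
rewrite (pow_exp_ln (exp (a * ln x))), ln_exp by apply exp_pos. f_equal; ring.
Qed.

(** Since [k!^a >= (k / e)^(a k)], it exceeds [Q^k] once [(k / e)^a >= Q]. The factor [|M| + 2] in
    [Q] absorbs the constant [M], as [k >= 1]. *)
Lemma fact_power_not_geometric (a M L : R) (m : nat) :
  0 < a -> (0 < m)%nat -> ~ (forall n, Rpower (INR (fact (n * m))) a <= M * L ^ (n * m)).
Proof.
intros Ha Hm H.
set (Q := (Rabs L + 1) * (Rabs M + 2)).
assert (TL := Rabs_pos L). assert (TM := Rabs_pos M).
assert (PQ : 0 < Q) by (unfold Q; nra).
assert (P1 := exp_pos 1).
destruct (nfloor_ex (exp 1 * Rpower Q (/ a))) as [N [_ HN]].
{ apply Rmult_le_pos; [lra|left; apply Rpower_pos]. }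
specialize (H (N + 1)%nat). set (k := ((N + 1) * m)%nat) in *.
assert (Hk1 : (1 <= k)%nat) by (unfold k; nia).
assert (Hk : INR N + 1 <= INR k).
{ rewrite <- S_INR. apply le_INR. unfold k. nia. }
assert (Pk : 0 < INR k) by (apply lt_0_INR; lia).
assert (B0 : Rpower Q (/ a) <= INR k / exp 1).
{ apply (Rmult_le_reg_l (exp 1)); [exact P1|]. replace (exp 1 * (INR k / exp 1)) with (INR k) by (field; lra).
    lra. }
assert (B1 : Q <= Rpower (INR k / exp 1) a).
{ replace Q with (Rpower (Rpower Q (/ a)) a).
  - apply Rle_Rpower_l; [lra|]. split; [apply Rpower_pos|exact B0].
  - rewrite Rpower_mult, Rinv_l, Rpower_1 by lra. reflexivity. }
assert (B2 : Q ^ k <= Rpower (INR (fact k)) a).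
{ apply Rle_trans with (Rpower (INR k / exp 1) a ^ k); [apply pow_incr; lra|].
  rewrite <- Rpower_pow_base by now apply Rdiv_lt_0_compat.
  apply Rle_Rpower_l; [lra|]. split; [apply pow_lt; now apply Rdiv_lt_0_compat|apply exp1_pow_fact]. }
assert (B3 : (Rabs L + 1) ^ k * (Rabs M + 2) <= Q ^ k).
{ unfold Q. rewrite Rpow_mult_distr. apply Rmult_le_compat_l; [apply pow_le; lra|].
  rewrite <- (pow_1 (Rabs M + 2)) at 1. apply Rle_pow; [lra|exact Hk1]. }
assert (B4 : M * L ^ k <= Rabs M * (Rabs L + 1) ^ k).
{ eapply Rle_trans; [apply Rle_abs|]. rewrite Rabs_mult, <- RPow_abs.
  apply Rmult_le_compat_l; [lra|]. apply pow_incr; lra. }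
assert (0 < (Rabs L + 1) ^ k) by (apply pow_lt; lra). nra.
Qed.

(* The series only involves powers of [z^m], so by injectivity a preimage would be invariant under rotation
   by [2 PI / m], which forces convergence. *)
Lemma not_surjective_of_large_opening (s : R) (S : sector) :
  1 < s -> (s - 1) * PI < opening S -> ~ taylor_surjective s S.
Proof.
intros Hs Hop Hsurj. unfold opening in Hop. assert (PI0 := PI_RGT_0).
assert (Bd := arg_bounds S).
set (a := s - 1) in *. assert (Pa : 0 < a) by (unfold a; lra).
set (gap := arg_sup S - arg_inf S - a * PI). assert (Pg : 0 < gap) by (unfold gap; lra).
destruct (nfloor_ex (2 * PI / gap)) as [m0 [_ Hm0]].
{ apply Rmult_le_pos; [lra|left; now apply Rinv_0_lt_compat]. }
(* Large enough that the rotation angle [2 PI / m] is smaller than the excess of the opening over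
   [a PI]. *)
set (m := Datatypes.S m0). assert (Em : INR m = INR m0 + 1) by apply S_INR.
assert (Pm : 0 < INR m) by (rewrite Em; assert (T := pos_INR m0); lra).
set (theta := 2 * PI / INR m).
assert (Pth : 0 < theta) by (apply Rdiv_lt_0_compat; lra).
assert (Hth : theta < gap).
{ apply (Rmult_lt_reg_r (INR m)); [exact Pm|]. replace (theta * INR m) with (2 * PI) by (unfold theta; field;
    lra).
  apply (Rmult_lt_compat_r gap) in Hm0; [|exact Pg].
  replace (2 * PI / gap * gap) with (2 * PI) in Hm0 by (field; lra). rewrite Em. lra. }
set (om := Cexp (0, theta)).
assert (Hom : (om ^ m)%C = 1).
{ unfold om. rewrite <- Cexp_INR.
  replace (INR m * (0, theta))%C with ((0, 2 * PI) : C).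
  - rewrite Cexp_2PI_0. apply Cexp_0.
  - assert (Etm : 2 * PI = INR m * theta) by (unfold theta; field; lra).
    rewrite Etm. unfold Cmult, RtoC; cbn [fst snd]. f_equal; ring. }
assert (Homk : forall n, (om ^ (n * m))%C = 1).
{ intros n. rewrite Nat.mul_comm, Cpow_mult_r, Hom, Cpow_1_l. reflexivity. }
set (c := fun k => if Nat.eqb (k mod m) 0 then RtoC (Rpower (INR (fact k)) a) else RtoC 0).
destruct (Hsurj c) as [f [Hg Htay]].
{ exists 1, 1. split; [lra|]. split; [lra|]. intros k. rewrite pow1, !Rmult_1_l. fold a.
  assert (P := Rpower_pos (INR (fact k)) a). unfold c. destruct (Nat.eqb (k mod m) 0).
  - rewrite Cmod_R, Rabs_pos_eq; lra.
  - rewrite Cmod_0; lra. }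
assert (Hh := gevrey_holo s S f Hg).
(* On [S1] both [f] and its rotation are defined, and by the choice of [m] its opening still exceeds
   [a PI], so injectivity applies there. *)
destruct (make_sector (radius S) (arg_inf S) (arg_sup S - theta)) as [S1 [R1 [R2 R3]]].
{ apply radius_pos. } { unfold gap in Hth. nra. } { lra. }
assert (Hr0 : rotates_into S1 S 0) by (unfold rotates_into; rewrite R1, R2, R3; lra).
assert (Hrth : rotates_into S1 S theta) by (unfold rotates_into; rewrite R1, R2, R3; lra).
assert (Inv : forall z, in_sector S1 z -> f z = f (om * z)%C).
{ apply (injective_of_large_opening s S1 Hs).
  - unfold opening. rewrite R2, R3. unfold gap, a in *. lra.
  - now apply (gevrey_restrict s S1 S).
  - now apply (rotate_gevrey s S1 S).
  - intros k.
    rewrite (taylor_map_eq S1 f k (c k * INR (fact k))%C).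
    + rewrite (taylor_map_eq S1 _ k (om ^ k * (c k * INR (fact k)))%C).
      * unfold c. destruct (Nat.eqb_spec (k mod m) 0) as [E|_]; [|unfold Cdiv; ring].
        apply Nat.Lcm0.mod_divide in E.
        destruct E as [n ->]. rewrite Homk. unfold Cdiv. ring.
      * apply (rotate_vertex_bound S1 S); try assumption. rewrite <- Htay. now apply (gevrey_vertex_taylor s).
    + intros S' HS'. rewrite <- Htay. apply (gevrey_vertex_taylor s S f k Hg). now apply (rotates_0_subsector
        S1). }
set (t0 := arg_inf S + (arg_sup S - theta - arg_inf S) / 2).
assert (Hop2 : arg_inf S < arg_sup S - theta) by (unfold gap in Hth; nra).
assert (Ht0 : arg_inf S < t0 < arg_sup S - theta) by (unfold t0; lra).
set (x := ln (radius S / 2)). assert (PR := radius_pos S).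
assert (Ex : exp x = radius S / 2) by (apply exp_ln; lra).
destruct (make_sector (3 * radius S / 4) ((arg_inf S + t0) / 2) ((arg_sup S + (t0 + theta)) / 2)) as [S' [Q1
  [Q2 Q3]]]; try lra.
assert (HS' : subsector S' S) by (unfold subsector; rewrite Q1, Q2, Q3; lra).
destruct (proj2 Hg S' HS') as [M [A [PM [PA HB]]]].
(* On the arc of radius [exp x] the integral bounds the coefficients of index divisible by [m] by
   [M exp (- x)^k], as Cauchy's inequality on a circle would. *)
apply (fact_power_not_geometric a M (exp (- x)) m Pa); [unfold m; lia|].
intros n. set (k := (n * m)%nat).
assert (E := arc_means S s theta t0 x f k Hg Pth (proj1 Ht0) ltac:(lra) ltac:(lra)).
assert (Eq : CInt (fun y => arc_integrand f k 0 (x, y)) t0 (t0 + theta) = (theta * taylor_map S f k)%C).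
{ apply E.
  - intros j u Hu. assert (HuS1 : in_sector S1 (Cexp (u, t0))) by (apply in_sector_Cexp; rewrite ?R1, ?R2, ?R3;
      lra).
    fold om.
    apply (derive_n_chain (in_sector S1) f (fun j w => om ^ j * C_derive_n f j (om * w))%C).
    + apply in_sector_open.
    + intros z Hz. simpl. rewrite Cmult_1_l. symmetry. now apply Inv.
    + intros i w Hw. eapply cderiv_eq.
      * apply cderiv_scal. apply (cderiv_comp (C_derive_n f i) (fun w => om * w)%C).
        -- apply (cderiv_derive_n (in_sector S)); [apply in_sector_open|exact Hh|]. now apply (rotate_in S1 S).
        -- apply cderiv_scal, cderiv_id.
      * rewrite Cpow_S. ring.
    + exact HuS1.
  - apply Homk. }
rewrite Htay in Eq.
assert (Ck : c k = RtoC (Rpower (INR (fact k)) a)).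
{ unfold c. replace (k mod m)%nat with 0%nat by (unfold k; now rewrite Nat.Div0.mod_mul). reflexivity. }
rewrite Ck in Eq.
assert (InS' : forall y, t0 <= y <= t0 + theta -> in_sector S' (Cexp (x, y))).
{ intros y Hy. apply in_sector_Cexp; rewrite ?Q1, ?Q2, ?Q3; lra. }
assert (B : Cmod (theta * Rpower (INR (fact k)) a)%C <= M * exp (- x) ^ k * (t0 + theta - t0)).
{ rewrite <- Eq. apply CInt_bound; [lra| |].
  - apply (cdiff_rect_vcont _ x x t0 (t0 + theta)); [|lra].
    intros p q Hp Hq. replace p with x by lra. eexists. unfold arc_integrand. apply cderiv_mult.
    + apply (cderiv_comp (C_derive_n f 0) Cexp); [|apply cderiv_Cexp].
      apply (cderiv_derive_n (in_sector S)); [apply in_sector_open|exact Hh|].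
      apply (subsector_incl S' S _ HS'). now apply InS'.
    + apply (cderiv_ext_loc (fun w => Cexp ((- INR (k - 0)) * w))%C _ _ _ 1 Rlt_0_1); [intros w _; f_equal;
        ring|].
      apply (cderiv_comp Cexp (fun w => (- INR (k - 0)) * w)%C); [apply cderiv_Cexp|apply cderiv_scal,
        cderiv_id].
  - intros y Hy. unfold arc_integrand. rewrite Nat.sub_0_r, Cmod_mult, Cexp_opp, Cexp_INR, Cmod_inv, Cmod_pow,
      Cmod_Cexp
      by (apply Cpow_nz, Cexp_nz). simpl.
    specialize (HB 0%nat _ (InS' y Hy)). simpl in HB. unfold Rpower in HB.
    rewrite ln_1, Rmult_0_r, exp_0, !Rmult_1_r in HB.
    rewrite exp_Ropp, pow_inv. apply Rmult_le_compat_r; [|exact HB].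
    left. apply Rinv_0_lt_compat, pow_lt, exp_pos. }
rewrite Cmod_mult, !Cmod_R, Rabs_pos_eq, Rabs_pos_eq in B by (try lra; left; apply Rpower_pos).
apply (Rmult_le_reg_l theta); [exact Pth|]. lra.
Qed.

(** * Gevrey asymptotic expansions *)

Fixpoint csum (u : nat -> C) (N : nat) : C :=
  match N with
  | O => 0
  | S n => (csum u n + u n)%C
  end.

(** The falling factorial [n (n - 1) ... (n - k + 1)]. Truncated subtraction makes it vanish for
    [k > n], so the k-th derivative of [z^n] needs no case distinction. *)
Fixpoint falling (n k : nat) : nat :=
  match k with
  | O => 1
  | S k => falling n k * (n - k)
  end.

Lemma falling_small (n k : nat) : (n < k)%nat -> falling n k = 0%nat.
Proof.
induction k as [|k IH]; intros H; [lia|]. simpl.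
destruct (Nat.eq_dec n k) as [->|Hn]; [rewrite Nat.sub_diag; lia|]. rewrite IH; lia.
Qed.

Lemma falling_fact (n k : nat) : (k <= n)%nat -> (falling n k * fact (n - k) = fact n)%nat.
Proof.
induction k as [|k IH]; intros H; [rewrite Nat.sub_0_r; simpl; lia|].
rewrite <- IH by lia. simpl falling.
replace (n - k)%nat with (S (n - S k)) by lia. rewrite fact_simpl. ring.
Qed.

Lemma csum_cderiv (f : nat -> C -> C) (l : nat -> C) (z : C) (N : nat) :
  (forall n, (n < N)%nat -> cderiv (f n) z (l n)) ->
  cderiv (fun w => csum (fun n => f n w) N) z (csum l N).
Proof.
induction N as [|N IH]; intros H; simpl.
- apply cderiv_const.
- apply cderiv_plus; [apply IH; intros; apply H; lia|apply H; lia].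
Qed.

Lemma csum_ext (u v : nat -> C) (N : nat) : (forall n, (n < N)%nat -> u n = v n) -> csum u N = csum v N.
Proof.
induction N as [|N IH]; intros H; simpl; [reflexivity|].
rewrite IH, H by (intros; try apply H; lia). reflexivity.
Qed.

Lemma csum_zero (u : nat -> C) (N : nat) : (forall n, (n < N)%nat -> u n = 0) -> csum u N = 0.
Proof.
induction N as [|N IH]; intros H; simpl; [reflexivity|].
rewrite IH, H by (intros; try apply H; lia). ring.
Qed.

Definition partial_sum (c : nat -> C) (N : nat) (z : C) : C := csum (fun n => c n * z ^ n)%C N.

Lemma partial_sum_derive_n (c : nat -> C) (N k : nat) (z : C) (U : C -> Prop) : C_open U -> U z ->
  C_derive_n (partial_sum c N) k z = csum (fun n => c n * (INR (falling n k) * z ^ (n - k)))%C N.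
Proof.
intros HU.
apply (derive_n_chain U _ (fun k z => csum (fun n => c n * (INR (falling n k) * z ^ (n - k)))%C N) HU).
- intros w _. apply csum_ext. intros n _. simpl. rewrite Nat.sub_0_r. ring.
- intros j w _. apply (csum_cderiv (fun n w => c n * (INR (falling n j) * w ^ (n - j)))%C).
  intros n _. apply cderiv_scal. eapply cderiv_eq; [apply cderiv_scal, cderiv_pow|].
  simpl falling. rewrite mult_INR, RtoC_mult.
  replace (n - j - 1)%nat with (n - S j)%nat by lia. ring.
Qed.

Lemma partial_sum_holo (c : nat -> C) (N : nat) (U : C -> Prop) : holo U (partial_sum c N).
Proof.
intros z _. eexists. apply cderiv_is_derive. unfold partial_sum.
apply (csum_cderiv (fun n w => c n * w ^ n)%C (fun n => c n * (INR n * z ^ (n - 1)))%C).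
intros n _. apply cderiv_scal, cderiv_pow.
Qed.

(** A condition free of derivatives, hence one that a function given by a sum can be checked to
    satisfy; [gevrey_of_asymptotic] turns it into membership in the class together with the Taylor
    series. *)
Definition gevrey_asymptotic (a : R) (S : sector) (f : C -> C) (c : nat -> C) : Prop :=
  forall S', subsector S' S -> exists M A, 0 < M /\ 0 < A /\
    forall N z, in_sector S' z ->
      Cmod (f z - partial_sum c N z) <= M * A ^ N * Rpower (INR (fact N)) a * Cmod z ^ N.

(** Cauchy's inequalities on the disc of radius [eta |z|], on which [|w| <= 2 |z|]; this is the
    origin of the factor [2] in the ratio. *)
Lemma asymptotic_derivatives (a : R) (S S' : sector) (f : C -> C) (c : nat -> C) :
  holo (in_sector S) f -> gevrey_asymptotic a S f c -> subsector S' S ->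
  exists M A Q, 0 < M /\ 0 < A /\ 0 < Q /\ forall N k z, in_sector S' z ->
    Cmod (C_derive_n f k z - C_derive_n (partial_sum c N) k z) <=
    M * A ^ N * Rpower (INR (fact N)) a * Cmod z ^ N * (Q / Cmod z) ^ k * INR (fact k).
Proof.
intros Hf Has HS'.
destruct (subsector_interp S' S HS') as [T [HS'T HT]].
destruct (sector_disc S' T HS'T) as [eta [He Hdisc]].
destruct (Has T HT) as [M [A [PM [PA HB]]]].
assert (P1 := exp_pos 1).
exists M, (A * 2), (exp 1 / eta). split; [exact PM|]. split; [lra|]. split; [apply Rdiv_lt_0_compat; lra|].
intros N k z Hz.
assert (Pz : 0 < Cmod z) by apply Hz.
assert (HzS : in_sector S z) by now apply (subsector_incl S').
rewrite <- (derive_n_minus (in_sector S)); try assumption; [|apply in_sector_open|apply partial_sum_holo].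
assert (InT : forall w, Cmod (w - z) < eta * Cmod z -> in_sector T w).
{ intros w Hw. replace w with (z + (w - z))%C by ring. apply Hdisc; [exact Hz|lra]. }
replace (exp 1 / eta / Cmod z) with (exp 1 / (eta * Cmod z)) by (field; lra).
rewrite Rpow_mult_distr.
replace (M * (A ^ N * 2 ^ N) * Rpower (INR (fact N)) a * Cmod z ^ N)
  with (M * A ^ N * Rpower (INR (fact N)) a * (2 * Cmod z) ^ N) by (rewrite Rpow_mult_distr; ring).
apply cauchy_ineq_n.
- nra.
- intros w Hw. eexists. apply cderiv_is_derive, cderiv_minus; apply ex_derive_cderiv.
  + apply Hf. apply (subsector_incl T S _ HT). now apply InT.
  + now apply (partial_sum_holo c N (fun _ => True)).
- intros w Hw. eapply Rle_trans; [apply HB, InT, Hw|].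
  assert (Pr := Rpower_pos (INR (fact N)) a). assert (PAN : 0 < A ^ N) by now apply pow_lt.
  apply Rmult_le_compat_l; [left; apply Rmult_lt_0_compat; [nra|exact Pr]|].
  apply pow_incr. split; [apply Cmod_ge_0|].
  replace w with ((w - z) + z)%C by ring. eapply Rle_trans; [apply Cmod_triangle|]. nra.
Qed.

(** With [N = k] the k-th derivative of the partial sum is [0] and [|z|^N] cancels [|z|^(- k)],
    which bounds the k-th derivative of [f]. With [N = k + 1] that derivative is [k! c_k] and one
    factor [|z|] is left, which gives the limit at the vertex. *)
Lemma gevrey_of_asymptotic (s : R) (S : sector) (f : C -> C) (c : nat -> C) :
  holo (in_sector S) f -> gevrey_asymptotic (s - 1) S f c ->
  gevrey_function s S f /\ forall k, taylor_map S f k = c k.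
Proof.
intros Hf Has. split.
- split; [exact Hf|]. intros S' HS'.
  destruct (asymptotic_derivatives (s - 1) S S' f c Hf Has HS') as [M [A [Q [PM [PA [PQ HB]]]]]].
  exists M, (A * Q). split; [exact PM|]. split; [now apply Rmult_lt_0_compat|].
  intros k z Hz. specialize (HB k k z Hz).
  assert (Pz : 0 < Cmod z) by apply Hz.
  rewrite (partial_sum_derive_n c k k z (in_sector S)) in HB; [|apply in_sector_open|now apply (subsector_incl
    S')].
  rewrite csum_zero in HB.
  2:{ intros n Hn. rewrite falling_small by exact Hn. simpl. ring. }
  replace (C_derive_n f k z - 0)%C with (C_derive_n f k z) in HB by ring.
  eapply Rle_trans; [exact HB|]. right.
  rewrite (Rpower_fact_split k s). unfold Rdiv. rewrite !Rpow_mult_distr, pow_inv. field.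
  apply pow_nonzero; lra.
- intros k. rewrite (taylor_map_eq S f k (c k * INR (fact k))%C).
  + field. apply INR_fact_nz.
  + intros S' HS'.
    destruct (asymptotic_derivatives (s - 1) S S' f c Hf Has HS') as [M [A [Q [PM [PA [PQ HB]]]]]].
    exists (M * A ^ Datatypes.S k * Rpower (INR (fact (Datatypes.S k))) (s - 1) * Q ^ k * INR (fact k)).
    intros z Hz. specialize (HB (Datatypes.S k) k z Hz).
    assert (Pz : 0 < Cmod z) by apply Hz.
    rewrite (partial_sum_derive_n c (Datatypes.S k) k z (in_sector S)) in HB; [|apply in_sector_open|now apply
      (subsector_incl S')].
    cbn [csum] in HB. rewrite csum_zero in HB.
    2:{ intros n Hn. rewrite falling_small by exact Hn. simpl. ring. }
    assert (Fk := falling_fact k k (le_n k)). rewrite Nat.sub_diag, Nat.mul_1_r in Fk.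
    rewrite Fk, Nat.sub_diag in HB.
    replace (0 + c k * (INR (fact k) * z ^ 0))%C with (c k * INR (fact k))%C in HB by (simpl; ring).
    eapply Rle_trans; [exact HB|]. right.
    unfold Rdiv. rewrite !Rpow_mult_distr, pow_inv. simpl pow. field.
    apply pow_nonzero; lra.
Qed.

(** * Negative powers on a sector *)

Definition mid_arg (S : sector) : R := (arg_inf S + arg_sup S) / 2.

(* For [z = r e^(i tau)] with [|tau| < PI], [tau / 2 = atan (sin tau / (1 + cos tau))]. *)
Definition clog (S : sector) (z : C) : C :=
  let w := (z * Cexp (0, - mid_arg S)%R)%C in
  (ln (Cmod z), mid_arg S + 2 * atan (Im w / (Cmod w + Re w))).

Lemma clog_Cexp (S : sector) (x t : R) :
  arg_inf S < t < arg_sup S -> clog S (Cexp (x, t)) = (x, t).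
Proof.
intros Ht. unfold clog. rewrite <- Cexp_plus.
assert (B := arg_bounds S).
set (tau := t - mid_arg S).
assert (Htau : - PI < tau < PI) by (unfold tau, mid_arg; lra).
replace ((x, t) + (0, - mid_arg S)%R)%C with (x, tau) by (unfold Cplus, tau; simpl; f_equal; ring).
rewrite !Cmod_Cexp. simpl. rewrite ln_exp. f_equal.
unfold Cexp, Re, Im; simpl.
assert (Pc : 0 < cos (tau / 2)) by (apply cos_gt_0; lra).
replace (exp x * sin tau / (exp x + exp x * cos tau)) with (tan (tau / 2)).
- rewrite atan_tan by lra. unfold tau. lra.
- replace (sin tau) with (2 * sin (tau / 2) * cos (tau / 2)) by (rewrite <- sin_2a; f_equal; field).
  replace (cos tau) with (2 * cos (tau / 2) * cos (tau / 2) - 1) by (rewrite <- cos_2a_cos; f_equal; field).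
  unfold tan. field. assert (E := exp_pos x). split; [|lra].
  replace (exp x + exp x * (2 * cos (tau / 2) * cos (tau / 2) - 1)) with (2 * exp x * (cos (tau / 2) * cos (tau
    / 2))) by ring.
  apply Rgt_not_eq. apply Rmult_lt_0_compat; [lra|now apply Rmult_lt_0_compat].
Qed.

Lemma ln_1_plus_bound (v : R) : - (1 / 2) <= v <= 1 / 2 -> Rabs (ln (1 + v)) <= 2 * Rabs v.
Proof.
intros Hv.
assert (U : ln (1 + v) <= v).
{ rewrite <- (ln_exp v) at 2. apply ln_le; [lra|apply exp_ineq1_le]. }
assert (L : - (v / (1 + v)) >= - ln (1 + v)).
{ rewrite <- ln_Rinv by lra. apply Rle_ge. rewrite <- (ln_exp (- (v / (1 + v)))). apply ln_le; [apply
    Rinv_0_lt_compat; lra|].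
  eapply Rle_trans; [|apply exp_ineq1_le]. right. field. lra. }
assert (Q : v / (1 + v) >= - (2 * Rabs v)).
{ apply Rle_ge. apply (Rmult_le_reg_r (1 + v)); [lra|]. replace (v / (1 + v) * (1 + v)) with v by (field; lra).
  assert (T := Rabs_pos v). unfold Rabs in *. destruct (Rcase_abs v); nra. }
apply Rabs_le. assert (T := Rle_abs v). assert (T2 := Rabs_pos v). lra.
Qed.

Lemma local_log (u : C) : Cmod u <= 1 / 2 ->
  exists v, Cexp v = (1 + u)%C /\ Cmod v <= 4 * Cmod u.
Proof.
intros Hu.
assert (U1 := re_le_Cmod u). assert (U2 := im_le_Cmod u).
apply Rabs_le_between in U1.
set (p := 1 + Re u). set (q := Im u).
assert (Pp : 1 / 2 <= p) by (unfold p; lra).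
assert (Epq : (1 + u)%C = (p, q)).
{ unfold p, q. destruct u as [u1 u2]. unfold Cplus, RtoC, Re, Im; simpl. f_equal; ring. }
exists (ln (Cmod (p, q)), atan (q / p)). split.
- rewrite Epq. symmetry. apply polar_right_half. lra.
- eapply Rle_trans; [apply Cmod_le_Rabs|]. unfold Re, Im; simpl.
  assert (A : Rabs (atan (q / p)) <= 2 * Cmod u).
  { eapply Rle_trans; [apply Rabs_atan_le|]. unfold Rdiv. rewrite Rabs_mult.
    rewrite (Rabs_pos_eq (/ p)) by (left; apply Rinv_0_lt_compat; lra).
    apply (Rmult_le_reg_r p); [lra|]. rewrite Rmult_assoc, Rinv_l, Rmult_1_r by lra.
    unfold q. assert (T := Cmod_ge_0 u). nra. }
  assert (B : Rabs (Cmod (p, q) - 1) <= Cmod u).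
  { rewrite <- Epq. apply Rabs_le.
    assert (T1 := Cmod_triangle 1 u). rewrite Cmod_1 in T1.
    assert (T2 := Cmod_triangle (1 + u) (- u)). rewrite Cmod_opp in T2.
    replace (1 + u + - u)%C with (RtoC 1) in T2 by ring. rewrite Cmod_1 in T2. lra. }
  assert (Lb : Rabs (ln (Cmod (p, q))) <= 2 * Rabs (Cmod (p, q) - 1)).
  { replace (Cmod (p, q)) with (1 + (Cmod (p, q) - 1)) at 1 by ring. apply ln_1_plus_bound.
    apply Rabs_le_between in B. lra. }
  lra.
Qed.

(** [clog] inverts [Cexp] as long as the argument stays between the sides: its increment is then the
    small [v] with [Cexp v = 1 + h / z], and [Cexp_bound2] controls [v - h / z]. *)
Lemma cderiv_clog (S : sector) (z : C) : in_sector S z -> cderiv (clog S) z (/ z).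
Proof.
intros Hz. apply in_sector_iff in Hz. destruct Hz as [x [t [Hx [Ht ->]]]].
rewrite <- Cexp_opp.
set (z := Cexp (x, t)). assert (Nz : z <> RtoC 0) by apply Cexp_nz.
assert (Pz : 0 < Cmod z) by now apply Cmod_gt_0.
intros eps He.
set (g := Rmin (t - arg_inf S) (arg_sup S - t)). assert (Pg : 0 < g) by (apply Rmin_pos; lra).
assert (g1 : g <= t - arg_inf S) by apply Rmin_l. assert (g2 : g <= arg_sup S - t) by apply Rmin_r.
assert (P2 := exp_pos 2).
(* [1 / 2] is the range of [local_log]; [g / 8] keeps the change of argument, at most [4 |u|], below
   the distance to the sides; the last term absorbs [(4 |u|)^2 exp 2]. *)
set (e := Rmin (1 / 2) (Rmin (g / 8) (eps * Cmod z / (16 * exp 2)))).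
assert (Pe : 0 < e).
{ repeat apply Rmin_pos; try lra. apply Rdiv_lt_0_compat; [nra|lra]. }
assert (e1 : e <= 1 / 2) by apply Rmin_l.
assert (e2 : e <= g / 8) by (eapply Rle_trans; [apply Rmin_r|apply Rmin_l]).
assert (e3 : e <= eps * Cmod z / (16 * exp 2)) by (eapply Rle_trans; [apply Rmin_r|apply Rmin_r]).
exists (e * Cmod z). split; [nra|]. intros h Hh.
set (u := (h / z)%C).
assert (Eh : h = (z * u)%C) by (unfold u; field; exact Nz).
assert (Mu : Cmod u < e).
{ rewrite Eh, Cmod_mult in Hh. apply (Rmult_lt_reg_l (Cmod z)); [exact Pz|]. lra. }
destruct (local_log u) as [v [Ev Mv]]; [lra|].
assert (Ezh : (z + h)%C = Cexp (x + Re v, t + Im v)).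
{ replace (z + h)%C with (z * (1 + u))%C by (rewrite Eh; ring).
  rewrite <- Ev. unfold z. rewrite <- Cexp_plus. reflexivity. }
assert (Iv := im_le_Cmod v). apply Rabs_le_between in Iv.
rewrite Ezh, clog_Cexp by lra. unfold z at 1. rewrite clog_Cexp by exact Ht.
replace (((x + Re v)%R, (t + Im v)%R) - (x, t))%C with v.
2:{ destruct v as [v1 v2]. unfold Cminus, Cplus, Copp, Re, Im; simpl. f_equal; ring. }
rewrite Cexp_opp. fold z.
replace (v - / z * h)%C with (- (Cexp v - 1 - v))%C by (rewrite Ev, Eh; field; exact Nz).
rewrite Cmod_opp. eapply Rle_trans; [apply Cexp_bound2|].
assert (Ee : exp (Cmod v) <= exp 2) by (apply exp_le; lra).
apply Rle_trans with (4 * Cmod u * (4 * Cmod u) * exp 2).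
- apply Rmult_le_compat; [nra|left; apply exp_pos| |exact Ee]. apply Rmult_le_compat; lra.
- rewrite Eh, Cmod_mult.
  assert (Q : Cmod u * (16 * exp 2) <= eps * Cmod z).
  { assert (L : Cmod u <= eps * Cmod z / (16 * exp 2)) by lra.
    apply (Rmult_le_compat_r (16 * exp 2)) in L; [|lra].
    replace (eps * Cmod z / (16 * exp 2) * (16 * exp 2)) with (eps * Cmod z) in L by (field; lra). exact L. }
  nra.
Qed.

(* [W z = (z e^(-i d))^(-1/a)], where [d] bisects the sector; it maps the sector into the right half plane. *)
Lemma negative_power_exists (a : R) (S : sector) :
  0 < a -> opening S <= a * PI ->
  exists W : C -> C, holo (in_sector S) W /\
    (forall z, in_sector S z -> Cmod (W z) = exp (- / a * ln (Cmod z))) /\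
    forall S', subsector S' S -> exists c, 0 < c <= 1 /\
      forall z, in_sector S' z -> c * Cmod (W z) <= Re (W z).
Proof.
intros Ha Hop. unfold opening in Hop.
set (k := / a). assert (Pk : 0 < k) by now apply Rinv_0_lt_compat.
assert (Eka : k * a = 1) by (unfold k; field; lra).
set (d := mid_arg S).
set (W := fun z => Cexp (- k * (clog S z - (0, d)%R))%C).
assert (EW : forall x t, arg_inf S < t < arg_sup S -> W (Cexp (x, t)) = Cexp (- k * x, - (k * (t - d)))%R).
{ intros x t Ht. unfold W. rewrite clog_Cexp by exact Ht. f_equal.
  unfold Cmult, Cminus, Cplus, Copp, RtoC; simpl. f_equal; ring. }
exists W. split; [|split].
- intros z Hz. eexists. apply cderiv_is_derive. unfold W.
  apply (cderiv_comp Cexp (fun z => - k * (clog S z - (0, d)%R))%C); [apply cderiv_Cexp|].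
  apply cderiv_scal, cderiv_minus; [now apply cderiv_clog|apply cderiv_const].
- intros z Hz. apply in_sector_iff in Hz. destruct Hz as [x [t [Hx [Ht ->]]]].
  rewrite EW, !Cmod_Cexp by exact Ht. simpl. now rewrite ln_exp.
- intros S' [Hr [Hinf Hsup]].
  (* The largest deviation from the bisector on [S']. It is smaller than half the opening of [S], so
     [k H' < PI / 2] and the cosine below is positive. *)
  set (H' := Rmax (arg_sup S' - d) (d - arg_inf S')).
  assert (H1 : arg_sup S' - d <= H') by apply Rmax_l. assert (H2 : d - arg_inf S' <= H') by apply Rmax_r.
  assert (B' := arg_bounds S').
  assert (H3 : k * H' < PI / 2).
  { apply (Rmult_lt_reg_r a); [exact Ha|]. replace (k * H' * a) with (H' * (k * a)) by ring. rewrite Eka,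
      Rmult_1_r.
    assert (H' < (arg_sup S - arg_inf S) / 2); [|lra].
    apply Rmax_lub_lt; unfold d, mid_arg; lra. }
  assert (PH : 0 < H') by lra.
  assert (PkH : 0 < k * H') by now apply Rmult_lt_0_compat.
  exists (cos (k * H')). split.
  + split; [apply cos_gt_0; lra|apply COS_bound].
  + intros z Hz. apply in_sector_iff in Hz. destruct Hz as [x [t [Hx [Ht ->]]]].
    rewrite EW by lra. rewrite Cmod_Cexp. unfold Cexp, Re, Im; simpl. rewrite Rmult_comm.
    apply Rmult_le_compat_l; [left; apply exp_pos|]. rewrite cos_neg.
    assert (Q : forall v, 0 <= v <= H' -> cos (k * H') <= cos (k * v)).
    { intros v Hv. apply cos_decr_1; try nra. }
    destruct (Rle_dec 0 (t - d)) as [L|L]; [apply Q; lra|].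
    rewrite <- (cos_neg (k * (t - d))). replace (- (k * (t - d))) with (k * - (t - d)) by ring. apply Q; lra.
Qed.

Lemma pow_le_fact_exp (n : nat) : forall u, 0 <= u -> u ^ n <= INR (fact n) * exp u.
Proof.
induction n as [|n IH]; intros u Hu.
- simpl. assert (T := exp_ineq1_le u). lra.
- destruct (MVT_gen (fun v => INR (fact (S n)) * exp v - v ^ S n) 0 u
    (fun v => INR (fact (S n)) * exp v - INR (S n) * v ^ n)) as [c [Hc E]].
  + intros v _. auto_derive; [exact I|].
    change (fact n + n * fact n)%nat with (fact (S n)).
    change (match n with 0%nat => 1 | S _ => INR n + 1 end) with (INR (S n)). simpl Init.Nat.pred. ring.
  + intros v _. apply continuity_pt_filterlim, (ex_derive_continuous (fun v => INR (fact (S n)) * exp v - v ^ S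
      n)).
    auto_derive. exact I.
  + rewrite Rmin_left, Rmax_right in Hc by lra.
    specialize (IH c ltac:(lra)).
    assert (PS : 0 < INR (S n)) by (apply lt_0_INR; lia).
    assert (D : 0 <= INR (fact (S n)) * exp c - INR (S n) * c ^ n).
    { rewrite fact_simpl, mult_INR, Rmult_assoc.
      assert (INR (S n) * c ^ n <= INR (S n) * (INR (fact n) * exp c)) by (apply Rmult_le_compat_l; lra). lra. }
    rewrite exp_0 in E. replace (0 ^ S n) with 0 in E by (simpl; ring).
    assert (Pf := fact_pos (S n)).
    assert (0 <= (INR (fact (S n)) * exp c - INR (S n) * c ^ n) * (u - 0)) by (apply Rmult_le_pos; lra). lra.
Qed.

Lemma Rpower_nat_mult (x q : R) (n : nat) : Rpower x (q * INR n) = Rpower x q ^ n.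
Proof.
rewrite <- Rpower_mult. rewrite Rpower_pow; [reflexivity|apply Rpower_pos].
Qed.

(** With [y = r^(-1/a)], raise [u^n <= n! e^u] at [u = c y / a] to the power [a]: then
    [e^(a u) = e^(c y)], and [u^(a n)] is [r^(- n)] up to a geometric factor. *)
Lemma exp_flat (a c r : R) (n : nat) : 0 < a -> 0 < c -> 0 < r ->
  exp (- (c * exp (- / a * ln r))) <= Rpower (a / c) a ^ n * Rpower (INR (fact n)) a * r ^ n.
Proof.
intros Ha Hc Hr. set (y := exp (- / a * ln r)). assert (Py : 0 < y) by apply exp_pos.
assert (Er : r = Rpower y (- a)).
{ unfold Rpower, y. rewrite ln_exp. replace (- a * (- / a * ln r)) with (ln r) by (field; lra). now rewrite
    exp_ln. }
assert (Pu : 0 < c / a * y) by (apply Rmult_lt_0_compat; [now apply Rdiv_lt_0_compat|exact Py]).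
assert (Q := pow_le_fact_exp n (c / a * y) (Rlt_le _ _ Pu)).
assert (Pf := fact_pos n).
assert (Q2 : Rpower ((c / a * y) ^ n) a <= Rpower (INR (fact n) * exp (c / a * y)) a).
{ apply Rle_Rpower_l; [lra|]. split; [now apply pow_lt|exact Q]. }
rewrite <- Rpower_mult_distr in Q2 by (try exact Pf; apply exp_pos).
replace (Rpower (exp (c / a * y)) a) with (exp (c * y)) in Q2.
2:{ unfold Rpower. rewrite ln_exp. f_equal. field. lra. }
rewrite Rpower_pow_base in Q2 by exact Pu.
assert (E1 : Rpower (c / a * y) a = / (Rpower (a / c) a * r)).
{ rewrite Er. rewrite Rpower_Ropp.
  rewrite <- Rpower_mult_distr by (try exact Py; now apply Rdiv_lt_0_compat).
  replace (c / a) with (/ (a / c)) by (field; lra).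
  replace (Rpower (/ (a / c)) a) with (/ Rpower (a / c) a).
  - field. split; apply Rgt_not_eq, Rpower_pos.
  - unfold Rpower. rewrite ln_Rinv by now apply Rdiv_lt_0_compat. rewrite <- exp_Ropp. f_equal; ring. }
rewrite E1 in Q2.
assert (PB := Rpower_pos (a / c) a).
assert (PX : 0 < (Rpower (a / c) a * r) ^ n) by (apply pow_lt; nra).
rewrite pow_inv in Q2.
rewrite exp_Ropp. 
replace (Rpower (a / c) a ^ n * Rpower (INR (fact n)) a * r ^ n)
  with (Rpower (INR (fact n)) a * (Rpower (a / c) a * r) ^ n) by (rewrite Rpow_mult_distr; ring).
set (X := (Rpower (a / c) a * r) ^ n) in *. assert (PE := exp_pos (c * y)).
apply (Rmult_le_reg_r (exp (c * y))); [exact PE|]. rewrite Rinv_l by lra.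
apply (Rmult_le_compat_r X) in Q2; [|lra]. rewrite Rinv_l in Q2 by lra. lra.
Qed.

(** Phrased as a domination so that it covers both [Cexp (- W)] and the zero function, the two
    functions that non-injectivity compares. *)
Lemma gevrey_flat_asymptotic (a : R) (S : sector) (f : C -> C) (W : C -> C) :
  0 < a ->
  (forall z, in_sector S z -> Cmod (W z) = exp (- / a * ln (Cmod z))) ->
  (forall S', subsector S' S -> exists c, 0 < c <= 1 /\ forall z, in_sector S' z -> c * Cmod (W z) <= Re (W z))
    ->
  (forall z, Cmod (f z) <= exp (- Re (W z))) ->
  gevrey_asymptotic a S f (fun _ => 0).
Proof.
intros Ha HW1 HW2 Hf S' HS'. destruct (HW2 S' HS') as [c [Hc Hre]].
exists 1, (Rpower (a / c) a). split; [lra|]. split; [apply Rpower_pos|].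
intros N z Hz. unfold partial_sum. rewrite csum_zero by (intros; ring).
replace (f z - 0)%C with (f z) by ring. rewrite Rmult_1_l.
assert (Pz : 0 < Cmod z) by apply Hz.
eapply Rle_trans; [apply Hf|]. eapply Rle_trans; [|apply (exp_flat a c (Cmod z) N); lra].
apply exp_le. rewrite <- HW1 by now apply (subsector_incl S'). specialize (Hre z Hz). lra.
Qed.

Lemma not_injective_of_small_opening (s : R) (S : sector) :
  1 < s -> opening S <= (s - 1) * PI -> ~ taylor_injective s S.
Proof.
intros Hs Hop Hinj.
destruct (negative_power_exists (s - 1) S ltac:(lra) Hop) as [W [HW [HW1 HW2]]].
destruct (gevrey_of_asymptotic s S (fun z => Cexp (- W z)) (fun _ => 0)) as [G1 T1].
- intros z Hz. eexists. apply cderiv_is_derive. apply (cderiv_comp Cexp (fun z => - W z)%C); [apply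
    cderiv_Cexp|].
  apply (cderiv_ext_loc (fun z => (-1) * W z)%C _ _ _ 1 Rlt_0_1); [intros; ring|].
  apply cderiv_scal, ex_derive_cderiv, HW, Hz.
- apply (gevrey_flat_asymptotic (s - 1) S _ W); try assumption; [lra|].
  intros z. rewrite Cmod_Cexp, re_opp. lra.
- destruct (gevrey_of_asymptotic s S (fun _ => RtoC 0) (fun _ => 0)) as [G2 T2].
  + intros z _. eexists. apply cderiv_is_derive, cderiv_const.
  + apply (gevrey_flat_asymptotic (s - 1) S _ W); try assumption; [lra|].
    intros z. rewrite Cmod_0. left; apply exp_pos.
  + destruct (sector_nonempty S) as [z Hz].
    apply (Cexp_nz (- W z)).
    apply (Hinj _ _ G1 G2); [|exact Hz]. intros k. now rewrite T1, T2.
Qed.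

(** * Series of holomorphic functions *)

Definition Cser (u : nat -> C) : C := (Series (fun n => Re (u n)), Series (fun n => Im (u n))).

(** The ratio can be fixed at [1 / 2] because the choice of [dl] achieves it on all subsectors at
    once; only [B] then depends on the subsector. *)
Definition geom_dominated (B : R) (u : nat -> C) : Prop := forall n, Cmod (u n) <= B * (1 / 2) ^ n.

Lemma real_geom_series (B : R) (u : nat -> R) :
  (forall n, Rabs (u n) <= B * (1 / 2) ^ n) -> ex_series u /\ Rabs (Series u) <= 2 * B.
Proof.
intros H.
assert (Hq : Rabs (1 / 2) < 1) by (rewrite Rabs_pos_eq; lra).
assert (Eg : ex_series (fun n => B * (1 / 2) ^ n)).
{ apply (ex_series_scal (K := R_AbsRing) (V := R_NormedModule) B (fun n => (1 / 2) ^ n)). now apply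
    ex_series_geom. }
assert (Ea : ex_series (fun n => Rabs (u n))).
{ apply (ex_series_le (K := R_AbsRing) (V := R_CompleteNormedModule) _ (fun n => B * (1 / 2) ^ n)); [|exact Eg].
  intros n. unfold norm; simpl. unfold abs; simpl. rewrite Rabs_Rabsolu. apply H. }
split; [now apply ex_series_Rabs|].
eapply Rle_trans; [now apply Series_Rabs|].
eapply Rle_trans; [apply (Series_le _ (fun n => B * (1 / 2) ^ n)); [|exact Eg]|].
- intros n. split; [apply Rabs_pos|apply H].
- rewrite Series_scal_l, Series_geom by exact Hq. right. field.
Qed.

Lemma geom_dominated_Re (B : R) (u : nat -> C) : geom_dominated B u ->
  ex_series (fun n => Re (u n)) /\ Rabs (Series (fun n => Re (u n))) <= 2 * B.
Proof.
intros H. apply real_geom_series. intros n. eapply Rle_trans; [apply re_le_Cmod|apply H].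
Qed.

Lemma geom_dominated_Im (B : R) (u : nat -> C) : geom_dominated B u ->
  ex_series (fun n => Im (u n)) /\ Rabs (Series (fun n => Im (u n))) <= 2 * B.
Proof.
intros H. apply real_geom_series. intros n. eapply Rle_trans; [apply im_le_Cmod|apply H].
Qed.

(** One factor [2] is the geometric sum, the other comes from the two components. *)
Lemma Cser_bound (B : R) (u : nat -> C) : geom_dominated B u -> Cmod (Cser u) <= 4 * B.
Proof.
intros H. destruct (geom_dominated_Re B u H) as [_ H1]. destruct (geom_dominated_Im B u H) as [_ H2].
eapply Rle_trans; [apply Cmod_le_Rabs|]. unfold Cser, Re at 1, Im at 1; simpl. lra.
Qed.

Lemma Cser_minus (B1 B2 : R) (u v : nat -> C) : geom_dominated B1 u -> geom_dominated B2 v ->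
  Cser (fun n => u n - v n)%C = (Cser u - Cser v)%C.
Proof.
intros H1 H2.
destruct (geom_dominated_Re B1 u H1) as [A1 _]. destruct (geom_dominated_Im B1 u H1) as [A2 _].
destruct (geom_dominated_Re B2 v H2) as [A3 _]. destruct (geom_dominated_Im B2 v H2) as [A4 _].
unfold Cser, Cminus, Cplus, Copp; simpl. f_equal.
- exact (Series_minus _ _ A1 A3).
- exact (Series_minus _ _ A2 A4).
Qed.

Lemma Cser_mult_r (B : R) (u : nat -> C) (h : C) : geom_dominated B u ->
  Cser (fun n => u n * h)%C = (Cser u * h)%C.
Proof.
intros H.
destruct (geom_dominated_Re B u H) as [A1 _]. destruct (geom_dominated_Im B u H) as [A2 _].
unfold Cser, Cmult; simpl. f_equal.
- rewrite <- !Series_scal_r. apply Series_minus; now apply ex_series_scal_r.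
- rewrite <- !Series_scal_r. apply Series_plus; now apply ex_series_scal_r.
Qed.

Lemma csum_shift (u : nat -> C) (N : nat) : csum u (S N) = (u 0%nat + csum (fun n => u (S n)) N)%C.
Proof.
induction N as [|N IH]; [simpl; ring|].
cbn [csum] in *. rewrite IH. ring.
Qed.

Lemma Cser_tail (N : nat) : forall (B : R) (u : nat -> C),
  geom_dominated B (fun n => u (N + n)%nat) -> Cmod (Cser u - csum u N) <= 4 * B.
Proof.
induction N as [|N IH]; intros B u H.
- simpl. replace (Cser u - 0)%C with (Cser u) by ring. now apply Cser_bound.
- rewrite csum_shift.
  assert (E : Cser u = (u 0%nat + Cser (fun n => u (S n)))%C).
  { destruct (geom_dominated_Re B _ H) as [A1 _]. destruct (geom_dominated_Im B _ H) as [A2 _].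
    apply (ex_series_incr_n (fun n => Re (u n)) (S N)) in A1.
    apply (ex_series_incr_n (fun n => Im (u n)) (S N)) in A2.
    unfold Cser. rewrite (Series_incr_1 (fun n => Re (u n))), (Series_incr_1 (fun n => Im (u n))) by assumption.
    reflexivity. }
  rewrite E.
  replace (u 0%nat + Cser (fun n => u (S n)) - (u 0%nat + csum (fun n => u (S n)) N))%C
    with (Cser (fun n => u (S n)) - csum (fun n => u (S n)) N)%C by ring.
  apply IH. exact H.
Qed.

(* Weierstrass: the quadratic remainders of the terms are summable by the Cauchy inequalities. *)
Lemma Cser_cdiff (T : nat -> C -> C) (z0 : C) (r B : R) :
  0 < r -> (forall n, cdiff_disc (T n) z0 r) ->
  (forall z, Cmod (z - z0) < r -> geom_dominated B (fun n => T n z)) ->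
  ex_derive (V := C_NormedModule) (fun z => Cser (fun n => T n z)) z0.
Proof.
intros Hr HT HB.
assert (Z0 : Cmod (z0 - z0) < r).
{ replace (z0 - z0)%C with (RtoC 0) by ring. now rewrite Cmod_0. }
assert (PB : 0 <= B).
{ assert (Q := HB z0 Z0 0%nat). simpl in Q. rewrite Rmult_1_r in Q. eapply Rle_trans; [apply Cmod_ge_0|exact
    Q]. }
assert (D' : geom_dominated (B / r) (fun n => C_derive (T n) z0)).
{ intros n. replace (B / r * (1 / 2) ^ n) with (B * (1 / 2) ^ n / r) by (field; lra).
  apply cauchy_ineq1; [exact Hr|apply HT|]. intros z Hz. now apply (HB z Hz). }
exists (Cser (fun n => C_derive (T n) z0)). apply cderiv_is_derive.
set (K := 64 * B / (r * r)).
assert (PK : 0 <= K) by (apply Rmult_le_pos; [lra|left; apply Rinv_0_lt_compat; nra]).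
intros eps He. exists (Rmin (r / 4) (eps / (K + 1))).
split; [apply Rmin_pos; [lra|apply Rdiv_lt_0_compat; lra]|].
intros h Hh.
assert (H1 := Rlt_le_trans _ _ _ Hh (Rmin_l _ _)). assert (H2 := Rlt_le_trans _ _ _ Hh (Rmin_r _ _)).
assert (Ph := Cmod_ge_0 h).
assert (Zh : Cmod (z0 + h - z0) < r) by (replace (z0 + h - z0)%C with h by ring; lra).
rewrite <- (Cser_mult_r (B / r)) by exact D'.
rewrite <- (Cser_minus B B) by (now apply HB).
assert (Dh : geom_dominated (B / r * Cmod h) (fun n => C_derive (T n) z0 * h)%C).
{ intros n. rewrite Cmod_mult. specialize (D' n). simpl in D'.
  replace (B / r * Cmod h * (1 / 2) ^ n) with (B / r * (1 / 2) ^ n * Cmod h) by ring. now apply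
    Rmult_le_compat_r. }
assert (Dd : geom_dominated (2 * B) (fun n => T n (z0 + h) - T n z0)%C).
{ intros n. unfold Cminus. eapply Rle_trans; [apply Cmod_triangle|]. rewrite Cmod_opp.
  assert (Q1 := HB _ Zh n). assert (Q2 := HB _ Z0 n). simpl in Q1, Q2. lra. }
rewrite <- (Cser_minus (2 * B) (B / r * Cmod h)) by assumption.
apply Rle_trans with (4 * (16 * B / (r * r) * (Cmod h * Cmod h))).
- apply Cser_bound. intros n.
  replace (16 * B / (r * r) * (Cmod h * Cmod h) * (1 / 2) ^ n)
    with (16 * (B * (1 / 2) ^ n) / (r * r) * (Cmod h * Cmod h)) by (field; lra).
  apply (cauchy_quadratic (T n) z0 r); [exact Hr|apply HT| |  |exact H1].
  + intros z Hz. now apply (HB z Hz).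
  + replace (z0 - z0)%C with (RtoC 0) by ring. rewrite Cmod_0. lra.
- replace (4 * (16 * B / (r * r) * (Cmod h * Cmod h))) with (K * Cmod h * Cmod h) by (unfold K; field; lra).
  apply Rmult_le_compat_r; [exact Ph|].
  apply (Rmult_lt_compat_l (K + 1)) in H2; [|lra].
  replace ((K + 1) * (eps / (K + 1))) with eps in H2 by (field; lra). nra.
Qed.

(** * Truncated exponentials *)

Fixpoint exp_sum (p : nat) (v : R) : R :=
  match p with
  | O => 0
  | S q => exp_sum q v + v ^ q / INR (fact q)
  end.

(** For [p >= 1] this is the regularised lower incomplete gamma function, or the probability that a
    Poisson variable of mean [v >= 0] is at least [p]. *)
Definition exp_tail (p : nat) (v : R) : R := 1 - exp (- v) * exp_sum p v.

Definition Cexp_sum (p : nat) (x : C) : C := csum (fun j => x ^ j / INR (fact j))%C p.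

Definition Cexp_tail (p : nat) (x : C) : C := (1 - Cexp (- x) * Cexp_sum p x)%C.

Lemma exp_sum_derive (p : nat) (v : R) : is_derive (exp_sum (S p)) v (exp_sum p v).
Proof.
induction p as [|p IH].
- apply (is_derive_ext (fun _ => 1)); [intros t; simpl; field|]. simpl. auto_derive; [exact I|reflexivity].
- apply (is_derive_plus (V := R_NormedModule) (exp_sum (S p)) (fun v => v ^ S p / INR (fact (S p)))); [exact
    IH|].
  apply (is_derive_ext (fun v => / INR (fact (S p)) * v ^ S p)); [intros t; apply Rmult_comm|].
  replace (v ^ p / INR (fact p)) with (/ INR (fact (S p)) * (INR (S p) * 1 * v ^ pred (S p))).
  + apply is_derive_scal. apply is_derive_pow, (is_derive_id (K := R_AbsRing)).
  + rewrite fact_simpl, mult_INR. simpl pred. field.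
    assert (0 < INR (S p)) by (apply lt_0_INR; lia). assert (T := fact_pos p). split; lra.
Qed.

Lemma exp_tail_derive (p : nat) (v : R) :
  is_derive (exp_tail (S p)) v (exp (- v) * (v ^ p / INR (fact p))).
Proof.
unfold exp_tail.
replace (exp (- v) * (v ^ p / INR (fact p)))
  with (minus 0 (plus (mult (- exp (- v)) (exp_sum (S p) v)) (mult (exp (- v)) (exp_sum p v)))).
- apply (is_derive_minus (V := R_NormedModule) (fun _ => 1) (fun v => exp (- v) * exp_sum (S p) v)).
  + auto_derive; [exact I|reflexivity].
  + apply (is_derive_mult (K := R_AbsRing) (fun v => exp (- v)) (exp_sum (S p))).
    * auto_derive; [exact I|ring].
    * apply exp_sum_derive.
    * intros; apply Rmult_comm.
- unfold minus, plus, opp, mult; simpl. ring.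
Qed.

Lemma exp_tail_0 (p : nat) : exp_tail (S p) 0 = 0.
Proof.
unfold exp_tail. replace (exp_sum (S p) 0) with 1.
- rewrite Ropp_0, exp_0. ring.
- induction p as [|p IH]; [simpl; field|].
  change (exp_sum (S (S p)) 0) with (exp_sum (S p) 0 + 0 ^ S p / INR (fact (S p))).
  rewrite <- IH. rewrite pow_i by lia. unfold Rdiv. ring.
Qed.

Lemma exp_tail_anti (m p : nat) (v : R) : (m <= p)%nat -> 0 <= v -> exp_tail p v <= exp_tail m v.
Proof.
intros Hmp Hv. induction Hmp as [|p Hmp IH]; [lra|].
eapply Rle_trans; [|exact IH]. unfold exp_tail. simpl.
assert (E := exp_pos (- v)). assert (T := fact_pos p).
assert (0 <= v ^ p / INR (fact p)).
{ apply Rmult_le_pos; [now apply pow_le|left; now apply Rinv_0_lt_compat]. }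
nra.
Qed.

(** For [m >= 1] the difference vanishes at [0] and has the nonnegative derivative
    [(1 - e^(-u)) u^(m-1) / (m-1)!]. *)
Lemma exp_tail_le (m : nat) (v : R) : 0 <= v -> exp_tail m v <= v ^ m / INR (fact m).
Proof.
intros Hv. destruct m as [|m].
- unfold exp_tail. simpl. lra.
- destruct (MVT_gen (fun u => u ^ S m / INR (fact (S m)) - exp_tail (S m) u) 0 v
    (fun u => u ^ m / INR (fact m) - exp (- u) * (u ^ m / INR (fact m)))) as [c [Hc E]].
  + intros u _. apply (is_derive_minus (V := R_NormedModule) (fun u => u ^ S m / INR (fact (S m))) (exp_tail (S
      m))); [|apply exp_tail_derive].
    apply (is_derive_ext (fun v => / INR (fact (S m)) * v ^ S m)); [intros t; apply Rmult_comm|].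
    replace (u ^ m / INR (fact m)) with (/ INR (fact (S m)) * (INR (S m) * 1 * u ^ pred (S m))).
    * apply is_derive_scal. apply is_derive_pow, (is_derive_id (K := R_AbsRing)).
    * rewrite fact_simpl, mult_INR. simpl pred. field.
      assert (0 < INR (S m)) by (apply lt_0_INR; lia). assert (T := fact_pos m). split; lra.
  + intros u _. apply continuity_pt_filterlim. apply (continuous_minus (V := R_NormedModule) (fun u => u ^ S m
      / INR (fact (S m))) (exp_tail (S m))).
    * apply (ex_derive_continuous (fun u => u ^ S m / INR (fact (S m)))).
      auto_derive. exact I.
    * apply (ex_derive_continuous (exp_tail (S m))). eexists. apply exp_tail_derive.
  + rewrite Rmin_left, Rmax_right in Hc by lra.
    rewrite exp_tail_0, pow_i in E by lia.
    assert (T := fact_pos m).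
    assert (P : 0 <= c ^ m / INR (fact m)).
    { apply Rmult_le_pos; [apply pow_le; lra|left; now apply Rinv_0_lt_compat]. }
    assert (Ee : exp (- c) <= 1) by (rewrite <- exp_0; apply exp_le; lra).
    assert (0 <= (c ^ m / INR (fact m) - exp (- c) * (c ^ m / INR (fact m))) * (v - 0)) by (apply Rmult_le_pos;
      nra).
    unfold Rdiv in E at 2. lra.
Qed.

Lemma Cexp_sum_cderiv (p : nat) (x : C) : cderiv (Cexp_sum (S p)) x (Cexp_sum p x).
Proof.
unfold Cexp_sum. induction p as [|p IH].
- apply (cderiv_ext_loc (fun _ => 1) _ _ _ 1 Rlt_0_1).
  + intros w _. simpl. field.
  + apply cderiv_const.
- apply (cderiv_plus (fun x => csum (fun j => x ^ j / INR (fact j))%C (S p))); [exact IH|].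
  apply (cderiv_ext_loc (fun w => / INR (fact (S p)) * w ^ S p)%C _ _ _ 1 Rlt_0_1); [intros w _; unfold Cdiv;
    ring|].
  eapply cderiv_eq; [apply cderiv_scal, cderiv_pow|].
  replace (S p - 1)%nat with p by lia.
  rewrite fact_simpl, mult_INR, RtoC_mult. field. split; [apply INR_fact_nz|].
  intros Q. apply RtoC_inj in Q. assert (0 < INR (S p)) by (apply lt_0_INR; lia). lra.
Qed.

Lemma Cexp_tail_cderiv (p : nat) (x : C) :
  cderiv (Cexp_tail (S p)) x (Cexp (- x) * (x ^ p / INR (fact p)))%C.
Proof.
unfold Cexp_tail. eapply cderiv_eq.
- apply cderiv_minus; [apply cderiv_const|]. apply cderiv_mult; [apply cderiv_Cexp_opp|apply Cexp_sum_cderiv].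
- unfold Cexp_sum. cbn [csum]. ring.
Qed.

(** For [p >= 1] the derivative of [Cexp_tail p] is [e^(-x) x^(p-1) / (p-1)!]. On the ray,
    [Re x >= c |x|] compares its modulus with the derivative of the real tail at [c |x|], at the
    price of [c^(- p)]. *)
Lemma Cexp_tail_bound (c : R) (p : nat) (x : C) :
  0 < c <= 1 -> c * Cmod x <= Re x -> Cmod (Cexp_tail p x) <= (/ c) ^ p * exp_tail p (c * Cmod x).
Proof.
intros Hc Hx. set (X := Cmod x) in *. assert (PX : 0 <= X) by apply Cmod_ge_0.
destruct p as [|p].
- unfold Cexp_tail, Cexp_sum, exp_tail. simpl. replace (1 - Cexp (- x) * 0)%C with (RtoC 1) by ring.
  rewrite Cmod_1. lra.
- set (F := fun t : R => Cexp_tail (S p) (0 + x * t)%C).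
  assert (F0 : F 0 = 0).
  { unfold F. replace (0 + x * 0%R)%C with (RtoC 0) by ring.
    unfold Cexp_tail, Cexp_sum. replace (csum (fun j => RtoC 0 ^ j / INR (fact j))%C (S p)) with (RtoC 1).
    - replace (- RtoC 0)%C with (RtoC 0) by ring. rewrite Cexp_0. ring.
    - rewrite csum_shift. rewrite csum_zero.
      + simpl. field.
      + intros n _. rewrite Cpow_S. unfold Cdiv. ring. }
  assert (Pf := fact_pos p).
  replace (Cexp_tail (S p) x) with (F 1 - F 0)%C.
  2:{ rewrite F0. unfold F. replace (0 + x * 1%R)%C with x by ring. ring. }
  set (g := fun t => (/ c) ^ S p * exp_tail (S p) (c * X * t)).
  replace ((/ c) ^ S p * exp_tail (S p) (c * X)) with (g 1 - g 0).
  2:{ unfold g. rewrite Rmult_0_r, exp_tail_0, Rmult_1_r. ring. }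
  apply (mean_value_ineq F (fun t : R => Cexp (- (0 + x * t)) * ((0 + x * t) ^ p / INR (fact p)) * x)%C g
    (fun t => (/ c) ^ S p * (c * X * (exp (- (c * X * t)) * ((c * X * t) ^ p / INR (fact p)))))).
  + lra.
  + intros t _. apply cderiv_rderiv, Cexp_tail_cderiv.
  + intros t _. apply is_derive_scal.
    apply (is_derive_comp (exp_tail (S p)) (fun t => c * X * t)); [apply exp_tail_derive|apply is_derive_lin].
  + intros t Ht. rewrite Cplus_0_l, !Cmod_mult, Cmod_div, Cmod_pow, Cmod_mult, !Cmod_R, Cmod_Cexp, !Rabs_pos_eq
      by (try lra; apply INR_fact_nz).
    fold X. rewrite re_opp, re_scal_r.
    replace ((/ c) ^ S p * (c * X * (exp (- (c * X * t)) * ((c * X * t) ^ p / INR (fact p)))))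
      with (exp (- (c * X * t)) * ((X * t) ^ p / INR (fact p)) * X).
    * apply Rmult_le_compat_r; [exact PX|]. apply Rmult_le_compat_r.
      -- apply Rmult_le_pos; [apply pow_le; nra|left; now apply Rinv_0_lt_compat].
      -- apply exp_le. nra.
    * rewrite !Rpow_mult_distr, pow_inv. simpl. field. repeat split; try lra. apply pow_nonzero; lra.
Qed.

Lemma Cexp_tail_compl (c : R) (p : nat) (x : C) :
  c * Cmod x <= Re x -> Cmod (1 - Cexp_tail p x) <= exp (- (c * Cmod x)) * exp_sum p (Cmod x).
Proof.
intros Hx. replace (1 - Cexp_tail p x)%C with (Cexp (- x) * Cexp_sum p x)%C by (unfold Cexp_tail; ring).
rewrite Cmod_mult, Cmod_Cexp, re_opp.
apply Rmult_le_compat; [left; apply exp_pos|apply Cmod_ge_0|apply exp_le; lra|].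
unfold Cexp_sum. induction p as [|p IH]; simpl.
- rewrite Cmod_0. lra.
- eapply Rle_trans; [apply Cmod_triangle|]. apply Rplus_le_compat; [exact IH|].
  rewrite Cmod_div by apply INR_fact_nz. rewrite Cmod_pow, Cmod_R, Rabs_pos_eq by (left; apply fact_pos). lra.
Qed.

(** Bounding the real tail at order [m] recovers [c^m], so that only [c^(m - p)] is lost. In
    [tail_term] the difference [p - m] is at most [a N + 2], which keeps the constant of the
    subsector out of the ratio in [k]. *)
Lemma Cexp_tail_bound_pow (c : R) (m p : nat) (x : C) :
  0 < c <= 1 -> c * Cmod x <= Re x -> (m <= p)%nat ->
  Cmod (Cexp_tail p x) <= (/ c) ^ (p - m) * (Cmod x ^ m / INR (fact m)).
Proof.
intros Hc Hx Hm. assert (PX := Cmod_ge_0 x).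
assert (Pc : 0 < (/ c) ^ p) by (apply pow_lt, Rinv_0_lt_compat; lra).
eapply Rle_trans; [now apply (Cexp_tail_bound c)|].
replace ((/ c) ^ (p - m) * (Cmod x ^ m / INR (fact m))) with ((/ c) ^ p * ((c * Cmod x) ^ m / INR (fact m))).
- apply Rmult_le_compat_l; [lra|].
  eapply Rle_trans; [apply (exp_tail_anti m p); [exact Hm|nra]|]. apply exp_tail_le; nra.
- replace p with (p - m + m)%nat at 1 by lia. rewrite pow_add, Rpow_mult_distr, !pow_inv.
  assert (T := fact_pos m). field. repeat split; try lra; apply pow_nonzero; lra.
Qed.

(** * Comparison of factorials and their powers *)

Lemma INR_fact_ge_1 (n : nat) : 1 <= INR (fact n).
Proof. apply (le_INR 1). assert (T := lt_O_fact n). lia. Qed.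

Lemma Rpower_ge_1 (x a : R) : 1 <= x -> 0 <= a -> 1 <= Rpower x a.
Proof.
intros Hx Ha. rewrite <- (Rpower_O x) by lra. now apply Rle_Rpower.
Qed.

Lemma pow_ge_1 (x : R) (n : nat) : 1 <= x -> 1 <= x ^ n.
Proof. intros Hx. rewrite <- (pow1 n). apply pow_incr. lra. Qed.

Lemma INR_le_pow2 (n : nat) : INR n <= 2 ^ n.
Proof.
induction n as [|n IH]; [simpl; lra|]. rewrite S_INR. simpl.
assert (T := pow_ge_1 2 n ltac:(lra)). lra.
Qed.

Lemma Rpower_self_pow (k : nat) (a : R) : (1 <= k)%nat -> Rpower (INR k ^ k) a = Rpower (INR k) (a * INR k).
Proof.
intros Hk. assert (P : 0 < INR k) by (apply lt_0_INR; lia).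
rewrite <- Rpower_pow, Rpower_mult by exact P. f_equal; ring.
Qed.

(** For [k >= 1], [k!^a <= k^(a k) <= k^(m + 1)] and [k <= (m + 1) / a]; then [pow_self_le_fact]
    leads back to [(m + 1)!], and [m + 1 <= 2^(m + 1)] to [m!]. These two steps account for the
    constant [2 e / a]. *)
Lemma fact_power_le_fact (a : R) : 0 < a -> exists K, 1 <= K /\
  forall k m, INR m <= a * INR k < INR m + 1 -> Rpower (INR (fact k)) a <= K ^ S k * INR (fact m).
Proof.
intros Ha. assert (P1 := exp_pos 1).
set (B := Rmax 1 (2 * exp 1 / a)). assert (B1 : 1 <= B) by apply Rmax_l. assert (B2 : 2 * exp 1 / a <= B) by
  apply Rmax_r.
exists (Rpower B (a + 1)). split; [apply Rpower_ge_1; lra|].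
intros k m Hm. assert (Fm := INR_fact_ge_1 m).
assert (K1 : 1 <= Rpower B (a + 1)) by (apply Rpower_ge_1; lra).
destruct k as [|k].
{ simpl fact. unfold Rpower at 1. simpl INR at 1. rewrite ln_1, Rmult_0_r, exp_0, pow_1. nra. }
assert (Pk : 1 <= INR (S k)) by (rewrite S_INR; assert (T := pos_INR k); lra).
set (x := INR (S k)) in *. set (M1 := S m). assert (EM : INR M1 = INR m + 1) by apply S_INR.
apply Rle_trans with (Rpower (x ^ S k) a).
{ apply Rle_Rpower_l; [lra|]. split; [apply fact_pos|apply fact_le_pow]. }
unfold x at 1. rewrite Rpower_self_pow by lia. fold x.
apply Rle_trans with (Rpower x (INR M1)); [apply Rle_Rpower; lra|].
rewrite Rpower_pow by lra.
assert (Hx : x <= INR M1 / a).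
{ apply (Rmult_le_reg_r a); [exact Ha|]. replace (INR M1 / a * a) with (INR M1) by (field; lra). lra. }
apply Rle_trans with ((INR M1 / a) ^ M1); [apply pow_incr; lra|].
apply Rle_trans with (B ^ M1 * INR (fact m)).
- apply Rle_trans with ((2 * exp 1 / a) ^ M1 * INR (fact m)).
  + unfold Rdiv. rewrite !Rpow_mult_distr.
    assert (Q := pow_self_le_fact M1). unfold M1 in Q at 4. rewrite fact_simpl, mult_INR in Q. fold M1 in Q.
    assert (Q2 := INR_le_pow2 M1).
    assert (Pe : 0 < exp 1 ^ M1) by now apply pow_lt.
    assert (Pi : 0 < (/ a) ^ M1) by (apply pow_lt; now apply Rinv_0_lt_compat).
    replace (2 ^ M1 * exp 1 ^ M1 * (/ a) ^ M1 * INR (fact m)) with (exp 1 ^ M1 * (2 ^ M1 * INR (fact m)) * (/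
      a) ^ M1) by ring.
    apply Rmult_le_compat_r; [lra|]. eapply Rle_trans; [exact Q|].
    apply Rmult_le_compat_l; [lra|]. apply Rmult_le_compat_r; lra.
  + apply Rmult_le_compat_r; [lra|]. apply pow_incr. split; [|exact B2].
    left. apply Rdiv_lt_0_compat; lra.
- apply Rmult_le_compat_r; [lra|].
  rewrite <- Rpower_nat_mult. rewrite <- Rpower_pow by lra.
  apply Rle_Rpower; [exact B1|]. rewrite (S_INR (S k)). fold x. nra.
Qed.

Lemma fact_le_fact_power (a : R) : 0 < a -> exists K, 1 <= K /\
  forall k m, INR m <= a * INR k + 1 -> INR (fact m) <= K ^ S k * Rpower (INR (fact k)) a.
Proof.
intros Ha. assert (P1 := exp_pos 1). assert (E1 := exp_ineq1_le 1).
(* Here [m!] is compared with [((a + 1) x)^(a x + 1)] for [x = k]: [b] collects the powers of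
   [a + 1], [g] comes from [k^k <= e^k k!] raised to the power [a], and the [2] in [K0] from
   [x <= 2^k]. *)
set (b := Rpower (a + 1) a). set (g := Rpower (exp 1) a).
assert (b1 : 1 <= b) by (apply Rpower_ge_1; lra). assert (g1 : 1 <= g) by (apply Rpower_ge_1; lra).
set (K0 := 2 * b * g). assert (K01 : 1 <= K0) by (unfold K0; nra).
exists ((a + 1) * K0). assert (K1 : 1 <= (a + 1) * K0) by nra. split; [exact K1|].
intros k m Hm.
assert (Fk := Rpower_ge_1 (INR (fact k)) a (INR_fact_ge_1 k) ltac:(lra)).
assert (Easy : INR (fact m) = 1 -> INR (fact m) <= ((a + 1) * K0) ^ S k * Rpower (INR (fact k)) a).
{ intros ->. assert (T := pow_ge_1 _ (S k) K1). nra. }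
destruct m as [|m]; [apply Easy; reflexivity|].
destruct k as [|k].
{ apply Easy. replace m with 0%nat; [reflexivity|].
  rewrite S_INR in Hm. simpl in Hm. destruct m as [|m]; [reflexivity|].
  rewrite S_INR in Hm. assert (T := pos_INR m). lra. }
set (x := INR (S k)) in *. assert (Pk : 1 <= x) by (unfold x; rewrite S_INR; assert (T := pos_INR k); lra).
set (v := INR (S m)) in *. assert (Pm : 1 <= v) by (unfold v; rewrite S_INR; assert (T := pos_INR m); lra).
apply Rle_trans with (v ^ S m); [apply fact_le_pow|].
rewrite <- Rpower_pow by lra. fold v.
apply Rle_trans with (Rpower v (a * x + 1)); [apply Rle_Rpower; lra|].
apply Rle_trans with (Rpower ((a + 1) * x) (a * x + 1)).
{ apply Rle_Rpower_l; [nra|]. split; [lra|nra]. }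
rewrite Rpower_plus, Rpower_1 by nra.
rewrite <- Rpower_mult_distr by lra.
unfold x at 1 2. rewrite <- Rpower_self_pow by lia. rewrite Rpower_nat_mult. fold b x.
assert (Q : Rpower (x ^ S k) a <= g ^ S k * Rpower (INR (fact (S k))) a).
{ unfold g. rewrite <- Rpower_pow_base by exact P1. rewrite Rpower_mult_distr by (try apply fact_pos; now apply
    pow_lt).
  apply Rle_Rpower_l; [lra|]. split; [apply pow_lt; lra|apply pow_self_le_fact]. }
assert (Q2 : x <= 2 ^ S k) by apply INR_le_pow2.
assert (Pb : 0 < b ^ S k) by (apply pow_lt; lra).
set (f := Rpower (INR (fact (S k))) a) in *.
apply Rle_trans with (b ^ S k * (g ^ S k * f) * ((a + 1) * 2 ^ S k)).
- assert (Px : 0 < Rpower (x ^ S k) a) by apply Rpower_pos.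
  apply Rmult_le_compat; [nra|nra| |apply Rmult_le_compat_l; lra].
  apply Rmult_le_compat_l; lra.
- replace (b ^ S k * (g ^ S k * f) * ((a + 1) * 2 ^ S k)) with ((a + 1) * K0 ^ S k * f)
    by (unfold K0; rewrite !Rpow_mult_distr; ring).
  apply Rmult_le_compat_r; [lra|].
  change (((a + 1) * K0) ^ S (S k)) with ((a + 1) * K0 * ((a + 1) * K0) ^ S k).
  rewrite (Rpow_mult_distr (a + 1) K0).
  assert (A1 := pow_ge_1 (a + 1) (S k) ltac:(lra)). assert (A2 := pow_ge_1 K0 (S k) K01).
  apply Rle_trans with ((a + 1) * K0 * (1 * K0 ^ S k)).
  + rewrite Rmult_1_l, Rmult_assoc. apply Rmult_le_compat_l; [lra|]. nra.
  + apply Rmult_le_compat_l; [nra|]. apply Rmult_le_compat_r; lra.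
Qed.

(** The binomial coefficient lies between [1] and [2^s]; the induction is Pascal's rule with the
    denominators cleared. *)
Lemma fact_add_le (s : nat) : forall n k, (n + k = s)%nat ->
  (fact n * fact k <= fact s <= 2 ^ s * (fact n * fact k))%nat.
Proof.
induction s as [|s IH]; intros n k H.
- assert (n = 0%nat /\ k = 0%nat) as [-> ->] by lia. simpl. lia.
- destruct n as [|n]; [|destruct k as [|k]].
  + rewrite Nat.add_0_l in H. subst k. change (fact 0) with 1%nat.
    assert (P := Nat.pow_nonzero 2 (S s) ltac:(lia)).
    set (q := (2 ^ S s)%nat) in *. set (t := fact (S s)). nia.
  + assert (n = s) as -> by lia. change (fact 0) with 1%nat.
    assert (P := Nat.pow_nonzero 2 (S s) ltac:(lia)).
    set (q := (2 ^ S s)%nat) in *. set (t := fact (S s)). nia.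
  + destruct (IH n (S k) ltac:(lia)) as [A1 A2]. destruct (IH (S n) k ltac:(lia)) as [B1 B2].
    rewrite (fact_simpl s). replace (S s) with (S n + S k)%nat by lia.
    rewrite (fact_simpl n), (fact_simpl k) in *.
    replace (2 ^ (S n + S k))%nat with (2 * 2 ^ s)%nat by (replace (S n + S k)%nat with (S s) by lia;
      reflexivity).
    set (P := (2 ^ s)%nat) in *. set (fn := fact n) in *. set (fk := fact k) in *. set (fs := fact s) in *.
    nia.
Qed.

Lemma Rpower_fact_add (a : R) (n k : nat) : 0 < a ->
  Rpower (INR (fact n)) a * Rpower (INR (fact k)) a <= Rpower (INR (fact (n + k))) a /\
  Rpower (INR (fact (n + k))) a <= Rpower 2 a ^ (n + k) * (Rpower (INR (fact n)) a * Rpower (INR (fact k)) a).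
Proof.
intros Ha. destruct (fact_add_le (n + k) n k eq_refl) as [H1 H2].
apply le_INR in H1. apply le_INR in H2. rewrite !mult_INR in *. rewrite pow_INR in H2.
change (INR 2) with 2 in H2.
assert (Pn := fact_pos n). assert (Pk := fact_pos k). assert (Pnk := fact_pos (n + k)).
rewrite Rpower_mult_distr by assumption.
assert (P2 : 0 < 2 ^ (n + k)) by (apply pow_lt; lra).
rewrite <- Rpower_pow_base by lra.
rewrite Rpower_mult_distr by (try exact P2; now apply Rmult_lt_0_compat).
split; apply Rle_Rpower_l; try lra; split; try assumption; now apply Rmult_lt_0_compat.
Qed.

Lemma ceil_sequence (a : R) : 0 < a -> exists p : nat -> nat, forall n, a * INR n <= INR (p n) <= a * INR n + 1.
Proof.
intros Ha. exists (fun n => Z.to_nat (up (a * INR n))). intros n.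
destruct (archimed (a * INR n)) as [H1 H2].
assert (P := pos_INR n). assert (0 <= a * INR n) by nra.
assert (Z0 : (0 <= up (a * INR n))%Z) by (apply le_IZR; lra).
rewrite (INR_IZR_INZ (Z.to_nat _)), Z2Nat.id by exact Z0. lra.
Qed.

(** * Bounds for the terms of the sum *)

Lemma Rpower_inv_base (y q : R) : 0 < y -> Rpower y (- q) = Rpower (/ y) q.
Proof. intros Hy. unfold Rpower. rewrite ln_Rinv by exact Hy. f_equal; ring. Qed.

(** Rounding [a k] to an integer leaves a power of [|W|] with exponent in [[-1, 0]]. It is bounded
    because [1 / |W| = |z|^(1/a)] is bounded on a sector of finite radius. *)
Lemma Rpower_le_of_small_exponent (y Y q : R) : 0 < y -> 1 <= Y -> / y <= Y -> 0 <= q <= 1 -> Rpower y (- q) <=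
  Y.
Proof.
intros Hy HY H Hq. rewrite Rpower_inv_base by exact Hy.
apply Rle_trans with (Rpower Y q).
- apply Rle_Rpower_l; [lra|]. split; [now apply Rinv_0_lt_compat|exact H].
- rewrite <- (Rpower_1 Y) at 2 by lra. apply Rle_Rpower; lra.
Qed.

Lemma Rmult4_le (p a b c d a' b' c' d' : R) :
  0 <= p -> 0 <= a <= a' -> 0 <= b <= b' -> 0 <= c <= c' -> 0 <= d <= d' ->
  p * (a * (b * (c * d))) <= p * (a' * (b' * (c' * d'))).
Proof.
intros Hp Ha Hb Hc Hd.
assert (Pcd : 0 <= c * d) by nra. assert (Pbcd : 0 <= b * (c * d)) by nra.
apply Rmult_le_compat_l; [exact Hp|].
apply Rmult_le_compat; try lra. apply Rmult_le_compat; try lra. apply Rmult_le_compat; lra.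
Qed.

(* The smallness condition on [dl] does not involve the constant [c] of the subsector, so that a single
   function serves all subsectors. *)
Lemma tail_term (a Ac K dl c Y : R) (p : nat -> nat) :
  0 < a -> 1 <= Ac -> 1 <= K -> 0 < dl <= 1 -> 0 < c <= 1 -> 1 <= Y ->
  (forall n, a * INR n <= INR (p n) <= a * INR n + 1) ->
  (forall k m, INR m <= a * INR k < INR m + 1 -> Rpower (INR (fact k)) a <= K ^ S k * INR (fact m)) ->
  Ac * Rpower 2 a * K * Rpower dl a <= 1 / 2 ->
  exists M A, 0 < M /\ 0 < A /\ forall (N k : nat) (w : C), 0 < Cmod w -> / Cmod w <= Y -> c * Cmod w <= Re w ->
    Ac ^ (N + k) * Rpower (INR (fact (N + k))) a * Rpower (Cmod w) (- a) ^ (N + k) * Cmod (Cexp_tail (p (N +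
      k)%nat) (dl * w)) <=
    M * A ^ N * Rpower (INR (fact N)) a * Rpower (Cmod w) (- a) ^ N * (1 / 2) ^ k.
Proof.
intros Ha HA HK Hdl Hc HY Hp HF Hsmall.
set (t := Rpower 2 a) in *. set (d := Rpower dl a) in *. set (i := / c).
assert (Hi : 1 <= i) by (unfold i; rewrite <- Rinv_1; apply Rinv_le_contravar; lra).
assert (Pt : 0 < t) by apply Rpower_pos. assert (Pd : 0 < d) by apply Rpower_pos.
assert (Pg : 0 < Rpower i a) by apply Rpower_pos.
exists (i ^ 2 * Y * (/ dl) * K), (Ac * t * Rpower i a).
assert (Pdl : 0 < / dl) by (apply Rinv_0_lt_compat; lra).
split; [apply Rmult_lt_0_compat; [apply Rmult_lt_0_compat; [apply Rmult_lt_0_compat; [apply pow_lt|]|]|]; lra|].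
split; [apply Rmult_lt_0_compat; [apply Rmult_lt_0_compat|]; lra|].
intros N k w Hw HwY Hre. set (y := Cmod w) in *. set (r := Rpower y (- a)).
assert (Pr : 0 < r) by apply Rpower_pos.
assert (PN := pos_INR N). assert (Pk := pos_INR k).
(* [m] is the integer part of [a k], without [N]: then [y^m] cancels [r^k] up to [Y], [m!] cancels
   [k!^a] up to [K^(k+1)], [dl^m] supplies the decay in [k], and [q - m <= a N + 2]. *)
destruct (nfloor_ex (a * INR k)) as [m Hm]; [nra|].
specialize (Hp (N + k)%nat). rewrite plus_INR in Hp. set (q := p (N + k)%nat) in *.
assert (Hmq : (m <= q)%nat) by (apply INR_le; nra).
assert (Mx : Cmod (dl * w) = dl * y) by (rewrite Cmod_mult, Cmod_R, Rabs_pos_eq by lra; reflexivity).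
assert (HE : Cmod (Cexp_tail q (dl * w)) <= i ^ (q - m) * ((dl * y) ^ m / INR (fact m))).
{ rewrite <- Mx. apply Cexp_tail_bound_pow; [exact Hc| |exact Hmq].
  rewrite Mx, re_scal_l. nra. }
destruct (Rpower_fact_add a N k Ha) as [_ HFact]. fold t in HFact.
specialize (HF k m Hm).
set (fN := Rpower (INR (fact N)) a) in *. set (fk := Rpower (INR (fact k)) a) in *.
assert (PfN : 0 < fN) by apply Rpower_pos. assert (Pfk : 0 < fk) by apply Rpower_pos.
assert (Pfm := fact_pos m).
assert (HG : i ^ (q - m) <= i ^ 2 * Rpower i a ^ N).
{ rewrite <- Rpower_nat_mult, <- !Rpower_pow, <- Rpower_plus by lra.
  apply Rle_Rpower; [exact Hi|]. rewrite minus_INR by exact Hmq. simpl (INR 2). lra. }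
assert (HQ : r ^ k * y ^ m <= Y).
{ unfold r. rewrite <- Rpower_nat_mult, <- (Rpower_pow m), <- Rpower_plus by exact Hw.
  replace (- a * INR k + INR m) with (- (a * INR k - INR m)) by ring.
  apply Rpower_le_of_small_exponent; try assumption. lra. }
assert (HD : dl ^ m <= / dl * d ^ k).
{ rewrite <- (Rpower_pow m) by lra. unfold d. rewrite <- Rpower_nat_mult.
  replace (/ dl) with (Rpower (/ dl) 1) by (apply Rpower_1; exact Pdl).
  replace (Rpower dl (INR m)) with (Rpower (/ dl) (- INR m)).
  2:{ rewrite Rpower_inv_base, Rinv_inv by exact Pdl. reflexivity. }
  replace (Rpower dl (a * INR k)) with (Rpower (/ dl) (- (a * INR k))).
  2:{ rewrite Rpower_inv_base, Rinv_inv by exact Pdl. reflexivity. }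
  rewrite <- Rpower_plus. apply Rle_Rpower; [rewrite <- Rinv_1; apply Rinv_le_contravar; lra|lra]. }
assert (HFm : fk / INR (fact m) <= K ^ S k).
{ apply (Rmult_le_reg_r (INR (fact m))); [exact Pfm|]. replace (fk / INR (fact m) * INR (fact m)) with fk by
    (field; lra). exact HF. }
assert (PAk : 0 < Ac ^ (N + k)) by (apply pow_lt; lra).
assert (Prk : 0 < r ^ (N + k)) by now apply pow_lt.
assert (Pym : 0 < y ^ m) by now apply pow_lt.
apply Rle_trans with (Ac ^ (N + k) * (t ^ (N + k) * (fN * fk)) * r ^ (N + k) * (i ^ (q - m) * ((dl * y) ^ m /
  INR (fact m)))).
{ apply Rmult_le_compat; [|apply Cmod_ge_0| |exact HE].
  - apply Rmult_le_pos; [apply Rmult_le_pos; [lra|left; apply Rpower_pos]|lra].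
  - apply Rmult_le_compat_r; [lra|]. apply Rmult_le_compat_l; lra. }
replace (Ac ^ (N + k) * (t ^ (N + k) * (fN * fk)) * r ^ (N + k) * (i ^ (q - m) * ((dl * y) ^ m / INR (fact m))))
  with (((Ac * t) ^ N * fN * r ^ N * (Ac * t) ^ k) * (i ^ (q - m) * ((r ^ k * y ^ m) * (dl ^ m * (fk / INR
    (fact m)))))).
2:{ rewrite !pow_add, !Rpow_mult_distr. field. lra. }
eapply Rle_trans.
{ apply Rmult4_le with (a' := i ^ 2 * Rpower i a ^ N) (b' := Y) (c' := / dl * d ^ k) (d' := K ^ S k).
  - assert (0 < (Ac * t) ^ N) by (apply pow_lt; nra). assert (0 < (Ac * t) ^ k) by (apply pow_lt; nra).
    assert (0 < r ^ N) by now apply pow_lt. left. repeat apply Rmult_lt_0_compat; assumption.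
  - split; [apply pow_le; lra|exact HG].
  - split; [apply Rmult_le_pos; [apply pow_le; lra|lra]|exact HQ].
  - split; [apply pow_le; lra|exact HD].
  - split; [left; now apply Rdiv_lt_0_compat|exact HFm]. }
apply Rle_trans with (i ^ 2 * Y * / dl * K * (Ac * t * Rpower i a) ^ N * fN * r ^ N * (Ac * t * K * d) ^ k).
- right. rewrite !Rpow_mult_distr. simpl (K ^ S k). ring.
- apply Rmult_le_compat_l.
  + assert (0 < (Ac * t * Rpower i a) ^ N) by (apply pow_lt; apply Rmult_lt_0_compat; [nra|lra]).
    assert (0 < r ^ N) by now apply pow_lt.
    left. repeat apply Rmult_lt_0_compat; lra.
  + apply pow_incr. split; [|exact Hsmall]. left. repeat apply Rmult_lt_0_compat; lra.
Qed.

(** The term of order [j] is bounded through [u^(m+j) <= (m+j)! e^u] at [u = c dl y] and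
    [(m+j)! <= 2^(m+j) m! j!], whence the [2] in the ratio. The separate [q] keeps one common bound
    for all terms during the induction on [p]. *)
Lemma weighted_exp_sum_bound (c dl y : R) (m : nat) : 0 < c <= 1 -> 0 < dl <= 1 -> 0 < y -> forall p q, (p <=
  q)%nat ->
  y ^ m * (exp (- (c * (dl * y))) * exp_sum p (dl * y)) <= INR p * ((2 / (c * dl)) ^ (m + q) * INR (fact m)).
Proof.
intros Hc Hdl Hy. set (X := dl * y). assert (PX : 0 < X) by (unfold X; nra).
set (Z := 2 / (c * dl)).
assert (Pcd : 0 < c * dl) by nra.
assert (HZ : 1 <= Z).
{ unfold Z. apply (Rmult_le_reg_r (c * dl)); [exact Pcd|]. replace (2 / (c * dl) * (c * dl)) with 2 by (field;
    lra). nra. }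
induction p as [|p IH]; intros q Hpq.
- simpl. lra.
- rewrite S_INR. simpl exp_sum. rewrite !Rmult_plus_distr_l, Rmult_plus_distr_r, Rmult_1_l.
  apply Rplus_le_compat; [apply IH; lia|].
  assert (Fp := fact_pos p). assert (Fm := fact_pos m).
  assert (Q := pow_le_fact_exp (m + p) (c * X) ltac:(nra)).
  destruct (fact_add_le (m + p) m p eq_refl) as [_ HB]. apply le_INR in HB. rewrite !mult_INR, pow_INR in HB.
    change (INR 2) with 2 in HB.
  assert (Pe := exp_pos (c * X)).
  assert (Pdc : 0 < (c * dl) ^ (m + p)) by now apply pow_lt.
  apply Rle_trans with (Z ^ (m + p) * INR (fact m)).
  + rewrite exp_Ropp.
    apply (Rmult_le_reg_r ((c * dl) ^ (m + p) * INR (fact p) * exp (c * X))).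
    { repeat apply Rmult_lt_0_compat; assumption. }
    replace (y ^ m * (/ exp (c * X) * (X ^ p / INR (fact p))) * ((c * dl) ^ (m + p) * INR (fact p) * exp (c *
      X)))
      with ((c * X) ^ (m + p) * dl ^ p).
    2:{ unfold X. rewrite !pow_add, !Rpow_mult_distr. field. split; apply Rgt_not_eq; first [apply exp_pos |
      exact Fp]. }
    replace (Z ^ (m + p) * INR (fact m) * ((c * dl) ^ (m + p) * INR (fact p) * exp (c * X)))
      with (2 ^ (m + p) * (INR (fact m) * INR (fact p)) * exp (c * X)).
    2:{ replace 2 with (Z * (c * dl)) at 1 by (unfold Z; field; lra). rewrite (Rpow_mult_distr Z). ring. }
    assert (Pdp : dl ^ p <= 1) by (rewrite <- (pow1 p); apply pow_incr; lra).
    assert (PcX : 0 < (c * X) ^ (m + p)) by (apply pow_lt; nra).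
    apply Rle_trans with ((c * X) ^ (m + p)); [nra|]. eapply Rle_trans; [exact Q|].
    apply Rmult_le_compat_r; [lra|exact HB].
  + apply Rmult_le_compat_r; [lra|]. apply Rle_pow; [exact HZ|lia].
Qed.

(** For [w = W z] the power [|w|^(- a)] is [|z|]. The exponentially small deviation from [1] is
    exchanged for [k] further factors [|z|]: with an integer [m] between [a k] and [a k + 1] this
    costs [m!], which is comparable to [k!^a]. *)
Lemma head_term (a Ac K dl c Y : R) (p : nat -> nat) :
  0 < a -> 1 <= Ac -> 1 <= K -> 0 < dl <= 1 -> 0 < c <= 1 -> 1 <= Y ->
  (forall n, a * INR n <= INR (p n) <= a * INR n + 1) ->
  (forall k m, INR m <= a * INR k + 1 -> INR (fact m) <= K ^ S k * Rpower (INR (fact k)) a) ->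
  exists M A, 0 < M /\ 0 < A /\ forall (n k : nat) (w : C), 0 < Cmod w -> / Cmod w <= Y -> c * Cmod w <= Re w ->
    Ac ^ n * Rpower (INR (fact n)) a * Rpower (Cmod w) (- a) ^ n * Cmod (1 - Cexp_tail (p n) (dl * w)) <=
    M * A ^ (n + k) * Rpower (INR (fact (n + k))) a * Rpower (Cmod w) (- a) ^ (n + k).
Proof.
intros Ha HA HK Hdl Hc HY Hp HF.
set (Z := 2 / (c * dl)).
assert (Pcd : 0 < c * dl) by nra.
assert (HZ : 1 <= Z).
{ unfold Z. apply (Rmult_le_reg_r (c * dl)); [exact Pcd|]. replace (2 / (c * dl) * (c * dl)) with 2 by (field;
    lra). nra. }
assert (HW := fun y m Hy => weighted_exp_sum_bound c dl y m Hc Hdl Hy). fold Z in HW.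
set (ea := exp a). assert (Pea : 0 < ea) by apply exp_pos. assert (P1 := exp_pos 1).
assert (PZa : 0 < Rpower Z a) by apply Rpower_pos.
exists (Y * Z ^ 2 * exp 1 * K), (Ac * Rpower Z a * ea * K).
clearbody Z.
split; [repeat apply Rmult_lt_0_compat; first [exact PZ2|lra]|].
split; [repeat apply Rmult_lt_0_compat; lra|].
intros n k w Hw HwY Hre. set (y := Cmod w) in *. set (r := Rpower y (- a)).
assert (Pr : 0 < r) by apply Rpower_pos.
destruct (ceil_sequence a Ha) as [cs Hcs]. set (m := cs k). specialize (Hcs k). fold m in Hcs. clearbody m.
  clear cs.
specialize (Hp n). set (q := p n) in *.
assert (Mx : Cmod (dl * w) = dl * y) by (rewrite Cmod_mult, Cmod_R, Rabs_pos_eq by lra; reflexivity).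
assert (HE : Cmod (1 - Cexp_tail q (dl * w)) <= exp (- (c * (dl * y))) * exp_sum q (dl * y)).
{ rewrite <- Mx. apply Cexp_tail_compl. rewrite Mx, re_scal_l. nra. }
assert (HS := HW y m Hw q q (le_n q)).
destruct (Rpower_fact_add a n k Ha) as [HFact _].
specialize (HF k m ltac:(lra)).
set (fn := Rpower (INR (fact n)) a) in *. set (fk := Rpower (INR (fact k)) a) in *.
assert (Pfn : 0 < fn) by apply Rpower_pos. assert (Pfk : 0 < fk) by apply Rpower_pos.
set (E := exp (- (c * (dl * y))) * exp_sum q (dl * y)) in *.
assert (PE : 0 <= E) by (eapply Rle_trans; [apply Cmod_ge_0|exact HE]).
assert (HQ : 1 <= Y * (r ^ k * y ^ m)).
{ unfold r. rewrite <- Rpower_nat_mult, <- (Rpower_pow m), <- Rpower_plus by exact Hw.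
  assert (Q : Rpower y (- (INR m - a * INR k)) <= Y) by (apply Rpower_le_of_small_exponent; try assumption;
    lra).
  assert (Pq : 0 < Rpower y (- a * INR k + INR m)) by apply Rpower_pos.
  apply (Rmult_le_compat_r (Rpower y (- a * INR k + INR m))) in Q; [|lra].
  rewrite <- Rpower_plus in Q. replace (- (INR m - a * INR k) + (- a * INR k + INR m)) with 0 in Q by ring.
  rewrite Rpower_O in Q by exact Hw. exact Q. }
assert (Hq : INR q <= exp 1 * ea ^ n).
{ assert (T := exp_ineq1_le (a * INR n + 1)).
  replace (exp 1 * ea ^ n) with (exp (a * INR n + 1)); [lra|].
  rewrite exp_plus. unfold ea. rewrite pow_exp_ln by apply exp_pos. rewrite ln_exp, (Rmult_comm (INR n)). ring.
    }
assert (HZq : Z ^ (m + q) <= Z ^ 2 * Rpower Z a ^ (n + k)).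
{ rewrite <- Rpower_nat_mult, <- !Rpower_pow, <- Rpower_plus by lra.
  apply Rle_Rpower; [exact HZ|]. rewrite !plus_INR. simpl (INR 2). lra. }
assert (Hea : 1 <= ea) by (unfold ea; rewrite <- exp_0; apply exp_le; lra).
assert (Pan : 0 < Ac ^ n) by (apply pow_lt; lra). assert (Prn : 0 < r ^ n) by now apply pow_lt.
assert (Prk : 0 < r ^ k) by now apply pow_lt.
set (P := Ac ^ n * fn * r ^ (n + k)).
assert (PP : 0 < P) by (unfold P; rewrite pow_add; repeat apply Rmult_lt_0_compat; assumption).
apply Rle_trans with (P * (Y * (y ^ m * E))).
{ apply Rle_trans with (Ac ^ n * fn * r ^ n * E).
  - apply Rmult_le_compat_l; [|exact HE]. left. repeat apply Rmult_lt_0_compat; assumption.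
  - unfold P. rewrite pow_add.
    replace (Ac ^ n * fn * (r ^ n * r ^ k) * (Y * (y ^ m * E))) with (Ac ^ n * fn * r ^ n * E * (Y * (r ^ k * y
      ^ m))) by ring.
    rewrite <- (Rmult_1_r (Ac ^ n * fn * r ^ n * E)) at 1. apply Rmult_le_compat_l; [|exact HQ].
    apply Rmult_le_pos; [left; repeat apply Rmult_lt_0_compat; assumption|exact PE]. }
assert (Pfm := fact_pos m).
assert (PZmq : 0 < Z ^ (m + q)) by (apply pow_lt; lra).
assert (Bd : y ^ m * E <= exp 1 * ea ^ n * (Z ^ 2 * Rpower Z a ^ (n + k) * (K ^ S k * fk))).
{ eapply Rle_trans; [exact HS|]. apply Rmult_le_compat; [apply pos_INR| |exact Hq|].
  - left; now apply Rmult_lt_0_compat.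
  - apply Rmult_le_compat; lra. }
apply Rle_trans with (P * (Y * (exp 1 * ea ^ n * (Z ^ 2 * Rpower Z a ^ (n + k) * (K ^ S k * fk))))).
{ apply Rmult_le_compat_l; [lra|]. apply Rmult_le_compat_l; lra. }
unfold P.
replace (Ac ^ n * fn * r ^ (n + k) * (Y * (exp 1 * ea ^ n * (Z ^ 2 * Rpower Z a ^ (n + k) * (K ^ S k * fk)))))
  with ((Y * Z ^ 2 * exp 1 * K * Rpower Z a ^ (n + k) * r ^ (n + k)) * (Ac ^ n * (ea ^ n * (K ^ k * (fn *
    fk)))))
  by (simpl (K ^ S k); ring).
replace (Y * Z ^ 2 * exp 1 * K * (Ac * Rpower Z a * ea * K) ^ (n + k) * Rpower (INR (fact (n + k))) a * r ^ (n
  + k))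
  with ((Y * Z ^ 2 * exp 1 * K * Rpower Z a ^ (n + k) * r ^ (n + k)) * (Ac ^ (n + k) * (ea ^ (n + k) * (K ^ (n
    + k) * Rpower (INR (fact (n + k))) a))))
  by (rewrite !Rpow_mult_distr; ring).
assert (PK : 0 < K ^ k) by (apply pow_lt; lra).
apply Rmult4_le.
- assert (0 < Z ^ 2) by (apply pow_lt; lra). assert (0 < Rpower Z a ^ (n + k)) by now apply pow_lt.
  assert (0 < r ^ (n + k)) by now apply pow_lt. left. repeat apply Rmult_lt_0_compat; lra.
- split; [lra|]. apply Rle_pow; [exact HA|lia].
- split; [left; now apply pow_lt|]. apply Rle_pow; [exact Hea|lia].
- split; [lra|]. apply Rle_pow; [exact HK|lia].
- split; [left; now apply Rmult_lt_0_compat|exact HFact].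
Qed.

(** * Summation of a Gevrey series and conclusion *)

Lemma csum_diff_bound (u v : nat -> C) (N : nat) (B : R) :
  (forall n, (n < N)%nat -> Cmod (u n - v n) <= B) -> Cmod (csum u N - csum v N) <= INR N * B.
Proof.
induction N as [|N IH]; intros H.
- simpl. replace (0 - 0)%C with (RtoC 0) by ring. rewrite Cmod_0. lra.
- cbn [csum]. replace (csum u N + u N - (csum v N + v N))%C with ((csum u N - csum v N) + (u N - v N))%C by
    ring.
  eapply Rle_trans; [apply Cmod_triangle|]. rewrite S_INR.
  assert (Q1 := IH ltac:(intros; apply H; lia)). assert (Q2 := H N ltac:(lia)). lra.
Qed.

(** The remainder after [N] terms splits into the tail of the constructed series, summable by
    [tail_term], and the [N] errors made in the head by replacing the truncated exponentials with
    [1]; the n-th of these is bounded by [head_term] with [k = N - n]. *)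
Lemma surjective_of_small_opening (s : R) (S : sector) :
  1 < s -> opening S <= (s - 1) * PI -> taylor_surjective s S.
Proof.
intros Hs Hop c [M0 [A0 [PM0 [PA0 Hc]]]].
set (a := s - 1) in *. assert (Pa : 0 < a) by (unfold a; lra).
destruct (negative_power_exists a S Pa Hop) as [W [HW [HW1 HW2]]].
destruct (ceil_sequence a Pa) as [p Hp].
destruct (fact_power_le_fact a Pa) as [K1 [HK1 HF1]].
destruct (fact_le_fact_power a Pa) as [K2 [HK2 HF2]].
set (Ac := Rmax 1 A0). assert (HAc : 1 <= Ac) by apply Rmax_l. assert (HA0 : A0 <= Ac) by apply Rmax_r.
set (t := Rpower 2 a). assert (Ht : 1 <= t) by (apply Rpower_ge_1; lra).
set (D := Ac * t * K1).
assert (HD : 1 <= D) by (unfold D; assert (1 <= Ac * t) by nra; nra).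
(* [dl] is chosen with [dl^a = q], which turns the smallness condition of [tail_term] into
   [D q = 1 / 2]. *)
set (q := / (2 * D)). assert (Pq : 0 < q) by (apply Rinv_0_lt_compat; lra).
assert (Hq1 : q <= 1) by (unfold q; rewrite <- Rinv_1; apply Rinv_le_contravar; lra).
set (dl := Rpower q (/ a)).
assert (Hdl : 0 < dl <= 1).
{ split; [apply Rpower_pos|]. unfold dl, Rpower. rewrite <- exp_0. apply exp_le.
  assert (L : ln q <= 0) by (rewrite <- ln_1; now apply ln_le).
  assert (Pi := Rinv_0_lt_compat a Pa). nra. }
assert (Hsmall : Ac * t * K1 * Rpower dl a <= 1 / 2).
{ unfold dl. rewrite Rpower_mult, Rinv_l, Rpower_1 by lra. fold D. unfold q. right. field. lra. }
set (T := fun n z => (c n * z ^ n * Cexp_tail (p n) (dl * W z))%C).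
set (Y := Rmax 1 (exp (ln (radius S) / a))). assert (HY : 1 <= Y) by apply Rmax_l.
assert (Wy : forall z, in_sector S z -> 0 < Cmod (W z) /\ / Cmod (W z) <= Y /\ Rpower (Cmod (W z)) (- a) = Cmod
  z).
{ intros z Hz. rewrite (HW1 z Hz). assert (Pz : 0 < Cmod z < radius S) by apply Hz.
  split; [apply exp_pos|]. split.
  - rewrite <- exp_Ropp. eapply Rle_trans; [|apply Rmax_r]. apply exp_le.
    replace (- (- / a * ln (Cmod z))) with (ln (Cmod z) / a) by (field; lra).
    apply Rmult_le_compat_r; [left; now apply Rinv_0_lt_compat|]. apply ln_le; lra.
  - unfold Rpower. rewrite ln_exp. replace (- a * (- / a * ln (Cmod z))) with (ln (Cmod z)) by (field; lra).
    now apply exp_ln. }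
assert (TB : forall n z x, 0 <= x -> Cmod (c n * z ^ n) * x <= M0 * (Ac ^ n * Rpower (INR (fact n)) a * Cmod z
  ^ n * x)).
{ intros n z x Hx. rewrite Cmod_mult, Cmod_pow. specialize (Hc n).
  assert (PF := Rpower_pos (INR (fact n)) a). assert (PZ := pow_le (Cmod z) n (Cmod_ge_0 z)).
  assert (PI : A0 ^ n <= Ac ^ n) by (apply pow_incr; lra).
  replace (M0 * (Ac ^ n * Rpower (INR (fact n)) a * Cmod z ^ n * x)) with (M0 * Ac ^ n * Rpower (INR (fact n))
    a * Cmod z ^ n * x) by ring.
  apply Rmult_le_compat_r; [exact Hx|]. apply Rmult_le_compat_r; [exact PZ|].
  eapply Rle_trans; [exact Hc|]. apply Rmult_le_compat_r; [lra|]. apply Rmult_le_compat_l; lra. }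
assert (Tail : forall S', subsector S' S -> exists M A, 0 < M /\ 0 < A /\ forall N z, in_sector S' z ->
  geom_dominated (M * A ^ N * Rpower (INR (fact N)) a * Cmod z ^ N) (fun k => T (N + k)%nat z)).
{ intros S' HS'. destruct (HW2 S' HS') as [cc [Hcc Hre]].
  destruct (tail_term a Ac K1 dl cc Y p Pa HAc HK1 Hdl Hcc HY Hp HF1 Hsmall) as [M [A [PM [PA HB]]]].
  exists (M0 * M), A. split; [nra|]. split; [exact PA|]. intros N z Hz k.
  destruct (Wy z (subsector_incl S' S z HS' Hz)) as [Y1 [Y2 Y3]].
  specialize (HB N k (W z) Y1 Y2 (Hre z Hz)). rewrite Y3 in HB.
  unfold T. rewrite Cmod_mult.
  eapply Rle_trans; [apply TB, Cmod_ge_0|].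
  replace (M0 * M * A ^ N * Rpower (INR (fact N)) a * Cmod z ^ N * (1 / 2) ^ k)
    with (M0 * (M * A ^ N * Rpower (INR (fact N)) a * Cmod z ^ N * (1 / 2) ^ k)) by ring.
  apply Rmult_le_compat_l; [lra|exact HB]. }
assert (HT : forall n, holo (in_sector S) (T n)).
{ intros n z Hz. eexists. apply cderiv_is_derive. unfold T. apply cderiv_mult.
  - apply cderiv_scal, cderiv_pow.
  - apply (cderiv_comp (Cexp_tail (p n)) (fun z => dl * W z)%C).
    + assert (Hex : exists l, cderiv (Cexp_tail (p n)) (dl * W z) l).
      (* The bounds on [p] allow [p n = 0], where the truncated exponential is the constant [1]. *)
      { destruct (p n) as [|m]; [|eexists; apply Cexp_tail_cderiv].
        exists (RtoC 0). apply (cderiv_ext_loc (fun _ => RtoC 1) _ _ _ 1 Rlt_0_1); [|apply cderiv_const].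
        intros w _. unfold Cexp_tail, Cexp_sum. simpl. ring. }
      destruct Hex as [l Hl]. apply ex_derive_cderiv. exists l. now apply cderiv_is_derive.
    + apply cderiv_scal, ex_derive_cderiv, HW, Hz. }
exists (fun z => Cser (fun n => T n z)). apply gevrey_of_asymptotic; fold a.
- intros z Hz. destruct (in_some_subsector S z Hz) as [S' [HS' Hz']].
  destruct (in_sector_open S' z Hz') as [rho [Prho Hrho]].
  destruct (Tail S' HS') as [M [A [PM [PA HB]]]].
  (* The tail bound with [N = 0] carries no power of [|z|], hence dominates the terms uniformly on a
     disc. *)
  apply (Cser_cdiff T z rho (M * A ^ 0 * Rpower (INR (fact 0)) a * 1)); [exact Prho| |].
  + intros n w Hw. apply HT. apply (subsector_incl S' S _ HS'). now apply Hrho.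
  + intros w Hw. exact (HB 0%nat w (Hrho w Hw)).
- intros S' HS'. destruct (HW2 S' HS') as [cc [Hcc Hre]].
  destruct (Tail S' HS') as [M1 [A1 [PM1 [PA1 HB1]]]].
  destruct (head_term a Ac K2 dl cc Y p Pa HAc HK2 Hdl Hcc HY Hp HF2) as [M2 [A2 [PM2 [PA2 HB2]]]].
  exists (4 * M1 + M0 * M2), (A1 + 2 * A2). split; [nra|]. split; [lra|]. intros N z Hz.
  destruct (Wy z (subsector_incl S' S z HS' Hz)) as [Y1 [Y2 Y3]].
  set (G := Rpower (INR (fact N)) a * Cmod z ^ N).
  assert (PG : 0 <= G) by (apply Rmult_le_pos; [left; apply Rpower_pos|apply pow_le, Cmod_ge_0]).
  assert (B1 : Cmod (Cser (fun n => T n z) - csum (fun n => T n z) N) <= 4 * (M1 * A1 ^ N * G)).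
  { apply (Cser_tail N (M1 * A1 ^ N * G) (fun n => T n z)). unfold G.
    rewrite <- (Rmult_assoc (M1 * A1 ^ N)). now apply HB1. }
  assert (B2 : Cmod (csum (fun n => T n z) N - partial_sum c N z) <= INR N * (M0 * (M2 * A2 ^ N * G))).
  { apply csum_diff_bound. intros n Hn.
    specialize (HB2 n (N - n)%nat (W z) Y1 Y2 (Hre z Hz)).
    replace (n + (N - n))%nat with N in HB2 by lia. rewrite Y3 in HB2.
    replace (T n z - c n * z ^ n)%C with (- (c n * z ^ n * (1 - Cexp_tail (p n) (dl * W z))))%C by (unfold T;
      ring).
    rewrite Cmod_opp, Cmod_mult. eapply Rle_trans; [apply TB, Cmod_ge_0|].
    apply Rmult_le_compat_l; [lra|]. unfold G. rewrite <- Rmult_assoc. exact HB2. }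
  eapply Rle_trans; [apply (Cmod_sub_triangle _ (csum (fun n => T n z) N))|].
  (* The number [N] of errors in the head is absorbed by [2^N]. *)
  assert (B3 : INR N * A2 ^ N <= (A1 + 2 * A2) ^ N).
  { apply Rle_trans with (2 ^ N * A2 ^ N).
    - apply Rmult_le_compat_r; [apply pow_le; lra|apply INR_le_pow2].
    - rewrite <- Rpow_mult_distr. apply pow_incr. lra. }
  assert (B4 : A1 ^ N <= (A1 + 2 * A2) ^ N) by (apply pow_incr; lra).
  set (X := (A1 + 2 * A2) ^ N) in *.
  apply Rle_trans with (4 * (M1 * X * G) + M0 * M2 * (X * G)).
  + apply Rplus_le_compat.
    * eapply Rle_trans; [exact B1|]. apply Rmult_le_compat_l; [lra|]. apply Rmult_le_compat_r; [exact PG|].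
      apply Rmult_le_compat_l; lra.
    * eapply Rle_trans; [exact B2|].
      replace (INR N * (M0 * (M2 * A2 ^ N * G))) with (M0 * M2 * (INR N * A2 ^ N * G)) by ring.
      apply Rmult_le_compat_l; [nra|]. apply Rmult_le_compat_r; lra.
  + right. unfold G. ring.
Qed.

Theorem mainTheorem3 (s : R) (S : sector) (hs : 1 < s) :
  (opening S <= Rmin ((s - 1) * PI) (2 * PI) ->
     taylor_surjective s S /\ ~ taylor_injective s S) /\
  (s < 3 -> (s - 1) * PI < opening S ->
     ~ taylor_surjective s S /\ taylor_injective s S).
Proof.
split.
- intros Hop. assert (L := Rmin_l ((s - 1) * PI) (2 * PI)).
  split; [apply surjective_of_small_opening|apply not_injective_of_small_opening]; lra.
- intros _ Hop.
  split; [now apply not_surjective_of_large_opening|now apply injective_of_large_opening].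
Qed.
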